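(* Let $f:\{0,1\}^n\to\{0,1\}$ be a monotone function with $C(f)\le k$. There is an implementation of Algorithm 1 (described in the context) that with high probability makes $O(k^7\log k\log n)$ queries to $f$ and returns a certificate of size $O(k^3)$, i.e. a set $S$ such that $f$, restricted by setting the coordinates in $S$ to the bits chosen during the run of the algorithm, is a constant function.
   Context: A set $S\subseteq[n]$ is a certificate for $f$'s value on $x$ if $f(y)=f(x)$ for all $y$ agreeing with $x$ on $S$; $C(f)$ is the maximum over $x$ of the minimum size of such a certificate. $f$ is monotone if $x\le y$ coordinatewise implies $f(x)\le f(y)$. For $p\in[0,1]$, $\{0,1\}^n_p$ is the product distribution where each bit is $1$ independently with probability $p$, and $\Phi_f(p)=\mathbb{E}_{x\sim\{0,1\}^n_p}[f(x)]$. For nonconstant monotone $f$, the critical probability $p(f)\in(0,1)$ is the unique $p$ with $\Phi_f(p)=1/2$. The $p$-biased rerandomized influence of coordinate $i$ is $\mathrm{Inf}^{\sim}_{i,p}[f]=2\Pr_{x\sim\{0,1\}^n_p}[f(x)\ne f(x^{\sim i})]$, where $x^{\sim i}$ is $x$ with its $i$-th coordinate resampled from the $p$-biased bit distribution. $f_{x_i=b}$ denotes the restriction of $f$ obtained by fixing $x_i=b$. Algorithm 1 (input: query access to monotone $f$ and parameter $k$): initialize $S\leftarrow\varnothing$; while $f$ is nonconstant: find $p$ with $|p-p(f)|\le\varepsilon$ where $\varepsilon=O(1/k^3)$; estimate $\mathrm{Inf}^{\sim}_{i,p}[f]$ to additive accuracy $\pm O(1/k^2)$ for all $i$; add to $S$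 the coordinate $i$ with the largest estimate; set $f\leftarrow f_{x_i=b}$ where $b=0$ if $p\ge1/2$ and $b=1$ otherwise; finally return $S$. ''With high probability'' means with probability at least $1-1/\mathrm{poly}(n)$. *)

(* Defs.v *)
From mathcomp Require Import all_boot all_order all_algebra.
From mathcomp Require Import boolp classical_sets reals exp.

Set Implicit Arguments.
Unset Strict Implicit.
Unset Printing Implicit Defensive.

Import Order.TTheory GRing.Theory Num.Theory.

Local Open Scope ring_scope.

Section BooleanFunctions.
Variable n : nat.

Definition cube := {ffun 'I_n -> bool}.

Implicit Types (f : cube -> bool) (x y : cube) (S : {set 'I_n}).

Definition monotone f : Prop :=
  forall x y, (forall i, x i ==> y i) -> f x ==> f y.

Definition is_constant f : Prop := forall x y, f x = f y.

Definition is_certificate f x S : bool :=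
  [forall y : cube, [forall i in S, y i == x i] ==> (f y == f x)].

(* The full set is always a certificate, so the arg min is over a nonempty
   family. *)
Definition cert_at f x : nat :=
  #|[arg min_(S < [set: 'I_n]%SET | is_certificate f x S) #|S| ]|.

Definition cert_complexity f : nat := (\max_(x : cube) cert_at f x)%N.

Definition set_coord x (i : 'I_n) (b : bool) : cube :=
  [ffun j => if j == i then b else x j].

(* Restrictions remain functions on all n coordinates; they just ignore the
   fixed ones. *)
Definition restrict f (i : 'I_n) (b : bool) : cube -> bool :=
  fun x => f (set_coord x i b).

Definition restrict_set f S (z : cube) : cube -> bool :=
  fun x => f [ffun i => if i \in S then z i else x i].

Section Biased.
Variable R : realType.
Implicit Types p : R.

Definition bit_prob p (b : bool) : R := if b then p else 1 - p.

Definition cube_prob p x : R := \prod_(i < n) bit_prob p (x i).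

Definition Phi f p : R := \sum_(x : cube) cube_prob p x * (f x)%:R.

(* For nonconstant monotone f the set below is a singleton; the default value 0
   is irrelevant. *)
Definition crit_prob f : R :=
  xget 0 [set p : R | 0 < p < 1 /\ Phi f p = 2^-1]%classic.

Definition rerand_inf f p (i : 'I_n) : R :=
  2 * \sum_(x : cube) \sum_(b : bool)
        cube_prob p x * bit_prob p b * (f x != f (set_coord x i b))%:R.

End Biased.
End BooleanFunctions.

Section RandomizedQueryPrograms.
Variable n : nat.

(* Adaptive randomized programs with query access to an unknown function on the
   cube: [Rand m c] draws a uniform element of {0, ..., m} and [Query x c] reads
   the value of the function at x. *)
Inductive qprog (A : Type) : Type :=
| Ret of A
| Query of cube n & (bool -> qprog A)
| Rand (m : nat) of ('I_m.+1 -> qprog A).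

Fixpoint bind (A B : Type) (P : qprog A) (K : A -> qprog B) : qprog B :=
  match P with
  | Ret a => K a
  | Query x c => Query x (fun b => bind (c b) K)
  | Rand m c => Rand (fun j : 'I_m.+1 => bind (c j) K)
  end.

(* [run_prob R f E q P] is the probability, over the internal randomness of P
   run on f after q queries have been made, that the returned value a and the
   total number q' of queries satisfy E a q'. *)
Fixpoint run_prob (R : realType) (A : Type) (f : cube n -> bool)
    (E : A -> nat -> Prop) (q : nat) (P : qprog A) : R :=
  match P with
  | Ret a => (`[< E a q >])%:R
  | Query x c => run_prob R f E q.+1 (c (f x))
  | Rand m c => (\sum_(j < m.+1) run_prob R f E q (c j)) / m.+1%:R
  end.

End RandomizedQueryPrograms.
Arguments Ret {n A}.
Arguments Query {n A}.
Arguments Rand {n A}.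

Section GreedyCertification.
Variables (R : realType) (n : nat).

(* One pass through the loop body: the value found for the critical probability,
   the influence estimates, the selected coordinate and the bit it is set to. *)
Record round := Round {
  r_p : R;
  r_est : 'I_n -> R;
  r_coord : 'I_n;
  r_bit : bool }.

(* Subroutines left open by the pseudocode. Each may query the original function,
   knows the rounds performed so far (hence the current restriction), and may
   read and update a private memory. A terminating program needs a bound on the
   number of passes; a run cut off by [max_rounds] before the function became
   constant is not an [accurate_run]. *)
Record implementation := Implementation {
  memory : Type;
  init_memory : memory;
  max_rounds : nat;
  test_nonconstant : memory -> seq round -> qprog n (bool * memory);
  find_crit : memory -> seq round -> qprog n (R * memory);
  estimate_inf : memory -> seq round -> R -> qprog n (('I_n -> R) * memory) }.

Definition largest (e : 'I_n -> R) : option 'I_n :=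
  [pick i | [forall j, e j <= e i]].

(* [largest] is None only for n = 0. *)
Fixpoint main_loop (I : implementation) (fuel : nat) (s : memory I)
    (t : seq round) : qprog n (seq round) :=
  if fuel is fuel'.+1 then
    bind (test_nonconstant s t) (fun '(nonconst, s1) =>
    if nonconst then
      bind (find_crit s1 t) (fun '(p, s2) =>
      bind (estimate_inf s2 t p) (fun '(e, s3) =>
      if largest e is Some i then
        main_loop fuel' s3 (rcons t (Round p e i (p < 2^-1)))
      else Ret t))
    else Ret t)
  else Ret t.

Definition algorithm (I : implementation) : qprog n (seq round) :=
  main_loop (max_rounds I) (init_memory I) [::].

(* The subroutines answered correctly, up to the additive errors eps and del,
   throughout the run t on f. *)
Fixpoint accurate_run (eps del : R) (f : cube n -> bool) (t : seq round) : Prop :=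
  match t with
  | [::] => is_constant f
  | r :: t' =>
      [/\ ~ is_constant f,
          0 <= r_p r <= 1 /\ `|r_p r - crit_prob R f| <= eps,
          forall i, `|r_est r i - rerand_inf f (r_p r) i| <= del
        & accurate_run eps del (restrict f (r_coord r) (r_bit r)) t']
  end.

Definition returned_set (t : seq round) : {set 'I_n} :=
  [set i in map r_coord t].

(* If a coordinate is selected twice, the first bit prevails: later restrictions
   of an already fixed coordinate have no effect. *)
Definition chosen_bits (t : seq round) : cube n :=
  [ffun i => if [seq r <- t | r_coord r == i] is r :: _ then r_bit r else false].

End GreedyCertification.

(* Main.v *)
(*
  Let c be the critical probability of the current restriction f.  The
  inequality of O'Donnell, Saks, Schramm and Servedio, applied to the decision
  tree of depth k^2 obtained by querying certificates, yields a coordinate of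
  influence Omega(1/k^2) at c.  Fixing it changes Phi by Omega(1/k^2), and
  Phi' <= k by Russo's formula, so c moves away from 1/2 by Omega(1/k^3); hence
  there are O(k^3) rounds.  By monotonicity Inf_i = 4 E[f(x) (x_i - p)], so
  O(k^4 log n) samples per round estimate all influences simultaneously.

  Locating c to within O(1/k^3) afresh in each round would cost k^6 samples per
  round, which is too much.  Instead Phi is compared, on common random
  thresholds, with an earlier restriction (the reference) whose Phi is known
  precisely.  Since Phi'(p)/p^k decreases and Phi'(p)/(1-p)^k increases, Phi' is
  stable at distance O(p(1-p)/k), so as long as c stays in such a window around
  the reference, the variance of the difference is O(Phi'(c)/k) and
  O(k^5/Phi'(c)) samples are enough.  As c moves by Omega(1/(k^2 Phi'(c))) in
  each round, this is k^7 times the distance travelled.  A new reference is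
  taken when c leaves the window; its cost is also k^7 times the distance
  travelled.  All queries are thus paid for by the total movement of c, which is
  at most 1.  The binary search over thresholds contributes the factor log k,
  and log n comes from the failure probability.
*)

Require Import Defs.
From mathcomp Require Import all_boot all_order all_algebra.
From mathcomp Require Import boolp classical_sets reals exp.
From mathcomp Require Import sequences polyrcf ring lra.

Set Implicit Arguments.
Unset Strict Implicit.
Unset Printing Implicit Defensive.

Import Order.TTheory GRing.Theory Num.Theory.

Local Open Scope ring_scope.

(** * Biased expectations *)

(** The obstacle is that the right sample size depends on Phi'(c), which is unknown. It is measured
    indirectly: the levels of Phi at distance alpha = 1/(1024 k^2) from 1/2 cut out a window around
    c of width about alpha/Phi'(c), which O(k^4) samples, up to logarithms, suffice to find. The
    width sets the sample size of the fine search, and it is at most a constant times the last move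
    of c. A reference stays useful because all bits set after it are equal: one step takes c away
    from 1/2 by more than the locating error, so the direction never flips. Restriction and
    reference are then pointwise comparable, and the second moment of their difference is controlled
    by differences of Phi. The precision needed for a reference, O(Phi'(c)/k^3), is again unknown,
    but the Poincare inequality gives 4 c (1-c) Phi'(c) >= 1 at Phi = 1/2, so an error O(1/(k^3 c
    (1-c))) is enough. On common thresholds a binary search sees a monotone empirical mean, so only
    the two grid points that bracket the target level have to behave; there is no union bound over
    the grid. *)

Section Expectation.
Variables (R : realType) (n : nat).
Implicit Types (p : R) (x y : cube n) (G H : cube n -> R) (i : 'I_n).

Definition Ex p G : R := \sum_(x : cube n) cube_prob p x * G x.

Lemma bit_prob_ge0 p b : 0 <= p <= 1 -> 0 <= bit_prob p b.
Proof. by case/andP=> p0 p1; case: b; rewrite /= ?subr_ge0. Qed.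

Lemma sum_bool (F : bool -> R) : \sum_(b : bool) F b = F true + F false.
Proof. by rewrite big_bool. Qed.

Lemma cube_prob_ge0 p x : 0 <= p <= 1 -> 0 <= cube_prob p x.
Proof. by move=> hp; apply: prodr_ge0 => i _; apply: bit_prob_ge0. Qed.

Lemma Ex_prod p (F : 'I_n -> bool -> R) :
  Ex p (fun x => \prod_i F i (x i)) =
  \prod_i (p * F i true + (1 - p) * F i false).
Proof.
under [RHS]eq_bigr => i _ do
  rewrite -(sum_bool (fun b => bit_prob p b * F i b)).
rewrite bigA_distr_bigA; apply: eq_bigr => x _.
by rewrite -big_split.
Qed.

Lemma Ex_cst p (a : R) : Ex p (fun=> a) = a.
Proof.
suff h : Ex p (fun=> 1) = 1 by rewrite /Ex -mulr_suml -[RHS]mul1r -[in RHS]h /Ex;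
  under [in RHS]eq_bigr do rewrite mulr1.
have := Ex_prod p (fun _ _ => 1).
under [RHS]eq_bigr => i _ do rewrite !mulr1 subrKC.
rewrite [in RHS]big1_eq => h; rewrite -[RHS]h; apply: eq_bigr => x _.
by congr (_ * _); rewrite big1_eq.
Qed.

Lemma eq_Ex p G H : G =1 H -> Ex p G = Ex p H.
Proof. by move=> e; apply: eq_bigr => x _; rewrite e. Qed.

Lemma ExD p G H : Ex p (fun x => G x + H x) = Ex p G + Ex p H.
Proof. by rewrite -big_split; apply: eq_bigr => x _; rewrite mulrDr. Qed.

Lemma ExZ p a G : Ex p (fun x => a * G x) = a * Ex p G.
Proof. by rewrite /Ex mulr_sumr; apply: eq_bigr => x _; rewrite mulrCA. Qed.

Lemma ExN p G : Ex p (fun x => - G x) = - Ex p G.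
Proof. by rewrite -mulN1r -ExZ; apply: eq_Ex => x; rewrite mulN1r. Qed.

Lemma ExB p G H : Ex p (fun x => G x - H x) = Ex p G - Ex p H.
Proof. by rewrite ExD ExN. Qed.

Lemma Ex_sum p (I : finType) (F : I -> cube n -> R) :
  Ex p (fun x => \sum_i F i x) = \sum_i Ex p (F i).
Proof.
rewrite /Ex exchange_big; apply: eq_bigr => x _; exact: mulr_sumr.
Qed.

Lemma le_Ex p G H : 0 <= p <= 1 -> (forall x, G x <= H x) -> Ex p G <= Ex p H.
Proof.
by move=> hp le; apply: ler_sum => x _; rewrite ler_wpM2l ?cube_prob_ge0.
Qed.

Lemma Ex_ge0 p G : 0 <= p <= 1 -> (forall x, 0 <= G x) -> 0 <= Ex p G.
Proof. by move=> hp h; rewrite -(Ex_cst p 0) le_Ex. Qed.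

Lemma PhiE (f : cube n -> bool) p : Phi f p = Ex p (fun x => (f x)%:R).
Proof. by []. Qed.

Lemma set_coord_eq x i b : set_coord x i b i = b.
Proof. by rewrite ffunE eqxx. Qed.

Lemma set_coord_neq x i b j : j != i -> set_coord x i b j = x j.
Proof. by move=> /negPf h; rewrite ffunE h. Qed.

Lemma set_coord_id x i : set_coord x i (x i) = x.
Proof. by apply/ffunP => j; rewrite ffunE; case: eqP => [->|]. Qed.

Lemma set_coord2 x i b c : set_coord (set_coord x i b) i c = set_coord x i c.
Proof. by apply/ffunP => j; rewrite !ffunE; case: eqP. Qed.

Definition cube_prob_off p i x : R := \prod_(j | j != i) bit_prob p (x j).

Lemma cube_probE p i x :
  cube_prob p x = bit_prob p (x i) * cube_prob_off p i x.
Proof. by rewrite /cube_prob (bigD1 i). Qed.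

Lemma cube_prob_off_set p i x b :
  cube_prob_off p i (set_coord x i b) = cube_prob_off p i x.
Proof. by apply: eq_bigr => j ji; rewrite set_coord_neq. Qed.

(** Written as a sum over half of the cube so that [Ex_cond] and [russo] can compare the halves term
    by term. *)
Lemma Ex_set_coord p i b G :
  Ex p (fun x => G (set_coord x i b)) =
  \sum_(x : cube n | x i == b) cube_prob_off p i x * G x.
Proof.
have half a : \sum_(x : cube n | x i == a) cube_prob p x * G (set_coord x i b) =
    bit_prob p a * \sum_(x : cube n | x i == b) cube_prob_off p i x * G x.
  rewrite (reindex_onto (fun x => set_coord x i a) (fun x => set_coord x i b)) /=.
    rewrite mulr_sumr; apply: eq_big => x.
      rewrite set_coord_eq eqxx set_coord2 /=.
      apply/eqP/eqP => [<-|<-]; [exact: set_coord_eq|exact: set_coord_id].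
    move=> /andP[_ /eqP e].
    by rewrite (cube_probE _ i) set_coord_eq cube_prob_off_set e mulrA.
  by move=> x /eqP <-; rewrite set_coord2 set_coord_id.
rewrite /Ex (bigID (fun x : cube n => x i == true)) /=.
under [X in _ + X]eq_bigl => x do rewrite eqb_id -eqbF_neg.
by rewrite !half -mulrDl /= subrKC mul1r.
Qed.

Lemma Ex_cond p i G :
  Ex p G = p * Ex p (fun x => G (set_coord x i true)) +
           (1 - p) * Ex p (fun x => G (set_coord x i false)).
Proof.
rewrite !Ex_set_coord /Ex (bigID (fun x : cube n => x i == true)) /=.
under [X in _ + X]eq_bigl => x do rewrite eqb_id -eqbF_neg.
rewrite !mulr_sumr; congr (_ + _);
by apply: eq_bigr => x /eqP e; rewrite (cube_probE _ i) e mulrA.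
Qed.

Definition overwrite (v : bool) x (z : cube n) : cube n :=
  [ffun i => if z i then v else x i].

(** Overwriting with [v] on a random set of density [t] is a monotone coupling of the biases p and t
    v + (1-t) p. The stability of Phi' is derived from it. *)
Lemma Ex_overwrite p t v G :
  Ex p (fun x => Ex t (fun z => G (overwrite v x z))) =
  Ex (t * v%:R + (1 - t) * p) G.
Proof.
set q := (X in Ex X G).
transitivity (\sum_(u : {ffun 'I_n -> bool * bool})
    (\prod_i (bit_prob p (u i).1 * bit_prob t (u i).2)) *
    G [ffun i => if (u i).2 then v else (u i).1]).
  rewrite /Ex; under eq_bigr => x _ do rewrite mulr_sumr.
  rewrite pair_big /=.
  rewrite (reindex (fun u : {ffun 'I_n -> bool * bool} =>
    ([ffun i => (u i).1] : cube n, [ffun i => (u i).2] : cube n))) /=; last first.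
    exists (fun w : cube n * cube n => [ffun i => (w.1 i, w.2 i)]) => [u|[x z]] _.
      by apply/ffunP => i; rewrite !ffunE; case: (u i).
    by congr pair; apply/ffunP => i; rewrite !ffunE.
  apply: eq_bigr => u _; rewrite mulrA big_split /=; congr (_ * _ * _).
  - by apply: eq_bigr => i _; rewrite ffunE.
  - by apply: eq_bigr => i _; rewrite ffunE.
  - by congr G; apply/ffunP => i; rewrite !ffunE.
rewrite (partition_big
  (fun u : {ffun 'I_n -> bool * bool} => [ffun i => if (u i).2 then v else (u i).1])
  predT) //=.
rewrite /Ex; apply: eq_bigr => y _.
rewrite -[RHS]mulr1.
under eq_bigr => u /eqP e do rewrite e.
rewrite -mulr_suml mulr1; congr (_ * _).
transitivity (\prod_i \sum_(a : bool * bool | (if a.2 then v else a.1) == y i)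
    (bit_prob p a.1 * bit_prob t a.2)).
  rewrite bigA_distr_big_dep; apply: eq_bigl => u.
  apply/eqP/familyP => [<- i|h]; first by rewrite unfold_in ffunE.
  by apply/ffunP => i; rewrite ffunE; apply/eqP; move: (h i); rewrite unfold_in.
apply: eq_bigr => i _; rewrite big_mkcond -(pair_bigA _ (fun a b =>
  if (if b then v else a) == y i then bit_prob p a * bit_prob t b else 0)) /=.
rewrite !big_bool /= /q.
by case: (y i); case: v {q} => /=; ring.
Qed.

End Expectation.

(** * Influences and certificates *)

Section Influence.
Variables (R : realType) (n : nat).
Implicit Types (p : R) (x y : cube n) (i : 'I_n) (f : cube n -> bool).

Definition pivotal f i x := f (set_coord x i true) && ~~ f (set_coord x i false).

Definition pivot_prob f p i : R := Ex p (fun x => (pivotal f i x)%:R).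

Lemma pivot_prob_ge0 f p i : 0 <= p <= 1 -> 0 <= pivot_prob f p i.
Proof. by move=> hp; apply: Ex_ge0. Qed.

Lemma set_coord_mono f i x : monotone f ->
  f (set_coord x i false) ==> f (set_coord x i true).
Proof.
by move=> mf; apply: mf => j; rewrite !ffunE; case: eqP => //; rewrite implybb.
Qed.

Lemma pivotalE f i x : monotone f ->
  (pivotal f i x)%:R =
  (f (set_coord x i true))%:R - (f (set_coord x i false))%:R :> R.
Proof.
move=> mf; rewrite /pivotal; have := set_coord_mono i x mf.
by case: (f _); case: (f _) => //= _; rewrite ?subrr ?subr0.
Qed.

Lemma Phi_cond f p i : Phi f p =
  p * Phi (restrict f i true) p + (1 - p) * Phi (restrict f i false) p.
Proof. by rewrite !PhiE (Ex_cond _ i). Qed.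

Lemma pivot_probE f p i : monotone f ->
  pivot_prob f p i = Phi (restrict f i true) p - Phi (restrict f i false) p.
Proof. by move=> mf; rewrite !PhiE -ExB; apply: eq_Ex => x; exact: pivotalE. Qed.

Lemma Phi_restrict f p i b : monotone f ->
  Phi (restrict f i b) p =
  Phi f p + (if b then 1 - p else - p) * pivot_prob f p i.
Proof.
by move=> mf; rewrite (pivot_probE _ _ mf) (Phi_cond f p i); case: b; ring.
Qed.

Lemma rerand_infEx f p i : rerand_inf f p i =
  2 * (p * Ex p (fun x => (f x != f (set_coord x i true))%:R) +
       (1 - p) * Ex p (fun x => (f x != f (set_coord x i false))%:R)).
Proof.
rewrite /rerand_inf; congr (_ * _).
under eq_bigr do rewrite big_bool.
rewrite big_split /= /Ex !mulr_sumr.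
by congr (_ + _); apply: eq_bigr => x _; rewrite mulrCA mulrA.
Qed.

(** Resampling changes the value when [i] is pivotal and the new bit differs, that is with
    probability 2 p (1-p) times that of being pivotal. *)
Lemma rerand_infE f p i : monotone f ->
  rerand_inf f p i = 4 * (p * (1 - p) * pivot_prob f p i).
Proof.
move=> mf; rewrite rerand_infEx /pivot_prob.
have h b : Ex p (fun x => (f x != f (set_coord x i b))%:R) =
    (if b then 1 - p else p) * Ex p (fun x => (pivotal f i x)%:R).
  rewrite (Ex_cond _ i).
  under eq_Ex => x do rewrite set_coord2.
  under [X in _ + _ * X]eq_Ex => x do rewrite set_coord2.
  case: b.
    under eq_Ex => x do rewrite eqxx.
    rewrite Ex_cst mulr0 add0r; congr (_ * _); apply: eq_Ex => x.
    have := set_coord_mono i x mf; rewrite /pivotal.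
    by case: (f _); case: (f _).
  under [X in _ + _ * X]eq_Ex => x do rewrite eqxx.
  rewrite Ex_cst mulr0 addr0; congr (_ * _); apply: eq_Ex => x.
  have := set_coord_mono i x mf; rewrite /pivotal.
  by case: (f _); case: (f _).
by rewrite !h; ring.
Qed.

Lemma rerand_inf_corr f p i : monotone f ->
  rerand_inf f p i = 4 * Ex p (fun x => (f x)%:R * ((x i)%:R - p)).
Proof.
move=> mf; rewrite rerand_infE // (Ex_cond _ i).
under [X in _ = _ * (_ * X + _)]eq_Ex => x do rewrite set_coord_eq mulrC.
under [X in _ = _ * (_ + _ * X)]eq_Ex => x do rewrite set_coord_eq mulrC.
by rewrite !ExZ pivot_probE // !PhiE /= /restrict; ring.
Qed.

Lemma rerand_inf_ge0 f p i : 0 <= p <= 1 -> 0 <= rerand_inf f p i.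
Proof.
move=> hp; rewrite rerand_infEx; have /andP[p0 p1] := hp.
by rewrite mulr_ge0 // addr_ge0 // mulr_ge0 ?subr_ge0 ?Ex_ge0.
Qed.

(* Phi drops by [p D_i] or rises by [(1-p) D_i], while [Inf = 4 p (1-p) D_i]. *)
Lemma Phi_restrict_gap f p i b : monotone f -> 0 <= p <= 1 ->
  if b then Phi f p + rerand_inf f p i / 4 <= Phi (restrict f i b) p
  else Phi (restrict f i b) p <= Phi f p - rerand_inf f p i / 4.
Proof.
move=> mf hp; rewrite (Phi_restrict p i b mf) (rerand_infE _ _ mf).
have := pivot_prob_ge0 f i hp; case/andP: hp => p0 p1.
move: (pivot_prob f p i) => D D0.
have h1 : 0 <= p * p * D by rewrite !mulr_ge0.
have h2 : 0 <= (1 - p) * (1 - p) * D by rewrite !mulr_ge0 // subr_ge0.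
by case: b; lra.
Qed.

End Influence.

Section Certificates.
Variable n : nat.
Implicit Types (x y : cube n) (i : 'I_n) (f g : cube n -> bool) (S : {set 'I_n}).

Definition certs_le k f :=
  forall x, exists2 S : {set 'I_n}, is_certificate f x S & (#|S| <= k)%N.

Lemma certP f x S :
  reflect (forall y, {in S, y =1 x} -> f y = f x) (is_certificate f x S).
Proof.
apply: (iffP forallP) => [h y e|h y].
  have /implyP/(_ _)/eqP := h y; apply; apply/forall_inP => i iS.
  by rewrite e.
apply/implyP => /forall_inP e; apply/eqP/h => i iS; exact/eqP/e.
Qed.

Lemma certs_complexity f k : (cert_complexity f <= k)%N -> certs_le k f.
Proof.
move=> h x; exists [arg min_(S < [set: 'I_n]%SET | is_certificate f x S) #|S| ].
  case: arg_minnP => //; apply/certP => y e; congr f; apply/ffunP => i.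
  by rewrite e ?inE.
by apply: leq_trans h; exact: (@leq_bigmax _ (cert_at f) x).
Qed.

Lemma monotone_restrict f i b : monotone f -> monotone (restrict f i b).
Proof.
by move=> mf x y le; apply: mf => j; rewrite !ffunE; case: eqP => // _; case: b.
Qed.

Lemma certs_restrict k f i b : certs_le k f -> certs_le k (restrict f i b).
Proof.
move=> cf x; have [S /certP hS cS] := cf (set_coord x i b); exists S => //.
apply/certP => y e; apply: hS => j jS; rewrite !ffunE; case: eqP => // _.
exact: e.
Qed.

Lemma pivotal_certificate f i x S : is_certificate f x S -> pivotal f i x -> i \in S.
Proof.
move=> /certP hS; apply: contraTT => iS.
have e b : f (set_coord x i b) = f x.
  by apply: hS => j jS; rewrite set_coord_neq //; apply: contraNneq iS => <-.
by rewrite /pivotal !e andbN.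
Qed.

(** Every certificate of [x] contains all coordinates pivotal at [x]. With Russo's formula this
    becomes Phi' <= k. *)
Lemma sum_pivotal_le (R : realType) k f x : certs_le k f ->
  \sum_i (pivotal f i x)%:R <= k%:R :> R.
Proof.
move=> cf; have [S hS cS] := cf x.
rewrite -natr_sum ler_nat; apply: leq_trans cS.
rewrite -sum1_card [leqRHS]big_mkcond; apply: leq_sum => i _.
by case: (boolP (pivotal f i x)) => [/(pivotal_certificate hS) ->|].
Qed.

Definition cube0 : cube n := [ffun=> false].
Definition cube1 : cube n := [ffun=> true].

Lemma nonconstant_monotone f : monotone f -> ~ is_constant f ->
  f cube0 = false /\ f cube1 = true.
Proof.
move=> mf nc.
have h0 x : f cube0 ==> f x by apply: mf => i; rewrite ffunE.
have h1 x : f x ==> f cube1 by apply: mf => i; rewrite ffunE implybT.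
case E0: (f cube0); case E1: (f cube1); split=> //; case: nc => x y;
  move: (h0 x) (h0 y) (h1 x) (h1 y); rewrite E0 E1 ?implybF /=;
  by case: (f x); case: (f y).
Qed.

Lemma constant_monotone f : monotone f -> f cube0 = f cube1 -> is_constant f.
Proof.
move=> mf e; apply: contrapT => nc.
by have [h0 h1] := nonconstant_monotone mf nc; rewrite h0 h1 in e.
Qed.

End Certificates.

(** * Decision trees and influential coordinates *)

Section DecisionTrees.
Variables (R : realType) (n : nat).
Implicit Types (p : R) (x y : cube n) (i : 'I_n) (f g : cube n -> bool).

Inductive dtree := Leaf | Node of 'I_n & dtree & dtree.
Implicit Type T : dtree.

Definition branch (b : bool) T0 T1 : dtree := if b then T1 else T0.

Fixpoint queries i T : bool :=
  if T is Node j T0 T1 then [|| i == j, queries i T0 | queries i T1] else false.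

Fixpoint read_once T : bool :=
  if T is Node j T0 T1 then
    [&& ~~ queries j T0, ~~ queries j T1, read_once T0 & read_once T1]
  else true.

Fixpoint depth T : nat :=
  if T is Node _ T0 T1 then (maxn (depth T0) (depth T1)).+1 else 0.

(** The point that agrees with [x] on what [T] queries along the path of [x], and with [y]
    elsewhere. *)
Fixpoint hybrid T x y : cube n :=
  if T is Node i T0 T1 then
    set_coord (hybrid (branch (x i) T0 T1) x y) i (x i)
  else y.

(** [T] computes [f]; in this form the leaves need no labels. *)
Definition determines T f := forall x y, f (hybrid T x y) = f x.

(** The worst path replaces the query probabilities of the usual inequality. It serves both trees of
    bounded depth and the tree that queries everything. *)
Fixpoint tree_cost (w : 'I_n -> R) T : R :=
  if T is Node i T0 T1 then w i + Num.max (tree_cost w T0) (tree_cost w T1)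
  else 0.

Lemma hybrid_set T i b x y : ~~ queries i T ->
  hybrid T (set_coord x i b) y = hybrid T x y.
Proof.
elim: T => //= j T0 IH0 T1 IH1; rewrite !negb_or => /and3P[ij q0 q1].
rewrite set_coord_neq 1?eq_sym //; congr (set_coord _ _ _).
by case: (x j) => /=; auto.
Qed.

Lemma Ex_branch p i T0 T1 (F : dtree -> bool -> cube n -> R) :
  (forall b x c, F (branch b T0 T1) b (set_coord x i c) = F (branch b T0 T1) b x) ->
  Ex p (fun x => F (branch (x i) T0 T1) (x i) x) =
  p * Ex p (F T1 true) + (1 - p) * Ex p (F T0 false).
Proof.
move=> hF; rewrite (Ex_cond _ i).
by congr (_ * _ + _ * _); apply: eq_Ex => x; rewrite set_coord_eq hF.
Qed.

(* Each queried value is fresh given the tree path that led to it. *)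
Lemma Ex_hybrid p T (G : cube n -> R) : read_once T ->
  Ex p (fun x => Ex p (fun y => G (hybrid T x y))) = Ex p G.
Proof.
elim: T G => [|i T0 IH0 T1 IH1] G /=; first by rewrite Ex_cst.
case/and4P => q0 q1 r0 r1.
rewrite (@Ex_branch p i T0 T1 (fun T b x =>
  Ex p (fun y => G (set_coord (hybrid T x y) i b)))).
  rewrite (IH1 (fun w => G (set_coord w i true))) //.
  by rewrite (IH0 (fun w => G (set_coord w i false))) // -Ex_cond.
by move=> b x c; apply: eq_Ex => y; rewrite hybrid_set //; case: b.
Qed.

(** Induction on the tree: by [Ex_hybrid] the hybrid of a subtree is p-biased, so putting in the bit
    of the root changes [f] as often as fixing that coordinate of a random point does. Averaged over
    the bit, this is half of [rerand_inf]. *)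
Lemma hybrid_disagreement p T f : 0 <= p <= 1 -> read_once T ->
  Ex p (fun x => Ex p (fun y => (f (hybrid T x y) != f y)%:R)) <=
  tree_cost (fun i => rerand_inf f p i / 2) T.
Proof.
move=> hp; have /andP[p0 p1] := hp; elim: T => [|i T0 IH0 T1 IH1] /=.
  by move=> _; under eq_Ex => x do under eq_Ex => y do rewrite eqxx; rewrite !Ex_cst.
case/and4P => q0 q1 r0 r1.
rewrite (@Ex_branch p i T0 T1 (fun T b x =>
  Ex p (fun y => (f (set_coord (hybrid T x y) i b) != f y)%:R))); last first.
  by move=> b x c; apply: eq_Ex => y; rewrite hybrid_set //; case: b.
have step b T : read_once T ->
    Ex p (fun x => Ex p (fun y => (f (set_coord (hybrid T x y) i b) != f y)%:R)) <=
    Ex p (fun w => (f w != f (set_coord w i b))%:R) +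
    Ex p (fun x => Ex p (fun y => (f (hybrid T x y) != f y)%:R)) :> R.
  move=> rT.
  rewrite -(Ex_hybrid p (fun w => (f w != f (set_coord w i b))%:R) rT) -ExD; apply: le_Ex => // x.
  rewrite -ExD; apply: le_Ex => // y; rewrite -natrD ler_nat.
  by case: (f _); case: (f _); case: (f _).
set m := Num.max _ _.
have m1 : tree_cost (fun i => rerand_inf f p i / 2) T1 <= m.
  by rewrite le_max lexx orbT.
have m0 : tree_cost (fun i => rerand_inf f p i / 2) T0 <= m.
  by rewrite le_max lexx.
have q0' : 0 <= 1 - p by rewrite subr_ge0.
have s1 := ler_wpM2l p0 (le_trans (step true T1 r1) (lerD (lexx _) (le_trans (IH1 r1) m1))).
have s0 := ler_wpM2l q0' (le_trans (step false T0 r0) (lerD (lexx _) (le_trans (IH0 r0) m0))).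
apply: le_trans (lerD s1 s0) _.
by rewrite rerand_infEx le_eqVlt; apply/orP; left; apply/eqP; field.
Qed.

(** Here [f (hybrid T x y)] is [f x], and two independent points disagree with probability 2 Phi (1
    - Phi). *)
Lemma determined_variance p T f : 0 <= p <= 1 -> read_once T -> determines T f ->
  2 * (Phi f p * (1 - Phi f p)) <= tree_cost (fun i => rerand_inf f p i / 2) T.
Proof.
move=> hp rT dT; apply: le_trans (hybrid_disagreement f hp rT).
rewrite le_eqVlt; apply/orP; left; apply/eqP.
transitivity (Ex p (fun x => Phi f p + (f x)%:R * (1 - 2 * Phi f p))).
  rewrite ExD Ex_cst; under [X in _ = _ + X]eq_Ex => x do rewrite mulrC.
  by rewrite ExZ -PhiE; ring.
apply: eq_Ex => x.
under [RHS]eq_Ex => y do rewrite dT.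
case: (f x) => /=.
  rewrite mul1r; transitivity (1 - Phi f p); first by ring.
  rewrite -{1}(Ex_cst n p 1) PhiE -ExB; apply: eq_Ex => y.
  by case: (f y); rewrite /= ?subrr ?subr0.
by rewrite mul0r addr0 PhiE; apply: eq_Ex => y; case: (f y).
Qed.

Lemma tree_cost_depth (w : 'I_n -> R) (M : R) T : (forall i, w i <= M) -> 0 <= M ->
  tree_cost w T <= (depth T)%:R * M.
Proof.
move=> wM M0; elim: T => [|i T0 IH0 T1 IH1] /=; first by rewrite mul0r.
rewrite -natr1 mulrDl mul1r addrC lerD // ge_max.
apply/andP; split; [apply: le_trans IH0 _|apply: le_trans IH1 _];
  by rewrite ler_wpM2r // ler_nat leq_max leqnn ?orbT.
Qed.

Lemma all_queries_tree (w : 'I_n -> R) f :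
  exists T, [/\ read_once T, determines T f & tree_cost w T = \sum_i w i].
Proof.
pose T (s : seq 'I_n) := foldr (fun i U => Node i U U) Leaf s.
have Tq s i : queries i (T s) = (i \in s).
  by elim: s => //= j s IH; rewrite inE IH orbb.
have Th s x y i : i \in s -> hybrid (T s) x y i = x i.
  elim: s => //= j s IH; rewrite inE /branch if_same.
  by case: (eqVneq i j) => [-> _|ij /= /IH e]; rewrite ?set_coord_eq // set_coord_neq.
exists (T (enum 'I_n)); split.
- elim: (enum _) (enum_uniq 'I_n) => //= i s IH /andP[is_ us].
  by rewrite !Tq is_ /= IH.
- by move=> x y; congr f; apply/ffunP => i; rewrite Th // mem_enum.
rewrite -big_enum; elim: (enum _) => [|i s IH] /=; first by rewrite big_nil.
by rewrite big_cons maxxx IH.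
Qed.

(** [A] collects the coordinates queried higher up; avoiding them keeps the tree [read_once]. *)
Lemma query_block_tree f d (A : {set 'I_n}) (s : seq 'I_n) (S : {set 'I_n}) :
  uniq s -> [disjoint s & A] -> (forall i, (i \in S) = (i \in s)) ->
  (forall z, exists T, [/\ read_once T, (depth T <= d)%N,
      forall i, i \in A :|: S -> ~~ queries i T
    & determines T (restrict_set f S z)]) ->
  exists T, [/\ read_once T, (depth T <= size s + d)%N,
      forall i, i \in A -> ~~ queries i T & determines T f].
Proof.
elim: s f A S => [|i s IH] f A S us ds memS hz.
  have [T [rT dT qT dtT]] := hz (cube0 n); exists T; split=> //.
    by move=> j jA; apply: qT; rewrite inE jA.
  have e x : restrict_set f S (cube0 n) x = f x.
    by congr f; apply/ffunP => j; rewrite ffunE memS.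
  by move=> x y; rewrite -!e.
move: us => /= /andP[is_ us].
have iA : i \notin A by move: ds; rewrite disjoint_cons => /andP[].
have ds' : [disjoint s & A] by move: ds; rewrite disjoint_cons => /andP[].
have sub b : exists T, [/\ read_once T, (depth T <= size s + d)%N,
      forall j, j \in i |: A -> ~~ queries j T & determines T (restrict f i b)].
  apply: (IH (restrict f i b) (i |: A) (S :\ i)) => //.
  - rewrite disjoint_sym; apply/pred0P => j /=; rewrite !inE.
    case: eqP => [->|_] /=; first by rewrite (negPf is_).
    by have /pred0P/(_ j) /= := ds'; rewrite andbC.
  - by move=> j; rewrite !inE memS inE; case: eqP => [->|] //; rewrite (negPf is_).
  move=> z; have [T [rT dT qT dtT]] := hz (set_coord z i b).
  exists T; split=> //.
    move=> j; rewrite !inE => h; apply: qT; rewrite inE.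
    by case: eqP h => [->|_] /=; rewrite ?memS ?inE ?eqxx ?orbT.
  have e x : restrict_set (restrict f i b) (S :\ i) z x =
             restrict_set f S (set_coord z i b) x.
    congr f; apply/ffunP => j; rewrite !ffunE !inE.
    by case: eqP => [->|_] /=; rewrite ?memS ?inE ?eqxx.
  by move=> x y; rewrite !e.
have [T0 [r0 d0 q0 dt0]] := sub false.
have [T1 [r1 d1 q1 dt1]] := sub true.
exists (Node i T0 T1); split=> /=.
- by rewrite q0 ?q1 ?setU11 //= r0 r1.
- by rewrite addSn ltnS geq_max d0.
- move=> j jA; rewrite !negb_or q0 ?q1 ?inE ?jA ?orbT // !andbT.
  by apply: contraNneq iA => <-.
move=> x y; case E: (x i) => /=.
  by rewrite E; apply: etrans (dt1 x y) _; rewrite /restrict -E set_coord_id.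
by rewrite E; apply: etrans (dt0 x y) _; rewrite /restrict -E set_coord_id.
Qed.

(* A 1-certificate meets every 0-certificate, so querying one shortens all
   0-certificates of the restricted function. *)
Lemma certificate_tree k a (A : {set 'I_n}) f : certs_le k f ->
  (forall x, f x = false -> exists2 S : {set 'I_n}, is_certificate f x S & (#|S| <= a)%N) ->
  (forall i x b, i \in A -> f (set_coord x i b) = f x) ->
  exists T, [/\ read_once T, (depth T <= a * k)%N,
    forall i, i \in A -> ~~ queries i T & determines T f].
Proof.
elim: a A f => [|a IH] A f cf c0 fA.
  exists Leaf; split=> // x y /=.
  have [/existsP[w /eqP fw]|/existsPn h] := boolP [exists w, f w == false].
    have [S /certP hS] := c0 w fw; rewrite leqn0 cards_eq0 => /eqP S0.
    by rewrite !(hS _ _) // => i; rewrite S0 inE.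
  by move: (h x) (h y); case: (f x); case: (f y).
have [/existsP[w fw]|/existsPn h] := boolP [exists w, f w]; last first.
  exists Leaf; split=> // x y /=.
  by move: (h x) (h y); case: (f x); case: (f y).
have [S0 /certP hS0 cS0] := cf w.
pose S := S0 :\: A.
have eA x y : {in ~: A, x =1 y} -> f x = f y.
  move=> e.
  have gen s : {subset s <= A} -> f (foldr (fun i u => set_coord u i (y i)) x s) = f x.
    elim: s => //= i s IHs sA; rewrite fA ?sA ?mem_head // IHs // => j js.
    by apply: sA; rewrite inE js orbT.
  rewrite -(gen (enum A)); last by move=> i; rewrite mem_enum.
  congr f; apply/ffunP => i.
  have gen2 s : foldr (fun i u => set_coord u i (y i)) x s i = if i \in s then y i else x i.
    elim: s => //= j s IHs; rewrite inE; case: (eqVneq i j) => [->|ij] /=.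
      by rewrite set_coord_eq.
    by rewrite set_coord_neq.
  by rewrite gen2 mem_enum; case: ifP => // /negbT iA; apply: e; rewrite inE.
have hS y : {in S, y =1 w} -> f y = f w.
  move=> e; rewrite -(hS0 [ffun i => if i \in S0 then w i else y i]); last first.
    by move=> i iS; rewrite ffunE iS.
  apply: eA => i; rewrite inE => iA; rewrite ffunE; case: ifP => // iS.
  by apply: e; rewrite inE iS iA.
have cS : (#|S| <= k)%N by apply: leq_trans cS0; rewrite subset_leq_card ?subsetDl.
have [|||z|T [rT dT qT dtT]] := @query_block_tree f (a * k)%N A (enum S) S.
- exact: enum_uniq.
- by apply/pred0P => i /=; rewrite mem_enum inE; case: (i \in A); rewrite ?andbF.
- by move=> i; rewrite mem_enum.
- apply: IH.
  + move=> x; have [U /certP hU cU] := cf [ffun i => if i \in S then z i else x i].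
    exists U => //; apply/certP => y e; apply: hU => i iU; rewrite !ffunE.
    by case: ifP => // _; apply: e.
  + move=> x fx; have [U /certP hU cU] := c0 _ fx.
    exists (U :\: S).
      apply/certP => y e; apply: hU => i iU; rewrite !ffunE.
      by case: ifP => // iS; apply: e; rewrite inE iS iU.
    have [/exists_inP[i iU iS]|/exists_inPn dj] := boolP [exists i in U, i \in S].
      rewrite -ltnS; apply: leq_trans cU; apply: proper_card.
      rewrite properE subsetDl; apply/subsetPn; exists i => //.
      by rewrite inE iS.
    (* If [U] missed [S], this point would agree with [w] on [S] and with the extension of [x] on
       [U], and [f] would take both values there. *)
    pose y : cube n := [ffun i => if i \in S then w i else
      ([ffun i => if i \in S then z i else x i] : cube n) i].
    have e1 : f y = f w by apply: hS => i iS; rewrite ffunE iS.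
    have e2 : f y = restrict_set f S z x.
      apply: hU => i iU; rewrite [y]lock !ffunE -lock /y ffunE.
      by move: (dj i iU) => /negPf ->; rewrite !ffunE (negPf (dj i iU)).
    by rewrite -e1 e2 fx in fw.
  move=> i x b; rewrite inE /restrict_set => /orP[iA|iS].
    apply: eA => j; rewrite inE => jA; rewrite !ffunE.
    by case: ifP => // _; case: eqP => // ji; rewrite ji iA in jA.
  congr f; apply/ffunP => j; rewrite !ffunE; case: ifP => // jS.
  by case: eqP => // ji; rewrite ji iS in jS.
exists T; split=> //; apply: leq_trans dT _.
by rewrite mulSn leq_add2r -cardE.
Qed.

Lemma max_influence k f p : certs_le k f -> 0 <= p <= 1 -> forall M : R, 0 <= M ->
  (forall i, rerand_inf f p i <= M) ->
  4 * (Phi f p * (1 - Phi f p)) <= k%:R ^+ 2 * M.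
Proof.
move=> cf hp M M0 hM.
have [||T [rT dT _ dtT]] := @certificate_tree k k finset.set0 f cf.
- by move=> x _; apply: cf.
- by move=> i x b; rewrite inE.
have h := determined_variance hp rT dtT.
have M20 : 0 <= M / 2 by rewrite divr_ge0.
have h2 : tree_cost (fun i => rerand_inf f p i / 2) T <= (depth T)%:R * (M / 2).
  by apply: tree_cost_depth => // i; rewrite ler_pM2r ?hM // invr_gt0.
have h3 : (depth T)%:R * (M / 2) <= (k * k)%:R * (M / 2).
  by rewrite ler_wpM2r // ler_nat.
have := le_trans h (le_trans h2 h3); rewrite natrM expr2; lra.
Qed.

(** The tree inequality for the tree that queries everything. At Phi = 1/2 it gives Phi' >= 1/(4 p
    (1-p)). *)
Lemma poincare f p : 0 <= p <= 1 -> monotone f ->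
  Phi f p * (1 - Phi f p) <= p * (1 - p) * \sum_i pivot_prob f p i.
Proof.
move=> hp mf; have [T [rT dT cT]] := all_queries_tree (fun i => rerand_inf f p i / 2) f.
have := determined_variance hp rT dT; rewrite cT -mulr_suml.
under eq_bigr do rewrite rerand_infE //.
by rewrite -!mulr_sumr; lra.
Qed.

End DecisionTrees.

(** * The slope of Phi *)

Lemma deriv_prod_seq (R : comNzRingType) (I : eqType) (s : seq I) (F : I -> {poly R}) :
  uniq s -> (\prod_(i <- s) F i)^`() =
  \sum_(i <- s) (F i)^`() * \prod_(j <- s | j != i) F j.
Proof.
elim: s => [|a s IH] /=; first by rewrite !big_nil derivC.
move=> /andP[as_ us]; rewrite !big_cons derivM IH // eqxx /=; congr (_ * _ + _).
  rewrite [RHS]big_seq_cond [LHS]big_seq_cond; apply: eq_bigl => j.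
  by case: eqP => [->|]; rewrite ?(negPf as_) ?andbT.
rewrite mulr_sumr; apply: eq_big_seq => i is_.
rewrite big_cons; case: eqP => [ai|_] /=; first by rewrite ai is_ in as_.
by rewrite mulrCA.
Qed.

Lemma bernoulli_ineq (R : realFieldType) (t : R) m : 0 <= t <= 1 ->
  1 - m%:R * t <= (1 - t) ^+ m.
Proof.
move=> /andP[t0 t1]; elim: m => [|m IH]; first by rewrite mul0r subr0 expr0.
rewrite exprS; have h : 0 <= 1 - t by rewrite subr_ge0.
apply: le_trans (ler_wpM2l h IH); rewrite -natr1.
have : 0 <= m%:R * t * t by rewrite !mulr_ge0.
by lra.
Qed.

Section Slope.
Variables (R : realType) (n : nat).
Implicit Types (p q c t : R) (x y : cube n) (i : 'I_n) (f g : cube n -> bool).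

Definition slope f p : R := \sum_i pivot_prob f p i.

(** As a polynomial in [p], Phi has a formal derivative, a mean value theorem and intermediate
    values. *)
Definition Phi_poly f : {poly R} :=
  \sum_(x : cube n) (f x)%:R *: \prod_i (if x i then 'X else 1 - 'X).

Lemma horner_Phi f p : (Phi_poly f).[p] = Phi f p.
Proof.
rewrite /Phi_poly horner_sum; apply: eq_bigr => x _.
rewrite hornerZ horner_prod mulrC; congr (_ * _); apply: eq_bigr => i _.
by case: (x i); rewrite !hornerE.
Qed.

(** Differentiating the factor of [i] leaves a sign and the weight of the other coordinates; the two
    halves of the cube then give the two restrictions. *)
Lemma russo f p : monotone f -> (Phi_poly f)^`().[p] = slope f p.
Proof.
move=> mf; rewrite /Phi_poly linear_sum horner_sum /=.
transitivity (\sum_(x : cube n) \sum_i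
  (f x)%:R * ((if x i then 1 else -1) * cube_prob_off p i x)).
  apply: eq_bigr => x _; rewrite derivZ hornerZ -mulr_sumr; congr (_ * _).
  rewrite -[\prod_i _]big_enum deriv_prod_seq ?enum_uniq // big_enum horner_sum /=.
  apply: eq_bigr => i _; rewrite hornerM big_enum_cond horner_prod; congr (_ * _).
    by case: (x i); rewrite !derivE ?hornerE // sub0r !hornerE.
  by apply: eq_bigr => j _; case: (x j); rewrite !hornerE.
rewrite exchange_big; apply: eq_bigr => i _.
rewrite pivot_probE // !PhiE /restrict.
rewrite (Ex_set_coord p i true (fun x => (f x)%:R)).
rewrite (Ex_set_coord p i false (fun x => (f x)%:R)).
rewrite (bigID (fun x : cube n => x i == true)) /= -sumrN; congr (_ + _).
  by apply: eq_bigr => x /eqP ->; rewrite mul1r mulrC.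
under eq_bigl => x do rewrite eqb_id -eqbF_neg.
by apply: eq_bigr => x /eqP ->; rewrite mulN1r mulrN mulrC.
Qed.

Lemma Phi_mvt f p q : monotone f -> p < q ->
  exists2 c, p < c < q & Phi f q - Phi f p = slope f c * (q - p).
Proof.
move=> mf pq; have [c] := poly_mvt (Phi_poly f) pq.
by rewrite in_itv /= !horner_Phi russo // => h e; exists c.
Qed.

Lemma slope_ge0 f p : 0 <= p <= 1 -> 0 <= slope f p.
Proof. by move=> hp; apply: sumr_ge0 => i _; apply: pivot_prob_ge0. Qed.

Lemma slope_le k f p : certs_le k f -> 0 <= p <= 1 -> slope f p <= k%:R.
Proof.
move=> cf hp; rewrite /slope /pivot_prob -Ex_sum -(Ex_cst n p k%:R).
by apply: le_Ex => // x; exact: sum_pivotal_le.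
Qed.

Lemma slope_poincare f p : monotone f -> 0 <= p <= 1 ->
  Phi f p * (1 - Phi f p) <= p * (1 - p) * slope f p.
Proof. by move=> mf hp; exact: poincare. Qed.

Lemma Phi_le f p q : monotone f -> 0 <= p -> p <= q -> q <= 1 -> Phi f p <= Phi f q.
Proof.
move=> mf p0; rewrite le_eqVlt => /predU1P[->//|pq] q1.
have [c /andP[pc cq] e] := Phi_mvt mf pq.
by rewrite -subr_ge0 e mulr_ge0 ?subr_ge0 ?(ltW pq) // slope_ge0 //; apply/andP; lra.
Qed.

Lemma Phi_lipschitz k f p q : monotone f -> certs_le k f ->
  0 <= p <= 1 -> 0 <= q <= 1 -> `|Phi f q - Phi f p| <= k%:R * `|q - p|.
Proof.
move=> mf cf.
wlog pq : p q / p < q.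
  move=> w hp hq; case: (ltgtP p q) => [pq|qp|->]; first exact: w.
    by rewrite distrC [`|q - p|]distrC; apply: w.
  by rewrite !subrr normr0 mulr0.
move=> hp hq; have [c hc ->] := Phi_mvt mf pq.
have c01 : 0 <= c <= 1 by lra.
rewrite normrM [`|slope _ _|]ger0_norm ?slope_ge0 //.
by rewrite ler_wpM2r // slope_le.
Qed.

Lemma Phi_cube0 f : Phi f (0 : R) = (f (cube0 n))%:R.
Proof.
rewrite /Phi (bigD1 (cube0 n)) //= big1 ?addr0.
  rewrite /cube_prob big1 ?mul1r // => i _.
  by rewrite ffunE /= subr0.
move=> x xn; suff [i xi] : exists i, x i.
  by rewrite (cube_probE _ i) xi /= !mul0r.
apply/existsP; apply: contraNT xn => /existsPn h; apply/eqP/ffunP => i.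
by rewrite ffunE; exact/negbTE.
Qed.

Lemma Phi_cube1 f : Phi f (1 : R) = (f (cube1 n))%:R.
Proof.
rewrite /Phi (bigD1 (cube1 n)) //= big1 ?addr0.
  rewrite /cube_prob big1 ?mul1r // => i _.
  by rewrite ffunE.
move=> x xn; suff [i xi] : exists i, ~~ x i.
  by rewrite (cube_probE _ i) (negPf xi) /= subrr !mul0r.
apply/existsP; apply: contraNT xn => /existsPn h; apply/eqP/ffunP => i.
by rewrite ffunE; apply/negPn.
Qed.

Lemma crit_probP f : monotone f -> ~ is_constant f ->
  0 < crit_prob R f < 1 /\ Phi f (crit_prob R f) = 2^-1.
Proof.
move=> mf nc; have [f0 f1] := nonconstant_monotone mf nc.
suff [p hp] : exists p : R, 0 < p < 1 /\ Phi f p = 2^-1.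
  by apply: (@xgetPex _ 0 [set p : R | 0 < p < 1 /\ Phi f p = 2^-1]%classic); exists p.
have [||p] := @poly_ivt R (Phi_poly f - (2^-1)%:P) 0 1 _ _; first exact: ler01.
  by rewrite !hornerE !horner_Phi Phi_cube0 Phi_cube1 f0 f1 /=; lra.
rewrite rootE !hornerE horner_Phi subr_eq0 => /andP[p0 p1] /eqP e.
exists p; split=> //; rewrite !lt_neqAle p0 p1 !andbT; apply/andP; split.
  by apply/eqP => z; move: e; rewrite -z Phi_cube0 f0 /=; lra.
by apply/eqP => z; move: e; rewrite z Phi_cube1 f1 /=; lra.
Qed.

Lemma overwrite_mono f v x z : monotone f ->
  if v then f x ==> f (overwrite v x z) else f (overwrite v x z) ==> f x.
Proof.
by move=> mf; case: v; apply: mf => i; rewrite ffunE; case: (z i);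
  rewrite ?implybT ?implybb.
Qed.

(* If [i] is pivotal at [x] it stays pivotal as long as the overwriting avoids
   a certificate of the value that the overwriting could destroy. *)
Lemma pivot_prob_overwrite k f i p t (v : bool) : monotone f -> certs_le k f ->
  0 <= p <= 1 -> 0 <= t <= 1 ->
  (1 - t) ^+ k * pivot_prob f p i <= pivot_prob f (t * v%:R + (1 - t) * p) i.
Proof.
move=> mf cf hp ht; have /andP[t0 t1] := ht.
rewrite /pivot_prob -Ex_overwrite -ExZ; apply: le_Ex => // x.
case pv: (pivotal f i x); last by rewrite mulr0 Ex_ge0.
(* Overwriting with [v] pushes [f] towards [v], so only the value with [i] set to [~~ v] is at
   risk. *)
rewrite mulr1; have [S /certP hS cS] := cf (set_coord x i (~~ v)).
apply: (@le_trans _ _ (Ex t (fun z : cube n =>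
    \prod_j (if j \in S then (~~ z j)%:R else 1)))).
  rewrite (Ex_prod t (fun j b => if j \in S then (~~ b)%:R else 1)).
  rewrite (eq_bigr (fun j => if j \in S then 1 - t else 1)); last first.
    by move=> j _; case: ifP => _ /=; ring.
  rewrite -big_mkcond /= prodr_const; apply: ler_wiXn2l => //; lra.
apply: le_Ex => // z.
have [/forall_inP h|] := boolP [forall j in S, ~~ z j]; last first.
  move=> /forallPn[j]; rewrite negb_imply negbK => /andP[jS zj].
  by rewrite (bigD1 j) //= jS zj mul0r.
rewrite big1 => [|j _]; last by case: ifP => // jS; rewrite h.
suff -> : pivotal f i (overwrite v x z) by [].
have keep : f (set_coord (overwrite v x z) i (~~ v)) = f (set_coord x i (~~ v)).
  by apply: hS => j jS; rewrite !ffunE (negPf (h j jS)).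
pose z' := set_coord z i false.
have e : set_coord (overwrite v x z) i v = overwrite v (set_coord x i v) z'.
  by apply/ffunP => j; rewrite !ffunE; case: eqP.
have := overwrite_mono v (set_coord x i v) z' mf; rewrite -e.
move: pv keep; rewrite /pivotal; case: v {hS e} => /= /andP[a b] ->.
  by rewrite a b /= andbT.
by rewrite a (negPf b) implybF.
Qed.

Lemma slope_overwrite k f p t (v : bool) : monotone f -> certs_le k f ->
  0 <= p <= 1 -> 0 <= t <= 1 -> k%:R * t <= 2^-1 ->
  slope f p <= 2 * slope f (t * v%:R + (1 - t) * p).
Proof.
move=> mf cf hp ht kt.
have h : (1 - t) ^+ k * slope f p <= slope f (t * v%:R + (1 - t) * p).
  by rewrite mulr_sumr; apply: ler_sum => i _; exact: pivot_prob_overwrite.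
have b := bernoulli_ineq k ht.
have s0 := slope_ge0 f hp.
have : 0 <= ((1 - t) ^+ k - 2^-1) * slope f p by apply: mulr_ge0 => //; lra.
by lra.
Qed.

(** The overwriting density t that takes bias p to q is (q-p)/(1-p) upwards and (p-q)/p downwards.
    The last two hypotheses say k t <= 1/2, which makes (1-t)^k >= 1/2. *)
Lemma slope_stable k f p q : (0 < k)%N -> monotone f -> certs_le k f ->
  0 < p < 1 -> 0 <= q <= 1 ->
  (q - p) * (2 * k%:R) <= 1 - p -> (p - q) * (2 * k%:R) <= p ->
  slope f p <= 2 * slope f q.
Proof.
move=> k0 mf cf hp hq h1 h2.
have k0' : 1 <= k%:R :> R by rewrite ler1n.
have hp' : 0 <= p <= 1 by lra.
have /andP[p0 p1] := hp.
have [pq|/ltW qp] := leP p q.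
  pose t := (q - p) / (1 - p).
  have e : q = t * true%:R + (1 - t) * p by rewrite /t /=; field; lra.
  have t0 : 0 <= t by rewrite divr_ge0 ?subr_ge0 // ltW.
  have t1 : t <= 1 by rewrite ler_pdivrMr; lra.
  rewrite e; apply: slope_overwrite cf _ _ _ => //; first by rewrite t0.
  by rewrite /t mulrA ler_pdivrMr; lra.
pose t := (p - q) / p.
have e : q = t * false%:R + (1 - t) * p by rewrite /t /=; field; lra.
have t0 : 0 <= t by rewrite divr_ge0 ?subr_ge0 // ltW.
have t1 : t <= 1 by rewrite ler_pdivrMr; lra.
rewrite e; apply: slope_overwrite cf _ _ _ => //; first by rewrite t0.
by rewrite /t mulrA ler_pdivrMr; lra.
Qed.

(** On the way back from q to c, the end of [0,1] ahead is at least as far from q as from c, so one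
    radius serves both directions. *)
Lemma slope_window k f c q : (0 < k)%N -> monotone f -> certs_le k f ->
  0 < c < 1 -> `|q - c| * (2 * k%:R) <= c * (1 - c) ->
  [/\ 0 < q < 1, slope f c <= 2 * slope f q & slope f q <= 2 * slope f c].
Proof.
move=> k0 mf cf hc h.
have k1 : 1 <= k%:R :> R by rewrite ler1n.
have d0 := normr_ge0 (q - c).
have hk : `|q - c| * 2 <= `|q - c| * (2 * k%:R) by rewrite ler_wpM2l //; lra.
have /andP[c0 c1] := hc.
have hl : c * (1 - c) <= c by nra.
have hr : c * (1 - c) <= 1 - c by nra.
have /andP[n1 n2] : - `|q - c| <= q - c <= `|q - c| by rewrite -ler_norml.
have m1 : (q - c) * (2 * k%:R) <= c * (1 - c).
  by apply: le_trans h; rewrite ler_wpM2r //; lra.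
have m2 : (c - q) * (2 * k%:R) <= c * (1 - c).
  by apply: le_trans h; rewrite ler_wpM2r //; lra.
have hq : 0 < q < 1 by lra.
split=> //.
  by apply: slope_stable cf _ _ _ _ => //; lra.
have [qc|/ltW cq] := leP q c.
  apply: slope_stable cf _ _ _ _ => //; [lra|lra|nra].
apply: slope_stable cf _ _ _ _ => //; [lra|nra|lra].
Qed.

End Slope.

(** * One greedy step *)

Section GreedyStep.
Variables (R : realType) (n k : nat).
Hypothesis k_gt0 : (0 < k)%N.
Implicit Types (p q c : R) (i : 'I_n) (f g : cube n -> bool).
Local Notation u := (k%:R^-1 : R).

Lemma inv_k_bounds : [/\ 0 < u, u <= 1 & k%:R * u = 1].
Proof.
have k1 : 1 <= k%:R :> R by rewrite ler1n.
by split; [rewrite invr_gt0; lra|rewrite invf_le1; lra|rewrite mulfV //; lra].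
Qed.

Definition crit_tol : R := u ^+ 3 / 64.

Definition admissible f := monotone f /\ certs_le k f.

Lemma admissible_restrict f i b : admissible f -> admissible (restrict f i b).
Proof. by case=> mf cf; split; [exact: monotone_restrict|exact: certs_restrict]. Qed.

(* 7/64 = 1/8 - 1/64: the effect of fixing an influential coordinate, minus the
   error made in locating the critical probability. *)
Definition pushed b f p :=
  if b then 2^-1 + 7 / 64 * u ^+ 2 <= Phi f p
  else Phi f p <= 2^-1 - 7 / 64 * u ^+ 2.

Lemma Phi_near_crit f p : admissible f -> ~ is_constant f ->
  0 <= p <= 1 -> `|p - crit_prob R f| <= crit_tol ->
  `|Phi f p - 2^-1| <= u ^+ 2 / 64.
Proof.
move=> [mf cf] nc hp hc; have [/andP[c0 c1] <-] := crit_probP R mf nc.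
have [u0 u1 ku] := inv_k_bounds.
apply: le_trans (Phi_lipschitz mf cf _ hp) _; first by apply/andP; lra.
have -> : u ^+ 2 / 64 = k%:R * crit_tol.
  by rewrite /crit_tol exprS !mulrA ku mul1r.
by rewrite ler_wpM2l.
Qed.

(** With Phi this near to 1/2, the largest influence is at least 3/4 u^2. Two estimation errors of
    u^2/8 leave u^2/2 for the selected coordinate. *)
Lemma selected_influence f p (e : 'I_n -> R) i : admissible f -> ~ is_constant f ->
  0 <= p <= 1 -> `|p - crit_prob R f| <= crit_tol ->
  (forall j, `|e j - rerand_inf f p j| <= u ^+ 2 / 8) ->
  (forall j, e j <= e i) ->
  u ^+ 2 / 2 <= rerand_inf f p i.
Proof.
move=> af nc hp hc he hi; have [mf cf] := af.
have [u0 u1 ku] := inv_k_bounds.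
have u2 : 0 <= u ^+ 2 <= 1 by rewrite sqr_ge0 expr_le1 // ltW.
have hphi := Phi_near_crit af nc hp hc.
have infi := rerand_inf_ge0 f i hp.
have hM j : rerand_inf f p j <= rerand_inf f p i + u ^+ 2 / 4.
  have := he j; have := he i; rewrite !ler_norml => /andP[a b] /andP[c d].
  by have := hi j; lra.
have M0 : 0 <= rerand_inf f p i + u ^+ 2 / 4 by lra.
have := max_influence cf hp M0 hM.
move: hphi; rewrite ler_norml; set F := Phi f p => /andP[a b].
have hF : 3 / 4 <= 4 * (F * (1 - F)).
  have : 0 <= (F - 2^-1 + 64^-1) * (64^-1 - (F - 2^-1)) by apply: mulr_ge0; lra.
  by lra.
move=> h; have h3 : 3 / 4 <= k%:R ^+ 2 * (rerand_inf f p i + u ^+ 2 / 4) by lra.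
have kk : k%:R ^+ 2 * u ^+ 2 = 1 by rewrite -exprMn ku expr1n.
have h4 : u ^+ 2 * (3 / 4) <= u ^+ 2 * (k%:R ^+ 2 * (rerand_inf f p i + u ^+ 2 / 4)).
  by rewrite ler_wpM2l //; lra.
by rewrite mulrA [u ^+ 2 * k%:R ^+ 2]mulrC kk mul1r in h4; lra.
Qed.

Lemma step_pushed f p i b : admissible f -> ~ is_constant f ->
  0 <= p <= 1 -> `|p - crit_prob R f| <= crit_tol ->
  u ^+ 2 / 2 <= rerand_inf f p i -> pushed b (restrict f i b) p.
Proof.
move=> af nc hp hc hi; have := Phi_near_crit af nc hp hc.
rewrite ler_norml => /andP[a a'].
by have := Phi_restrict_gap i b af.1 hp; rewrite /pushed; case: b; lra.
Qed.

(** Phi is k-Lipschitz, so a gap of 7/64 u^2 means a distance of at least 7/64 u^3, which is 7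
    [crit_tol]. *)
Lemma crit_pushed f p b : admissible f -> ~ is_constant f ->
  0 <= p <= 1 -> pushed b f p ->
  if b then crit_prob R f <= p - 7 * crit_tol else p + 7 * crit_tol <= crit_prob R f.
Proof.
move=> [mf cf] nc hp; have [/andP[c0 c1] hc] := crit_probP R mf nc.
have [u0 u1 ku] := inv_k_bounds.
have u2 : 0 < u ^+ 2 by rewrite exprn_gt0.
set c := crit_prob R f in c0 c1 hc *; have /andP[p0 p1] := hp.
have toE : crit_tol = u * (u ^+ 2 / 64) by rewrite /crit_tol exprS mulrA.
have key d : 7 / 64 * u ^+ 2 <= k%:R * d -> 7 * crit_tol <= d.
  move=> h; have : u * (7 / 64 * u ^+ 2) <= u * (k%:R * d) by rewrite ler_wpM2l // ltW.
  by rewrite [X in _ <= X]mulrA [u * k%:R]mulrC ku mul1r toE; lra.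
have lip q r : 0 <= q <= 1 -> 0 <= r <= 1 -> q <= r ->
    Phi f r - Phi f q <= k%:R * (r - q).
  move=> hq hr qr; rewrite -[r - q]ger0_norm ?subr_ge0 //.
  exact: le_trans (ler_norm _) (Phi_lipschitz mf cf hq hr).
have hc' : 0 <= c <= 1 by lra.
rewrite /pushed; case: b => h.
  have cp : c <= p.
    by rewrite leNgt; apply/negP => pc; have := Phi_le mf p0 (ltW pc) (ltW c1); lra.
  by have := key (p - c); have := lip c p hc' hp cp; lra.
have pc : p <= c.
  by rewrite leNgt; apply/negP => cp; have := Phi_le mf (ltW c0) (ltW cp) p1; lra.
by have := key (c - p); have := lip p c hp hc' pc; lra.
Qed.

(** The potential of the amortized analysis. *)
Definition crit_dist c : R := `|c - 2^-1|.

Lemma crit_tol_gt0 : 0 < crit_tol.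
Proof. by have [u0 _ _] := inv_k_bounds; rewrite divr_gt0 ?exprn_gt0. Qed.

(** The locating error leaves 6 of the 7 [crit_tol]. As c may lie across 1/2 by up to [crit_tol], up
    to 2 [crit_tol] of the move can be lost, a third of the smallest move; hence the factor 2/3. The
    last clause keeps all later rounds on the same side of 1/2. *)
Lemma crit_progress p c c' : `|p - c| <= crit_tol ->
  (if p < 2^-1 then c' <= p - 7 * crit_tol else p + 7 * crit_tol <= c') ->
  [/\ 6 * crit_tol <= `|c' - c|, crit_dist c + 2 / 3 * `|c' - c| <= crit_dist c'
    & if p < 2^-1 then c' <= 2^-1 - 7 * crit_tol else 2^-1 + 7 * crit_tol <= c'].
Proof.
have t0 := crit_tol_gt0; set t := crit_tol in t0 *.
rewrite ler_norml /crit_dist => /andP[a b]; case: ifP => [lt h|/negbT]; last rewrite -leNgt => le h.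
  have -> : `|c' - c| = c - c' by rewrite distrC ger0_norm //; lra.
  have -> : `|c' - 2^-1| = 2^-1 - c' by rewrite distrC ger0_norm //; lra.
  by split; [lra| |lra]; have [h2|h2] := ger0P (c - 2^-1); lra.
have -> : `|c' - c| = c' - c by rewrite ger0_norm //; lra.
have -> : `|c' - 2^-1| = c' - 2^-1 by rewrite ger0_norm //; lra.
by split; [lra| |lra]; have [h2|h2] := ger0P (c - 2^-1); lra.
Qed.

End GreedyStep.

(** * Concentration *)

Section Concentration.
Variable R : realType.

Definition average (T : finType) (F : T -> R) : R := (\sum_x F x) / #|T|%:R.

Definition freq (T : finType) (P : pred T) : R := average (fun x => (P x)%:R).

Section Average.
Variable T : finType.
Hypothesis T_gt0 : (0 < #|T|)%N.
Implicit Types F G : T -> R.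

Let cT_neq0 : #|T|%:R != 0 :> R.
Proof. by rewrite pnatr_eq0 -lt0n. Qed.

Lemma average_cst (a : R) : average (fun _ : T => a) = a.
Proof. by rewrite /average sumr_const -[a *+ _]mulr_natr -mulrA mulfV ?mulr1. Qed.

Lemma averageD F G : average (fun x => F x + G x) = average F + average G.
Proof. by rewrite /average big_split mulrDl. Qed.

Lemma averageZ a F : average (fun x => a * F x) = a * average F.
Proof. by rewrite /average -mulr_sumr mulrA. Qed.

Lemma averageN F : average (fun x => - F x) = - average F.
Proof. by rewrite /average sumrN mulNr. Qed.

Lemma le_average F G : (forall x, F x <= G x) -> average F <= average G.
Proof. by move=> h; rewrite ler_wpM2r ?invr_ge0 // ler_sum. Qed.

Lemma freq_or (P Q : pred T) : freq (fun x => P x || Q x) <= freq P + freq Q.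
Proof.
rewrite -averageD; apply: le_average => x; rewrite -natrD ler_nat /=.
by case: (P x); case: (Q x).
Qed.

Lemma average_prod N F :
  average (fun w : {ffun 'I_N -> T} => \prod_(l < N) F (w l)) = average F ^+ N.
Proof.
rewrite /average -(bigA_distr_bigA (fun _ : 'I_N => F)) prodr_const card_ffun card_ord.
by rewrite natrX expr_div_n.
Qed.

End Average.

(** exp(y) <= 1/(1-y), and (1 + y + 2 y^2)(1 - y) = 1 + y^2 (1 - 2 y). *)
Lemma expR_le_quad (y : R) : y <= 2^-1 -> expR y <= 1 + y + 2 * y ^+ 2.
Proof.
move=> hy; have h : 1 - y <= expR (- y) by have := expR_ge1Dx (- y); lra.
have h1 : 0 < 1 - y by lra.
rewrite -[expR y]invrK -expRN.
apply: (@le_trans _ _ (1 - y)^-1); first by rewrite lef_pV2 // posrE ?expR_gt0.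
rewrite -[_^-1]mul1r ler_pdivrMr //.
have : 0 <= y ^+ 2 * (1 - 2 * y) by rewrite mulr_ge0 ?sqr_ge0 //; lra.
by rewrite expr2; lra.
Qed.

Definition sample_mean (T : finType) N (X : T -> R) (w : {ffun 'I_N -> T}) : R :=
  (\sum_l X (w l)) / N%:R.

Lemma sample_meanN (T : finType) N (X : T -> R) (w : {ffun 'I_N -> T}) :
  sample_mean (fun x => - X x) w = - sample_mean X w.
Proof. by rewrite /sample_mean sumrN mulNr. Qed.

(* Bernstein: [lam = t / (4 v)] in the exponential Markov inequality. *)
Lemma upper_tail (T : finType) N (X : T -> R) (v t L : R) :
  (0 < #|T|)%N -> (0 < N)%N -> (forall a, X a <= 1) -> average (fun a => X a ^+ 2) <= v ->
  0 < t -> t <= 2 * v -> 8 * v * L <= N%:R * t ^+ 2 ->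
  freq (fun w : {ffun 'I_N -> T} => average X + t <= sample_mean X w) <= expR (- L).
Proof.
move=> T0 N0 X1 Xv t0 tv hL; have v0 : 0 < v by lra.
set mu := average X; pose lam := t / (4 * v).
have lam0 : 0 < lam by rewrite divr_gt0 //; lra.
(* The condition t <= 2 v enters here: it keeps the exponent in the range of [expR_le_quad]. *)
have lam1 : lam <= 2^-1 by rewrite ler_pdivrMr; lra.
have N0' : 0 < N%:R :> R by rewrite ltr0n.
have W0 : (0 < #|{ffun 'I_N -> T}|)%N by rewrite card_ffun expn_gt0 T0.
pose Y a := expR (lam * (X a - (mu + t))).
have Y0 a : 0 < Y a by exact: expR_gt0.
apply: (@le_trans _ _ (average (fun w : {ffun 'I_N -> T} => \prod_(l < N) Y (w l)))).
  apply: le_average => w.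
  case: (boolP (mu + t <= _)) => /= h; last by apply: prodr_ge0 => l _; exact: ltW.
  rewrite -expR_sum -mulr_sumr sumrB.
  apply: le_trans (expR_ge1Dx _); rewrite lerDl (mulr_ge0 (ltW lam0)) //.
  rewrite sumr_const card_ord -[(mu + t) *+ _]mulr_natr subr_ge0.
  by move: h; rewrite /sample_mean ler_pdivlMr.
rewrite average_prod.
have hY : average Y <= expR (- (L / N%:R)).
  rewrite /Y; under eq_fun => a do rewrite mulrBr expRD.
  apply: (@le_trans _ _ (average (fun a => expR (- (lam * (mu + t))) *
      (1 + lam * X a + 2 * lam ^+ 2 * X a ^+ 2)))).
    apply: le_average => a; rewrite mulrC ler_wpM2l ?expR_ge0 //.
    have := @expR_le_quad (lam * X a); rewrite exprMn mulrA; apply.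
    have := X1 a => xa; apply: (@le_trans _ _ (lam * 1)); last by lra.
    by rewrite ler_wpM2l // ltW.
  rewrite averageZ // !averageD // average_cst // !averageZ //.
  have h1 : 1 + lam * mu + 2 * lam ^+ 2 * average (fun a => X a ^+ 2) <=
      expR (lam * mu + 2 * lam ^+ 2 * v).
    apply: le_trans (expR_ge1Dx _).
    have : 0 <= 2 * lam ^+ 2 * (v - average (fun a => X a ^+ 2)).
      by rewrite mulr_ge0 ?subr_ge0 // mulr_ge0 ?sqr_ge0.
    by lra.
  apply: le_trans (ler_wpM2l (expR_ge0 _) h1) _.
  rewrite -expRD ler_expR.
  have e : lam * t - 2 * lam ^+ 2 * v = t ^+ 2 / (8 * v).
    by rewrite /lam; field; lra.
  have : L / N%:R <= t ^+ 2 / (8 * v).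
    by rewrite ler_pdivrMr // mulrAC ler_pdivlMr; lra.
  by lra.
have -> : - L = - (L / N%:R) * N%:R by rewrite mulNr mulfVK // gt_eqF.
rewrite expRM_natr; apply: lerXn2r => //; rewrite nnegrE ?expR_ge0 //.
by rewrite divr_ge0 // sumr_ge0 // => a _; exact: ltW.
Qed.

Lemma lower_tail (T : finType) N (X : T -> R) (v t L : R) :
  (0 < #|T|)%N -> (0 < N)%N -> (forall a, -1 <= X a) -> average (fun a => X a ^+ 2) <= v ->
  0 < t -> t <= 2 * v -> 8 * v * L <= N%:R * t ^+ 2 ->
  freq (fun w : {ffun 'I_N -> T} => sample_mean X w <= average X - t) <= expR (- L).
Proof.
move=> T0 N0 X1 Xv t0 tv hL.
rewrite (_ : freq _ = freq (fun w : {ffun 'I_N -> T} =>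
    average (fun a => - X a) + t <= sample_mean (fun a => - X a) w)); last first.
  congr average; apply/funext => w.
  by rewrite averageN sample_meanN lerNr opprD opprK.
apply: (@upper_tail _ _ _ v) => // [a|]; first by have := X1 a; lra.
rewrite (_ : (fun a => (- X a) ^+ 2) = (fun a => X a ^+ 2)) //.
by apply/funext => a; rewrite sqrrN.
Qed.

End Concentration.

(** * Common random thresholds *)

Section Thresholds.
Variables (R : realType) (n m : nat).

(** One uniform threshold per coordinate yields points of all biases j/(m+1) at once, increasing
    with [j], from finitely many outcomes. *)
Definition threshold_point (j : nat) (U : {ffun 'I_n -> 'I_m.+1}) : cube n :=
  [ffun i => (U i < j)%N].

Definition grid (j : nat) : R := j%:R / m.+1%:R.

Lemma grid_bounds j : (j <= m.+1)%N -> 0 <= grid j <= 1.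
Proof.
by move=> h; rewrite /grid divr_ge0 //= ler_pdivrMr ?ltr0n // mul1r ler_nat.
Qed.

Lemma average_threshold j (G : cube n -> R) : (j <= m.+1)%N ->
  average (fun U => G (threshold_point j U)) = Ex (grid j) G.
Proof.
move=> jm; rewrite /average card_ffun !card_ord mulr_suml.
rewrite (partition_big (threshold_point j) predT) //=.
apply: eq_bigr => y _.
under eq_bigr => U /eqP e do rewrite e mulrC.
rewrite -mulr_suml; congr (_ * _).
have -> : ((m.+1 ^ n)%:R^-1 : R) = \prod_(i < n) m.+1%:R^-1.
  by rewrite prodr_const card_ord natrX exprVn.
transitivity (\prod_(i < n) \sum_(a < m.+1 | (a < j)%N == y i) (m.+1%:R^-1 : R)).
  rewrite bigA_distr_big_dep; apply: eq_bigl => U.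
  apply/eqP/familyP => [<- i|h]; first by rewrite unfold_in ffunE.
  by apply/ffunP => i; rewrite ffunE; have := h i; rewrite unfold_in => /eqP.
apply: eq_bigr => i _.
have ht : \sum_(a < m.+1 | (a < j)%N) (m.+1%:R^-1 : R) = grid j.
  by rewrite -(big_ord_widen _ (fun=> m.+1%:R^-1)) // sumr_const card_ord /grid [RHS]mulr_natl.
case: (y i) => /=.
  by rewrite -ht; apply: eq_bigl => a; rewrite eqb_id.
have : \sum_(a < m.+1) (m.+1%:R^-1 : R) = 1.
  by rewrite sumr_const card_ord -[LHS]mulr_natr mulVf // pnatr_eq0.
rewrite (bigID (fun a : 'I_m.+1 => (a < j)%N)) /= ht => h.
by under eq_bigl => a do rewrite eqbF_neg; lra.
Qed.

Lemma threshold_mono j j' U i : (j <= j')%N ->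
  threshold_point j U i ==> threshold_point j' U i.
Proof. by move=> le; rewrite !ffunE; apply/implyP => h; apply: leq_trans le. Qed.

End Thresholds.

(** * Randomized query programs *)

Section ProgramLogic.
Variables (R : realType) (n : nat) (f : cube n -> bool).

Definition whp (A : Type) (d : R) (E : A -> nat -> Prop) (q : nat) (P : qprog n A) :=
  1 - d <= run_prob R f E q P.

(** Real-valued postconditions make the semantics of [bind] compositional. *)
Fixpoint expected (A : Type) (F : A -> nat -> R) (q : nat) (P : qprog n A) : R :=
  match P with
  | Ret a => F a q
  | Query x c => expected F q.+1 (c (f x))
  | Rand m c => (\sum_(j < m.+1) expected F q (c j)) / m.+1%:R
  end.

Lemma run_probE (A : Type) (E : A -> nat -> Prop) q (P : qprog n A) :
  run_prob R f E q P = expected (fun a q => (`[< E a q >])%:R) q P.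
Proof.
elim: P q => //= m c IH q; congr (_ / _); apply: eq_bigr => j _; exact: IH.
Qed.

Lemma expected_bind (A B : Type) (F : B -> nat -> R) q (P : qprog n A) (K : A -> qprog n B) :
  expected F q (bind P K) = expected (fun a q' => expected F q' (K a)) q P.
Proof.
elim: P q => //= m c IH q; congr (_ / _); apply: eq_bigr => j _; exact: IH.
Qed.

Lemma le_expected (A : Type) (F G : A -> nat -> R) q (P : qprog n A) :
  (forall a q, F a q <= G a q) -> expected F q P <= expected G q P.
Proof.
move=> h; elim: P q => //= m c IH q.
by rewrite ler_wpM2r ?invr_ge0 // ler_sum.
Qed.

Lemma expectedB (A : Type) (F : A -> nat -> R) (d : R) q (P : qprog n A) :
  expected (fun a q => F a q - d) q P = expected F q P - d.
Proof.
elim: P q => //= m c IH q; under eq_bigr do rewrite IH.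
rewrite sumrB mulrBl; congr (_ - _).
by rewrite sumr_const card_ord -[X in X / _]mulr_natr mulfK // pnatr_eq0.
Qed.

Lemma run_prob_ge0 (A : Type) (E : A -> nat -> Prop) q (P : qprog n A) :
  0 <= run_prob R f E q P.
Proof.
elim: P q => //= m c IH q.
by rewrite divr_ge0 // sumr_ge0.
Qed.

Lemma whp_bind (A B : Type) (d1 d2 : R) (E1 : A -> nat -> Prop) (E2 : B -> nat -> Prop) q
    (P : qprog n A) (K : A -> qprog n B) :
  0 <= d2 -> whp d1 E1 q P -> (forall a q', E1 a q' -> whp d2 E2 q' (K a)) ->
  whp (d1 + d2) E2 q (bind P K).
Proof.
move=> d20 h1 h2; rewrite /whp run_probE expected_bind.
(* Where [E1] fails this lower bound is -d2 <= 0, hence trivial; where it holds it is the hypothesis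
   on [K]. *)
apply: (@le_trans _ _ (expected (fun a q => (`[< E1 a q >])%:R - d2) q P)).
  by rewrite expectedB -run_probE; move: h1; rewrite /whp; lra.
apply: le_expected => a q'; rewrite -run_probE.
case: asboolP => [e|_]; first exact: h2.
by have := run_prob_ge0 E2 q' (K a); rewrite sub0r; lra.
Qed.

Lemma whp_ret (A : Type) (E : A -> nat -> Prop) q a : E a q -> whp 0 E q (Ret a).
Proof. by move=> e; rewrite /whp /= asboolT // subr0. Qed.

Lemma whp_mono (A : Type) (d d' : R) (E E' : A -> nat -> Prop) q (P : qprog n A) :
  d <= d' -> (forall a q', E a q' -> E' a q') -> whp d E q P -> whp d' E' q P.
Proof.
move=> dd EE; rewrite /whp !run_probE => h.
apply: (@le_trans _ _ (1 - d)); first by lra.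
apply: le_trans h _; apply: le_expected => a q'; rewrite ler_nat.
by case: asboolP => // /EE e; rewrite asboolT.
Qed.

Lemma whp_seq (A B : Type) (d : R) (E1 : A -> nat -> Prop) (E2 : B -> nat -> Prop) q
    (P : qprog n A) (K : A -> qprog n B) :
  0 <= d -> whp 0 E1 q P -> (forall a q', E1 a q' -> whp d E2 q' (K a)) ->
  whp d E2 q (bind P K).
Proof. by move=> d0 h1 h2; rewrite -[d]add0r; apply: whp_bind h2. Qed.

Definition uniform (T : finType) (t0 : T) : qprog n T :=
  Rand #|T|.-1 (fun j => Ret (nth t0 (enum T) j)).

Lemma whp_uniform (T : finType) (t0 : T) (bad : pred T) (E : T -> nat -> Prop) q :
  (forall x, ~~ bad x -> E x q) -> whp (freq R bad) E q (uniform t0).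
Proof.
move=> h; rewrite /whp /=.
have T0 : (0 < #|T|)%N by apply/card_gt0P; exists t0.
have -> : \sum_(j < #|T|.-1.+1) (`[< E (nth t0 (enum T) j) q >])%:R =
          \sum_(x : T) (`[< E x q >])%:R :> R.
  rewrite -(big_mkord xpredT (fun j => (`[< E (nth t0 (enum T) j) q >])%:R)).
  by rewrite prednK // -big_enum (big_nth t0) -cardE.
rewrite prednK // -[X in _ <= X]/(average (fun x : T => (`[< E x q >])%:R)).
rewrite -{1}[1](average_cst T0) /freq -averageN // -averageD //.
apply: le_average => // x.
by case: (boolP (bad x)) => [_|/h e]; rewrite ?subrr ?subr0 // asboolT.
Qed.

Fixpoint query_all (xs : seq (cube n)) : qprog n (seq bool) :=
  if xs is x :: xs' then
    Query x (fun b => bind (query_all xs') (fun bs => Ret (b :: bs)))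
  else Ret [::].

Lemma whp_query_all xs q :
  whp 0 (fun a q' => a = map f xs /\ q' = (q + size xs)%N) q (query_all xs).
Proof.
elim: xs q => [|x xs IH] q /=; first by apply: whp_ret; rewrite addn0.
suff h : whp 0 (fun a q' => a = f x :: map f xs /\ q' = (q + (size xs).+1)%N) q.+1
  (bind (query_all xs) (fun bs => Ret (f x :: bs))) by exact: h.
apply: whp_seq (IH q.+1) _ => // a q' [-> ->].
by apply: whp_ret; rewrite addSnnS.
Qed.

Fixpoint bsearch (test : nat -> qprog n bool) (b lo : nat) : qprog n nat :=
  if b is b'.+1 then
    bind (test (lo + 2 ^ b')%N)
      (fun r => bsearch test b' (if r then lo else lo + 2 ^ b')%N)
  else Ret lo.+1.

(** The ends [lo] and [lo + 2 ^ b] are never tested, hence the two exceptional disjuncts. The tests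
    cannot fail because samples are drawn beforehand. *)
Lemma whp_bsearch test (phi : nat -> bool) (w : nat) b lo q :
  (forall j q, (j <= lo + 2 ^ b)%N ->
     whp 0 (fun a q' => a = phi j /\ q' = (q + w)%N) q (test j)) ->
  whp 0 (fun j q' => [/\ (lo < j <= lo + 2 ^ b)%N, (j == lo + 2 ^ b)%N || phi j,
    (j == lo.+1) || ~~ phi j.-1 & q' = (q + b * w)%N]) q (bsearch test b lo).
Proof.
elim: b lo q => [|b IH] lo q ht /=.
  by apply: whp_ret; rewrite expn0 addn1 ltnSn eqxx addn0 /=; split.
have e2 : (2 ^ b.+1 = 2 ^ b + 2 ^ b)%N by rewrite expnS mul2n addnn.
apply: whp_seq (ht _ _ _) _ => //; first by rewrite e2 leq_add2l leq_addr.
move=> r q1 [-> ->]; case E: (phi _).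
  apply: whp_mono (IH lo (q + w)%N _) => // [j q' [/andP[lj jh] a c ->]|j q2 h].
    split=> //; first by rewrite lj (leq_trans jh) // leq_add2l e2 leq_addr.
      by case/orP: a => [/eqP ->|->]; rewrite ?E ?orbT.
    by rewrite mulSn addnA.
  by apply: ht; apply: leq_trans h _; rewrite leq_add2l e2 leq_addr.
apply: whp_mono (IH (lo + 2 ^ b)%N (q + w)%N _) => // [j q' [/andP[lj jh] a c ->]|j q2 h].
  split.
  - by rewrite (leq_ltn_trans (leq_addr _ _) lj) e2 addnA.
  - by rewrite e2 addnA.
  - by case/orP: c => [/eqP ->|->]; rewrite /= ?E orbT.
  - by rewrite mulSn addnA.
by apply: ht; rewrite e2 addnA.
Qed.

End ProgramLogic.

(** * Querying a restriction and searching the grid *)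

Section Subroutines.
Variables (R : realType) (n m : nat) (f : cube n -> bool).
Notation sample N := {ffun 'I_N -> {ffun 'I_n -> 'I_m.+1}}.
Implicit Types (t : seq (round R n)) (x : cube n).

(** [foldr] applies the earliest round last, so that its bit prevails, as in [chosen_bits]. *)
Definition fix_coords t x : cube n :=
  foldr (fun r y => set_coord y (r_coord r) (r_bit r)) x t.

Definition current t : cube n -> bool := fun x => f (fix_coords t x).

Definition empirical t N (w : sample N) (j : nat) : qprog n R :=
  bind (query_all [seq fix_coords t (threshold_point j (w l)) | l <- enum 'I_N])
    (fun bs => Ret ((\sum_(b <- bs) b%:R) / N%:R)).

Definition threshold_mean (g : cube n -> bool) N (w : sample N) (j : nat) : R :=
  sample_mean (fun U => (g (threshold_point j U))%:R) w.

Lemma whp_empirical t N (w : sample N) j q :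
  whp f (0 : R) (fun a q' => a = threshold_mean (current t) w j /\ q' = (q + N)%N) q
    (empirical t w j).
Proof.
apply: (whp_seq (lexx _) (whp_query_all R f _ _)) => bs q' [-> ->].
apply: whp_ret; rewrite size_map size_enum_ord; split=> //.
by rewrite /threshold_mean /sample_mean -map_comp big_map -[in RHS]big_enum.
Qed.

Lemma threshold_mean_mono g N (w : sample N) j j' : monotone g -> (j <= j')%N ->
  threshold_mean g w j <= threshold_mean g w j'.
Proof.
move=> mg jj; rewrite ler_wpM2r ?invr_ge0 //; apply: ler_sum => l _.
rewrite ler_nat; have := mg (threshold_point j (w l)) (threshold_point j' (w l)).
by case: (g _) => // /(_ (fun i => threshold_mono _ _ jj)) /= ->.
Qed.

Definition search b t N (w : sample N) (theta : R) : qprog n nat :=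
  bsearch (fun j => bind (empirical t w j) (fun a => Ret (theta <= a))) b 0.

Lemma whp_search b t N (w : sample N) theta j1 j2 q : monotone (current t) ->
  (j1 < 2 ^ b)%N -> (0 < j2)%N ->
  threshold_mean (current t) w j1 < theta <= threshold_mean (current t) w j2 ->
  whp f (0 : R) (fun j q' => [/\ (j1 < j <= j2)%N, (0 < j <= 2 ^ b)%N & q' = (q + b * N)%N])
    q (search b t w theta).
Proof.
move=> mg j1b j20 /andP[h1 h2].
apply: whp_mono (@whp_bsearch R n f _
  (fun j => theta <= threshold_mean (current t) w j) N b 0 q _) => //.
  move=> j q' [/andP[j0 jb] a c ->]; rewrite add0n in a jb; split; rewrite ?j0 //.
  apply/andP; split.
    rewrite ltnNge; apply/negP => jj1; case/orP: a => [/eqP e|a].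
      by rewrite e leqNgt j1b in jj1.
    by have := threshold_mean_mono w mg jj1; lra.
  rewrite leqNgt; apply/negP => jj2; case/orP: c => [/eqP e|].
    by move: jj2; rewrite e ltnS leqNgt j20.
  rewrite -ltNge => c; have jj : (j2 <= j.-1)%N by rewrite -ltnS prednK.
  by have := threshold_mean_mono w mg jj; lra.
move=> j q' _; apply: (whp_seq (lexx _) (whp_empirical _ _ _ _)) => a q1 [-> ->].
exact: whp_ret.
Qed.

End Subroutines.

(** * The window around the critical probability *)

Lemma bracket (R : realDomainType) (phi : nat -> R) (M : nat) (lo hi : R) :
  phi 0 <= lo -> lo < hi -> hi <= phi M ->
  exists j1 j2, [/\ (j1 < M)%N, phi j1 <= lo < phi j1.+1, (0 < j2 <= M)%N &
    phi j2.-1 < hi <= phi j2].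
Proof.
move=> h0 lh hM.
have ex2 : exists j, hi <= phi j by exists M.
pose P j := (j <= M)%N && (phi j <= lo).
have exP : exists j, P j by exists 0%N; rewrite /P h0.
have ubP j : P j -> (j <= M)%N by case/andP.
case: (ex_maxnP exP ubP) => j1 /andP[j1M p1] max1.
case: (ex_minnP ex2) => j2 p2 min2.
have j1M' : (j1 < M)%N.
  by rewrite ltn_neqAle j1M andbT; apply/eqP => e; rewrite e in p1; lra.
have j20 : (0 < j2)%N.
  by rewrite lt0n; apply/eqP => e; rewrite e in p2; lra.
exists j1, j2; split=> //.
- rewrite p1 ltNge; apply/negP => h; have := max1 j1.+1.
  by rewrite /P j1M' h ltnn => /(_ isT).
- by rewrite j20 min2.
- rewrite p2 andbT ltNge; apply/negP => h.
  by have := min2 _ h; rewrite leqNgt prednK // leqnn.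
Qed.

Definition bern_var (R : realType) (p : R) : R := p * (1 - p).

Lemma bern_var_dist (R : realType) (p q : R) : 0 <= p <= 1 -> 0 <= q <= 1 ->
  bern_var p <= bern_var q + `|p - q|.
Proof.
move=> hp hq; rewrite /bern_var; have [h|h] := ger0P (p - q).
  have : 0 <= (p - q) * (p + q) by apply: mulr_ge0; lra.
  by lra.
have : 0 <= (q - p) * (2 - p - q) by apply: mulr_ge0; lra.
by lra.
Qed.

Section Window.
Variables (R : realType) (n k : nat) (g : cube n -> bool).
Hypotheses (k_gt0 : (0 < k)%N) (ag : admissible k g) (nc : ~ is_constant g).
Local Notation u := (k%:R^-1 : R).
Local Notation c := (crit_prob R g).
Local Notation s := (slope g c).
Local Notation tol := (crit_tol R k).

(** Small enough that Phi' is still stable where Phi leaves 1/2 by this much, large enough for k^4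
    samples to resolve it. *)
Definition level_step : R := u ^+ 2 / 1024.

(** The first clause is Poincare at Phi = 1/2; together with s <= k it keeps c at distance of order
    1/k from 0 and 1. *)
Lemma slope_crit : [/\ 1 <= 4 * bern_var c * s, s <= k%:R, 1 <= s & u <= 4 * bern_var c].
Proof.
have [mg cg] := ag; have [/andP[c0 c1] hc] := crit_probP R mg nc.
have c01 : 0 <= c <= 1 by lra.
have [u0 u1 ku] := inv_k_bounds R k_gt0.
have := slope_poincare mg c01; rewrite hc -/(bern_var c) => h.
have sk := slope_le cg c01; have s0 := slope_ge0 g c01.
have v4 : bern_var c <= 4^-1.
  by have := sqr_ge0 (c - 2^-1); rewrite /bern_var expr2; lra.
have v0 : 0 <= bern_var c by rewrite mulr_ge0; lra.
split=> //; first by lra.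
  have : 0 <= (4^-1 - bern_var c) * s by rewrite mulr_ge0 //; lra.
  by lra.
have h2 : bern_var c * s <= bern_var c * k%:R by rewrite ler_wpM2l.
have h3 : u * (1 - 2^-1) * 2^-1 <= u * (bern_var c * k%:R).
  by rewrite -mulrA ler_wpM2l //; lra.
have e : u * (bern_var c * k%:R) = bern_var c by rewrite mulrCA [u * k%:R]mulrC ku mulr1.
by rewrite e in h3; lra.
Qed.

Lemma window_mvt q : `|q - c| * (2 * k%:R) <= bern_var c ->
  [/\ 0 < q < 1,
    c <= q -> s / 2 * (q - c) <= Phi g q - 2^-1 <= 2 * s * (q - c) &
    q <= c -> s / 2 * (c - q) <= 2^-1 - Phi g q <= 2 * s * (c - q)].
Proof.
move=> hq; have [mg cg] := ag; have [hc0 hc] := crit_probP R mg nc.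
have [q01 _ _] := slope_window k_gt0 mg cg hc0 hq.
have win x : `|x - c| <= `|q - c| -> s / 2 <= slope g x <= 2 * s.
  move=> h; have hx : `|x - c| * (2 * k%:R) <= c * (1 - c).
    by apply: le_trans hq; rewrite ler_wpM2r // mulr_ge0.
  by have [_ a b] := slope_window k_gt0 mg cg hc0 hx; lra.
split=> //.
  rewrite le_eqVlt => /predU1P[<-|cq]; first by rewrite hc !subrr !mulr0 lexx.
  have [x /andP[cx xq] e] := Phi_mvt mg cq; rewrite hc in e; rewrite e.
  have [d0|] := ltP 0 (q - c); last by lra.
  have /win/andP[a b] : `|x - c| <= `|q - c| by rewrite !ger0_norm; lra.
  by rewrite !ler_pM2r // a b.
rewrite le_eqVlt => /predU1P[->|cq]; first by rewrite hc !subrr !mulr0 lexx.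
have [x /andP[cx xq] e] := Phi_mvt mg cq; rewrite hc in e; rewrite e.
have [d0|] := ltP 0 (c - q); last by lra.
have /win/andP[a b] : `|x - c| <= `|q - c| by rewrite !ler0_norm; lra.
by rewrite !ler_pM2r // a b.
Qed.

Lemma window_norm q : `|q - c| * (2 * k%:R) <= bern_var c ->
  `|Phi g q - 2^-1| <= 2 * s * `|q - c|.
Proof.
move=> hq; have [_ h1 h2] := window_mvt hq; have [_ _ s1 _] := slope_crit.
have [cq|/ltW qc] := leP c q.
  have /andP[a b] := h1 cq.
  have : 0 <= s / 2 * (q - c) by rewrite mulr_ge0; lra.
  by move=> z; rewrite !ger0_norm; lra.
have /andP[a b] := h2 qc.
have : 0 <= s / 2 * (c - q) by rewrite mulr_ge0; lra.
by move=> z; rewrite distrC [`|q - _|]distrC !ger0_norm; lra.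
Qed.

(* Crossing a level of Phi pins down the position, since Phi has slope at least
   [s/2] in the window around [c]. *)
Lemma position_of_level q d : 0 <= q <= 1 -> 0 <= d -> d * (2 * k%:R) <= bern_var c ->
  (Phi g q < 2^-1 + s / 2 * d -> q < c + d) /\
  (2^-1 - s / 2 * d < Phi g q -> c - d < q).
Proof.
move=> hq d0 hd; have [mg cg] := ag.
have hp : `|c + d - c| * (2 * k%:R) <= bern_var c by rewrite addrAC subrr add0r ger0_norm.
have hm : `|c - d - c| * (2 * k%:R) <= bern_var c.
  by rewrite addrAC subrr add0r normrN ger0_norm.
have [hp01 hp1 _] := window_mvt hp; have [hm01 _ hm1] := window_mvt hm.
split=> h; rewrite ltNge; apply/negP => le.
  have /andP[a _] := hp1 ltac:(lra).
  have : Phi g (c + d) <= Phi g q by apply: Phi_le => //; lra.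
  have e : c + d - c = d by ring.
  by rewrite e in a; lra.
have /andP[a _] := hm1 ltac:(lra).
have : Phi g q <= Phi g (c - d) by apply: Phi_le => //; lra.
have e : c - (c - d) = d by ring.
by rewrite e in a; lra.
Qed.

Lemma Phi_side q : 0 <= q <= 1 ->
  (Phi g q < 2^-1 -> q <= c) /\ (2^-1 < Phi g q -> c <= q).
Proof.
move=> /andP[q0 q1]; have [mg cg] := ag; have [/andP[c0 c1] hc] := crit_probP R mg nc.
split=> h; rewrite leNgt; apply/negP => z.
  by have := Phi_le mg (ltW c0) (ltW z) q1; lra.
by have := Phi_le mg q0 (ltW z) (ltW c1); lra.
Qed.

(** Let v = c (1-c) and d = v u / 32. At c + d and c - d, Phi differs from 1/2 by at least s d / 2
    >= u / 256, because 4 v s >= 1, and this exceeds u^2 / 512. *)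
Lemma near_half q : 0 <= q <= 1 -> `|Phi g q - 2^-1| <= u ^+ 2 / 512 ->
  `|q - c| * 32 <= bern_var c * u.
Proof.
move=> hq; rewrite ler_norml => /andP[a b].
have [v1 _ s1 uv] := slope_crit; have [u0 u1 ku] := inv_k_bounds R k_gt0.
have u2 : u ^+ 2 <= u by rewrite expr2; nra.
have v0 : 0 <= bern_var c by lra.
pose d := bern_var c * u / 32.
have d0 : 0 <= d by rewrite divr_ge0 // mulr_ge0 // ltW.
have hd : d * (2 * k%:R) <= bern_var c.
  have -> : d * (2 * k%:R) = bern_var c / 16 by rewrite /d; field; rewrite pnatr_eq0 -lt0n.
  by lra.
have e : u / 256 <= s / 2 * d.
  have -> : s / 2 * d = 4 * bern_var c * s * u / 256.
    by rewrite /d; field; rewrite pnatr_eq0 -lt0n.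
  by have := ler_wpM2r (ltW u0) v1; lra.
have [h1 h2] := position_of_level hq d0 hd.
have := h1 ltac:(lra); have := h2 ltac:(lra).
move=> x y; have : `|q - c| <= d by rewrite ler_norml; lra.
by rewrite /d; lra.
Qed.

Lemma level_step_bounds : 0 < level_step <= u ^+ 2 / 1024.
Proof.
have [u0 _ _] := inv_k_bounds R k_gt0.
by rewrite /level_step lexx andbT divr_gt0 ?exprn_gt0.
Qed.

(** Phi - 1/2 is between alpha/2 and 3 alpha/2 and Phi' between s/2 and 2 s, so the offset equals
    alpha/s up to constants and reveals the slope. *)
Lemma coarse_upper q : 0 <= q <= 1 -> `|Phi g q - (2^-1 + level_step)| <= level_step / 2 ->
  [/\ c <= q, (q - c) * 32 <= bern_var c * u, level_step <= 4 * s * (q - c)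
    & s * (q - c) <= 3 * level_step].
Proof.
move=> hq; have /andP[l0 l1] := level_step_bounds.
rewrite ler_norml => /andP[a b]; have [mg cg] := ag.
have [/andP[c0 c1] hc] := crit_probP R mg nc.
have [u0 u1 ku] := inv_k_bounds R k_gt0.
have cq : c <= q by apply: (Phi_side hq).2; lra.
have hn : `|q - c| * 32 <= bern_var c * u.
  by apply: near_half => //; rewrite ler_norml /level_step in a b *; lra.
have [] := @window_mvt q.
  have -> : `|q - c| * (2 * k%:R) = `|q - c| * 32 * k%:R / 16 by field.
  apply: (@le_trans _ _ (bern_var c * u * k%:R / 16)).
    by have := ler_wpM2r (ler0n R k) hn; lra.
  have -> : bern_var c * u * k%:R / 16 = bern_var c / 16.
    by field; rewrite pnatr_eq0 -lt0n.
  by have [_ _ _] := slope_crit; lra.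
move=> _ /(_ cq)/andP[d e] _; rewrite ger0_norm ?subr_ge0 // in hn.
by split=> //; lra.
Qed.

Lemma coarse_lower q : 0 <= q <= 1 -> `|Phi g q - (2^-1 - level_step)| <= level_step / 2 ->
  [/\ q <= c, (c - q) * 32 <= bern_var c * u, level_step <= 4 * s * (c - q)
    & s * (c - q) <= 3 * level_step].
Proof.
move=> hq; have /andP[l0 l1] := level_step_bounds.
rewrite ler_norml => /andP[a b]; have [mg cg] := ag.
have [/andP[c0 c1] hc] := crit_probP R mg nc.
have [u0 u1 ku] := inv_k_bounds R k_gt0.
have cq : q <= c by apply: (Phi_side hq).1; lra.
have hn : `|q - c| * 32 <= bern_var c * u.
  by apply: near_half => //; rewrite ler_norml /level_step in a b *; lra.
have [] := @window_mvt q.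
  have -> : `|q - c| * (2 * k%:R) = `|q - c| * 32 * k%:R / 16 by field.
  apply: (@le_trans _ _ (bern_var c * u * k%:R / 16)).
    by have := ler_wpM2r (ler0n R k) hn; lra.
  have -> : bern_var c * u * k%:R / 16 = bern_var c / 16.
    by field; rewrite pnatr_eq0 -lt0n.
  by have [_ _ _] := slope_crit; lra.
move=> _ _ /(_ cq)/andP[d e]; rewrite distrC ger0_norm ?subr_ge0 // in hn.
by split=> //; lra.
Qed.

Variable m : nat.
Hypothesis fine_grid : 4096 * k%:R ^+ 3 <= m.+1%:R :> R.
Local Notation grid := (grid R m).

Lemma grid_step : m.+1%:R^-1 <= u ^+ 3 / 4096.
Proof.
have k3 : 0 < k%:R ^+ 3 :> R by rewrite exprn_gt0 ?ltr0n.
have -> : u ^+ 3 / 4096 = (4096 * k%:R ^+ 3)^-1 by field; rewrite pnatr_eq0 -lt0n.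
by rewrite lef_pV2 // posrE ?ltr0n // mulr_gt0.
Qed.

Lemma gridS j : grid j.+1 = grid j + m.+1%:R^-1.
Proof. by rewrite /grid -natr1 mulrDl mul1r. Qed.

Lemma grid_le i j : (i <= j)%N -> grid i <= grid j.
Proof. by move=> h; rewrite ler_wpM2r ?invr_ge0 // ler_nat. Qed.

Lemma Phi_grid_mono i j : (i <= j)%N -> (j <= m.+1)%N -> Phi g (grid i) <= Phi g (grid j).
Proof.
move=> ij jm; have [mg _] := ag.
have /andP[a _] := @grid_bounds R m i (leq_trans ij jm).
have /andP[_ b] := @grid_bounds R m j jm.
by apply: Phi_le => //; exact: grid_le.
Qed.

Lemma Phi_grid_ends : Phi g (grid 0) = 0 /\ Phi g (grid m.+1) = 1.
Proof.
have [mg _] := ag; have [g0 g1] := nonconstant_monotone mg nc.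
rewrite /grid mul0r mulfV ?pnatr_eq0 //.
by rewrite Phi_cube0 Phi_cube1 g0 g1.
Qed.

(** Half of the error alpha/2 is left to sampling; the other half is the change of Phi over one grid
    step, at most k u^3 / 4096 = alpha/4. *)
Lemma coarse_bracket theta : `|theta - 2^-1| <= level_step ->
  exists j1 j2, [/\ (j1 < m.+1)%N, (0 < j2 <= m.+1)%N,
    Phi g (grid j1) <= theta - level_step / 4, theta + level_step / 4 <= Phi g (grid j2) &
    forall j, (j1 < j <= j2)%N -> `|Phi g (grid j) - theta| <= level_step / 2].
Proof.
have /andP[l0 l1] := level_step_bounds; rewrite ler_norml => /andP[t1 t2].
have [mg cg] := ag; have [u0 u1 ku] := inv_k_bounds R k_gt0.
have u2 : u ^+ 2 <= 1 by rewrite expr_le1 // ltW.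
have [p0 p1] := Phi_grid_ends.
have [|||j1 [j2 [j1m /andP[a b] /andP[j20 j2m] /andP[d e]]]] := @bracket R
  (fun j => Phi g (grid j)) m.+1 (theta - level_step / 4) (theta + level_step / 4).
- by rewrite p0; lra.
- by lra.
- by rewrite p1; lra.
exists j1, j2; split=> //; first by rewrite j20.
move=> j /andP[jj1 jj2]; have jm := leq_trans jj2 j2m.
have j0 : (0 < j)%N by apply: leq_ltn_trans jj1.
have lo := Phi_grid_mono jj1 jm.
have hi : Phi g (grid j.-1) <= Phi g (grid j2.-1).
  by apply: Phi_grid_mono; [rewrite -!subn1 leq_sub2r | apply: leq_trans (leq_pred _) j2m].
have st : Phi g (grid j) - Phi g (grid j.-1) <= level_step / 4.
  apply: le_trans (ler_norm _) _.
  apply: le_trans (Phi_lipschitz mg cg (grid_bounds _ _) (grid_bounds _ _)) _ => //.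
    exact: leq_trans (leq_pred _) jm.
  rewrite -{1}(prednK j0) gridS addrAC subrr add0r ger0_norm ?invr_ge0 //.
  apply: le_trans (ler_wpM2l _ grid_step) _ => //.
  by rewrite exprS !mulrA ku mul1r /level_step; lra.
by rewrite ler_norml; lra.
Qed.

(** At distance tol/2 from c, Phi has moved by at least s tol / 4, and a grid step adds at most
    tol/64 to the distance. The margin s tol / 4 is later shared by the sampling error and the error
    of the reference. *)
Lemma fine_bracket : exists j1 j2, [/\ (j1 < m.+1)%N, (0 < j2 <= m.+1)%N,
    `|grid j1 - c| <= tol /\ `|grid j2 - c| <= tol,
    Phi g (grid j1) <= 2^-1 - s * tol / 4 /\ 2^-1 + s * tol / 4 <= Phi g (grid j2) &
    forall j, (j1 < j <= j2)%N -> `|grid j - c| <= tol].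
Proof.
have [mg cg] := ag; have [u0 u1 ku] := inv_k_bounds R k_gt0.
have u2 : 0 <= u ^+ 2 <= 1 by rewrite sqr_ge0 expr_le1 // ltW.
have t0 := crit_tol_gt0 R k_gt0.
have [v1 sk s1 uv] := slope_crit.
have [hc01 hc] := crit_probP R mg nc.
have ktol : k%:R * tol = u ^+ 2 / 64.
  by rewrite /crit_tol exprS !mulrA ku mul1r.
have gam0 : 0 < s * tol by rewrite mulr_gt0 //; lra.
have gam1 : s * tol <= 64^-1.
  by apply: le_trans (ler_wpM2r (ltW t0) sk) _; rewrite ktol; lra.
have [p0 p1] := Phi_grid_ends.
have [|||j1 [j2 [j1m /andP[a b] /andP[j20 j2m] /andP[d e]]]] := @bracket R
  (fun j => Phi g (grid j)) m.+1 (2^-1 - s * tol / 4) (2^-1 + s * tol / 4).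
- by rewrite p0; lra.
- by lra.
- by rewrite p1; lra.
have hd : tol / 2 * (2 * k%:R) <= bern_var c.
  have -> : tol / 2 * (2 * k%:R) = k%:R * tol by field.
  rewrite ktol; apply: (@le_trans _ _ (u / 4)); last by lra.
  have : u ^+ 2 <= u by rewrite expr2; nra.
  by lra.
have pos j : (j <= m.+1)%N -> (Phi g (grid j) < 2^-1 + s * tol / 4 -> grid j < c + tol / 2) /\
    (2^-1 - s * tol / 4 < Phi g (grid j) -> c - tol / 2 < grid j).
  move=> jm; have -> : s * tol / 4 = s / 2 * (tol / 2) by field.
  by apply: position_of_level => //; [exact: grid_bounds|lra].
have [h [sm SS]] : exists h, h <= tol / 64 /\ forall j, grid j.+1 = grid j + h.
  exists m.+1%:R^-1; split; last exact: gridS.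
  by apply: le_trans grid_step _; rewrite /crit_tol -mulrA -invfM; lra.
have L1 := (pos j1.+1 j1m).2 b; rewrite SS in L1.
have j2p : (j2.-1 <= m.+1)%N by apply: leq_trans (leq_pred _) j2m.
have U2 := (pos j2.-1 j2p).1 d.
have E2 : grid j2 = grid j2.-1 + h by rewrite -SS prednK.
have U1 := (Phi_side (grid_bounds R (ltnW j1m))).1 ltac:(lra).
have L2 := (Phi_side (grid_bounds R j2m)).2 ltac:(lra).
exists j1, j2; split=> //; first by rewrite j20.
  by rewrite !ler_norml; split; lra.
move=> j /andP[jj1 jj2]; have := grid_le jj1; have := grid_le jj2.
by rewrite SS ler_norml; lra.
Qed.

End Window.

(** * The implementation *)

Section Tails.
Variables (R : realType) (n m : nat).
Notation sample N := {ffun 'I_N -> {ffun 'I_n -> 'I_m.+1}}.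
Local Notation grid := (grid R m).

Lemma le_freq (T : finType) (P Q : pred T) : (forall x, P x -> Q x) ->
  freq R P <= freq R Q.
Proof.
move=> h; apply: le_average => x; rewrite ler_nat.
by case: (P x) (h x) => // ->.
Qed.

Lemma freq_exists (T : finType) (I : finType) (P : I -> pred T) :
  freq R (fun x => [exists i, P i x]) <= \sum_i freq R (P i).
Proof.
rewrite /freq /average -mulr_suml exchange_big ler_wpM2r ?invr_ge0 //.
apply: ler_sum => x _; rewrite -natr_sum ler_nat.
case: existsP => // -[i Pi]; rewrite (bigD1 i) //= Pi; exact: leq_addr.
Qed.

Lemma sample_space_gt0 : (0 < #|{ffun 'I_n -> 'I_m.+1}|)%N.
Proof. by rewrite card_ffun expn_gt0 card_ord. Qed.

Lemma threshold_tails (g : cube n -> bool) N j (gam L lo hi : R) :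
  (j <= m.+1)%N -> (0 < N)%N -> 0 < gam -> gam <= 2 -> 8 * L <= N%:R * gam ^+ 2 ->
  (Phi g (grid j) + gam <= hi ->
    freq R (fun w : sample N => hi <= threshold_mean R g w j) <= expR (- L)) /\
  (lo <= Phi g (grid j) - gam ->
    freq R (fun w : sample N => threshold_mean R g w j <= lo) <= expR (- L)).
Proof.
move=> jm N0 g0 g2 hL; pose X (U : {ffun 'I_n -> 'I_m.+1}) := (g (threshold_point j U))%:R : R.
have avX : average X = Phi g (grid j) by rewrite (average_threshold (fun x => (g x)%:R)).
have X01 U : 0 <= X U <= 1 by rewrite /X; case: (g _) => /=; lra.
have X2 : average (fun U => X U ^+ 2) <= 1.
  rewrite -(average_cst sample_space_gt0 1); apply: le_average => U.
  by have /andP[a b] := X01 U; rewrite expr_le1.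
have hL' : 8 * 1 * L <= N%:R * gam ^+ 2 by rewrite mulr1.
have g2' : gam <= 2 * 1 by rewrite mulr1.
split=> h.
  apply: le_trans (upper_tail sample_space_gt0 N0 _ X2 g0 g2' hL'); last first.
    by move=> U; have /andP[] := X01 U.
  by apply: le_freq => w; rewrite avX => hw; apply: le_trans hw.
apply: le_trans (lower_tail sample_space_gt0 N0 _ X2 g0 g2' hL'); last first.
  by move=> U; have := X01 U; lra.
by apply: le_freq => w; rewrite avX => hw; apply: le_trans h.
Qed.

End Tails.

Section Algorithm.
Variables (R : realType) (n k b : nat) (L : R).
Local Notation m := (2 ^ b).-1.
Local Notation u := (k%:R^-1 : R).
Local Notation alpha := (level_step R k).
Local Notation grid := (grid R m).
Notation sample N := {ffun 'I_N -> {ffun 'I_n -> 'I_m.+1}}.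
Implicit Types (t : seq (round R n)).

Definition sample_size (x : R) : nat := (Num.truncn x).+1.
Definition coarse_size := sample_size (2 ^+ 27 * k%:R ^+ 4 * L).
(** Proportional to k^7 [ref_radius], so that the distance covered before the next reference can pay
    for it. *)
Definition ref_size j := sample_size (2 ^+ 27 * bern_var (grid j) * k%:R ^+ 6 * L).
(** [w] stands for alpha / Phi'(c) up to constants, so this is of order k^5 L / Phi'(c). *)
Definition fine_size (w : R) := sample_size (2 ^+ 32 * k%:R ^+ 7 * w * L).

Definition draw N : qprog n (sample N) := uniform n [ffun=> [ffun=> ord0]].

(* A reference [(t0, j0, a)]: [a] is a precise estimate of Phi at [grid j0] for
   the restriction reached after the rounds [t0]. *)
Definition ref_type : Type := seq (round R n) * nat * R.

Definition coarse_window t : qprog n (nat * nat) :=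
  bind (draw coarse_size) (fun w =>
  bind (search b t w (2^-1 + alpha)) (fun jp =>
  bind (search b t w (2^-1 - alpha)) (fun jm => Ret (jp, jm)))).

Definition ref_radius j : R := bern_var (grid j) * u / 8.

Definition new_reference t j : qprog n ref_type :=
  bind (draw (ref_size j)) (fun w =>
  bind (empirical t w j) (fun a => Ret (t, j, a))).

Definition reference (old : option ref_type) t j : qprog n ref_type :=
  if old is Some (t0, j0, a) then
    if `|grid j - grid j0| <= ref_radius j0 then Ret (t0, j0, a)
    else new_reference t j
  else new_reference t j.

(* Comparing with the reference on common samples makes the variance small, so
   that few samples suffice. *)
Definition refine (ref : ref_type) t (w : R) : qprog n nat :=
  let: (t0, j0, a) := ref in
  bind (draw (fine_size w)) (fun s =>
  (* The test reads a + (mean of the current restriction - a0) >= 1/2: the precise value [a],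
     corrected on common samples. *)
  bind (empirical t0 s j0) (fun a0 => search b t s (2^-1 - a + a0))).

Definition locate (mem : option ref_type * nat) t : qprog n (R * (option ref_type * nat)) :=
  bind (coarse_window t) (fun '(jp, jm) =>
  bind (reference mem.1 t jp) (fun ref =>
  bind (refine ref t (grid jp - grid jm)) (fun j =>
  Ret (grid j, (Some ref, j))))).

(** The grid index of [p] is taken from the memory, because thresholds produce only grid biases. *)
Definition influences (mem : option ref_type * nat) t (p : R) :
    qprog n (('I_n -> R) * (option ref_type * nat)) :=
  bind (draw coarse_size) (fun s =>
  bind (query_all [seq fix_coords t (threshold_point mem.2 (s l)) | l <- enum 'I_coarse_size])
    (fun bs => Ret (fun i : 'I_n => 4 *
      ((\sum_(l < coarse_size) (nth false bs l)%:R * ((threshold_point mem.2 (s l) i)%:R - grid mem.2)) /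
        coarse_size%:R), mem))).

Definition nonconstancy_test (mem : option ref_type * nat) t :
    qprog n (bool * (option ref_type * nat)) :=
  bind (query_all [:: fix_coords t (cube0 n); fix_coords t (cube1 n)])
    (fun bs => Ret (nth false bs 0 != nth false bs 1, mem)).

Variable f : cube n -> bool.
Hypotheses (k_gt0 : (0 < k)%N) (L_gt0 : 0 < L) (fine_grid : 4096 * k%:R ^+ 3 <= (2 ^ b)%:R :> R).
Local Notation tol := (crit_tol R k).
Local Notation c g := (crit_prob R g).

Lemma grid_size : m.+1 = (2 ^ b)%N.
Proof. by rewrite prednK // expn_gt0. Qed.

Lemma fine_grid' : 4096 * k%:R ^+ 3 <= m.+1%:R :> R.
Proof. by rewrite grid_size. Qed.

Lemma sample_size_ge (x : R) : x <= (sample_size x)%:R.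
Proof. by apply: ltW; exact: truncnS_gt. Qed.

Lemma sample_size_le (x : R) : 0 <= x -> (sample_size x)%:R <= x + 1.
Proof. by move=> x0; rewrite /sample_size -natr1 lerD2r truncn_le. Qed.

Lemma whp_draw N (bad : pred (sample N)) q :
  whp f (freq R bad) (fun w q' => ~~ bad w /\ q' = q) q (draw N).
Proof. exact: whp_uniform. Qed.

Lemma tail_prob_ge0 : 0 <= expR (- L). Proof. exact: expR_ge0. Qed.

Lemma coarse_size_ge : 8 * L <= coarse_size%:R * (alpha / 4) ^+ 2.
Proof.
have [u0 u1 ku] := inv_k_bounds R k_gt0.
have a2 : 0 <= (alpha / 4) ^+ 2 by rewrite sqr_ge0.
apply: le_trans (ler_wpM2r a2 (sample_size_ge _)).
have -> : 2 ^+ 27 * k%:R ^+ 4 * L * (alpha / 4) ^+ 2 = 8 * L :> R.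
  by rewrite /level_step; field; rewrite pnatr_eq0 -lt0n.
exact: lexx.
Qed.

Definition coarse_ok (g : cube n -> bool) jp jm :=
  [/\ (jp <= m.+1)%N, (jm <= m.+1)%N,
    `|Phi g (grid jp) - (2^-1 + alpha)| <= alpha / 2 &
    `|Phi g (grid jm) - (2^-1 - alpha)| <= alpha / 2].

(** One sample serves both searches; each relies on the empirical mean at the two ends of its
    bracket, hence four tails. *)
Lemma whp_coarse_window t q : admissible k (current f t) -> ~ is_constant (current f t) ->
  whp f (4 * expR (- L)) (fun '(jp, jm) q' => coarse_ok (current f t) jp jm /\
    q' = (q + 2 * (b * coarse_size))%N) q (coarse_window t).
Proof.
move=> ag nc; have [mg cg] := ag; set g := current f t in ag nc mg cg *.
have /andP[l0 l1] := level_step_bounds R k_gt0.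
have [u0 u1 ku] := inv_k_bounds R k_gt0.
have u2 : u ^+ 2 <= 1 by rewrite expr_le1 // ltW.
have [|j1 [j2 [j1m /andP[j20 j2m] h1 h2 hj]]] :=
  coarse_bracket k_gt0 ag nc fine_grid' (theta := 2^-1 + alpha).
  by rewrite addrAC subrr add0r ger0_norm // ltW.
have [|i1 [i2 [i1m /andP[i20 i2m] g1 g2 gj]]] :=
  coarse_bracket k_gt0 ag nc fine_grid' (theta := 2^-1 - alpha).
  by rewrite addrAC subrr add0r normrN ger0_norm // ltW.
pose lowbad j th (w : sample coarse_size) := th <= threshold_mean R g w j.
pose highbad j th (w : sample coarse_size) := threshold_mean R g w j < th.
have N0 : (0 < coarse_size)%N by [].
have t0 : 0 < alpha / 4 by lra.
have t2 : alpha / 4 <= 2 by rewrite /level_step in l1 *; lra.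
have tl j (jm : (j <= m.+1)%N) lo hi := threshold_tails g lo hi jm N0 t0 t2 coarse_size_ge.
pose bad w := lowbad j1 (2^-1 + alpha) w || (highbad j2 (2^-1 + alpha) w ||
  (lowbad i1 (2^-1 - alpha) w || highbad i2 (2^-1 - alpha) w)).
have badP : freq R bad <= 4 * expR (- L).
  have B1 := (tl j1 (ltnW j1m) 0 (2^-1 + alpha)).1 ltac:(lra).
  have B2 := (tl j2 j2m (2^-1 + alpha) 0).2 ltac:(lra).
  have B3 := (tl i1 (ltnW i1m) 0 (2^-1 - alpha)).1 ltac:(lra).
  have B4 := (tl i2 i2m (2^-1 - alpha) 0).2 ltac:(lra).
  have C2 : freq R (highbad j2 (2^-1 + alpha)) <= expR (- L).
    by apply: le_trans B2; apply: le_freq => w; apply: ltW.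
  have C4 : freq R (highbad i2 (2^-1 - alpha)) <= expR (- L).
    by apply: le_trans B4; apply: le_freq => w; apply: ltW.
  have D1 := freq_or R (lowbad j1 (2^-1 + alpha)) (fun w => highbad j2 (2^-1 + alpha) w ||
    (lowbad i1 (2^-1 - alpha) w || highbad i2 (2^-1 - alpha) w)).
  have D2 := freq_or R (highbad j2 (2^-1 + alpha))
    (fun w => lowbad i1 (2^-1 - alpha) w || highbad i2 (2^-1 - alpha) w).
  have D3 := freq_or R (lowbad i1 (2^-1 - alpha)) (highbad i2 (2^-1 - alpha)).
  rewrite /bad; apply: le_trans D1 _.
  by rewrite /lowbad in D2 D3 *; lra.
rewrite -[4 * _]addr0; apply: whp_bind => //.
  exact: (whp_mono badP (fun _ _ h => h) (whp_draw bad q)).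
move=> w q1 [/norP[nb1 /norP[nb2 /norP[nb3 nb4]]] ->].
rewrite /lowbad /highbad -!ltNge -?leNgt in nb1 nb2 nb3 nb4.
have j1b : (j1 < 2 ^ b)%N by rewrite -grid_size.
have i1b : (i1 < 2 ^ b)%N by rewrite -grid_size.
have W1 : threshold_mean R g w j1 < 2^-1 + alpha <= threshold_mean R g w j2 by rewrite nb1.
have W2 : threshold_mean R g w i1 < 2^-1 - alpha <= threshold_mean R g w i2 by rewrite nb3.
apply: (whp_seq (lexx _) (whp_search q mg j1b j20 W1)) => jp q2 [hp /andP[_ hpb] ->].
apply: (whp_seq (lexx _) (whp_search _ mg i1b i20 W2)) => jm q3 [hm /andP[_ hmb] ->].
apply: whp_ret; split; last by rewrite mul2n -addnn addnA.
by split; rewrite ?grid_size //; [exact: hj|exact: gj].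
Qed.


End Algorithm.

(** * Locating the critical probability *)

Section Estimates.
Variables (R : realType) (n k b : nat) (L : R).
Local Notation m := (2 ^ b).-1.
Local Notation u := (k%:R^-1 : R).
Local Notation alpha := (level_step R k).
Local Notation grid := (grid R m).
Local Notation tol := (crit_tol R k).
Local Notation c g := (crit_prob R g).
Local Notation ref_type := (ref_type R n).
Local Notation ref_radius := (ref_radius R k b).
Local Notation coarse_size := (coarse_size k L).
Local Notation ref_size := (ref_size k b L).
Local Notation fine_size := (fine_size k L).
Local Notation coarse_ok := (@coarse_ok R n k b).
Local Notation new_reference := (@new_reference R n k b L).
Local Notation reference := (@reference R n k b L).
Local Notation refine := (@refine R n k b L).
Notation sample N := {ffun 'I_N -> {ffun 'I_n -> 'I_m.+1}}.
Implicit Types (t : seq (round R n)) (g : cube n -> bool).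
Variable f : cube n -> bool.
Hypotheses (k_gt0 : (0 < k)%N) (L_gt0 : 0 < L) (fine_grid : 4096 * k%:R ^+ 3 <= (2 ^ b)%:R :> R).

Lemma inv_k_cube : u ^+ 3 <= u.
Proof.
have [u0 u1 ku] := inv_k_bounds R k_gt0.
have h : u ^+ 2 <= 1 by rewrite expr_le1 // ltW.
by have := ler_wpM2l (ltW u0) h; rewrite mulr1 -exprS.
Qed.

(** [v] will be the bit set in all rounds since [g0]. Comparability turns a mean absolute difference
    into a difference of Phi. *)
Definition comparable_as (v : bool) (g g0 : cube n -> bool) :=
  forall x, if v then g0 x ==> g x else g x ==> g0 x.

Lemma average_abs (T : finType) (v : bool) (F : T -> R) :
  (forall x, if v then 0 <= F x else F x <= 0) ->
  average (fun x => `|F x|) = `|average F|.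
Proof.
case: v => h.
  rewrite ger0_norm; last by rewrite divr_ge0 // sumr_ge0.
  by congr (_ / _); apply: eq_bigr => x _; rewrite ger0_norm.
rewrite ler0_norm; last by rewrite mulr_le0_ge0 ?invr_ge0 // sumr_le0.
by rewrite -averageN; congr (_ / _); apply: eq_bigr => x _; rewrite ler0_norm.
Qed.

Definition threshold_diff (g g0 : cube n -> bool) j j0 (U : {ffun 'I_n -> 'I_m.+1}) : R :=
  (g (threshold_point j U))%:R - (g0 (threshold_point j0 U))%:R.

Lemma threshold_diff_bounds g g0 j j0 U : -1 <= threshold_diff g g0 j j0 U <= 1.
Proof. by rewrite /threshold_diff; case: (g _); case: (g0 _) => /=; lra. Qed.

Lemma average_threshold_diff g g0 j j0 : (j <= m.+1)%N -> (j0 <= m.+1)%N ->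
  average (threshold_diff g g0 j j0) = Phi g (grid j) - Phi g0 (grid j0).
Proof.
move=> jm j0m; rewrite averageD averageN.
rewrite (average_threshold (fun x => (g x)%:R)) //.
by rewrite (average_threshold (fun x => (g0 x)%:R)).
Qed.

(** Passing through [g] at [j0] splits the difference into two parts of constant sign, one by
    monotonicity in the threshold and one by comparability. *)
Lemma threshold_diff_moment (v : bool) g g0 j j0 : monotone g -> comparable_as v g g0 ->
  (j <= m.+1)%N -> (j0 <= m.+1)%N ->
  average (fun U => threshold_diff g g0 j j0 U ^+ 2) <=
  `|Phi g (grid j) - Phi g (grid j0)| + `|Phi g (grid j0) - Phi g0 (grid j0)|.
Proof.
move=> mg cmp jm j0m; rewrite -!average_threshold_diff //.
rewrite -(@average_abs _ (j0 <= j)%N); last first.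
  move=> U; rewrite /threshold_diff; case: leqP => h.
    rewrite subr_ge0 ler_nat.
    have := mg _ _ (fun i => threshold_mono U i h).
    by case: (g _) => //= ->.
  rewrite subr_le0 ler_nat.
  have := mg _ _ (fun i => threshold_mono U i (ltnW h)).
  by case: (g _) => //= ->.
rewrite -(@average_abs _ v); last first.
  move=> U; rewrite /threshold_diff; have := cmp (threshold_point j0 U).
  by case: v {cmp}; case: (g _); case: (g0 _) => //= _; lra.
rewrite -averageD; apply: le_average => U; rewrite /threshold_diff.
by case: (g (threshold_point j U)); case: (g (threshold_point j0 U));
  case: (g0 _) => /=;
  rewrite ?subrr ?sub0r ?subr0 ?normrN ?normr1 ?normr0 ?sqrrN ?expr1n ?expr0n /=; lra.
Qed.

Lemma threshold_mean_diff g g0 N (w : sample N) j j0 :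
  sample_mean (threshold_diff g g0 j j0) w = threshold_mean R g w j - threshold_mean R g0 w j0.
Proof. by rewrite /sample_mean sumrB mulrBl. Qed.

(** The aim is O(Phi'(c) / k^3); by Poincare 1/(p (1-p)) may stand in for the unknown slope. *)
Definition ref_error j : R := u ^+ 3 / (4096 * bern_var (grid j)).

Definition ref_ok (g : cube n -> bool) j (a : R) :=
  [/\ admissible k g, ~ is_constant g, (j <= m.+1)%N,
    `|Phi g (grid j) - (2^-1 + alpha)| <= alpha / 2 &
    `|a - Phi g (grid j)| <= ref_error j].

Lemma bern_var_le (q : R) : bern_var q <= 4^-1.
Proof. by have := sqr_ge0 (q - 2^-1); rewrite /bern_var expr2; lra. Qed.

Lemma ref_var g j : admissible k g -> ~ is_constant g -> (j <= m.+1)%N ->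
  `|Phi g (grid j) - (2^-1 + alpha)| <= alpha / 2 -> u <= 8 * bern_var (grid j).
Proof.
move=> ag nc jm h.
have [cq hd _ _] := coarse_upper k_gt0 ag nc (@grid_bounds R m j jm) h.
have [_ _ _ uv] := slope_crit R k_gt0 ag nc.
have [u0 u1 ku] := inv_k_bounds R k_gt0.
have [/andP[c0 c1] _] := crit_probP R ag.1 nc.
have cc : 0 <= c g <= 1 by lra.
have := bern_var_dist cc (@grid_bounds R m j jm).
rewrite distrC ger0_norm ?subr_ge0 //.
have := ler_wpM2l (_ : 0 <= bern_var (c g)) u1; rewrite mulr1.
by have v0 : 0 <= bern_var (c g) by [lra]; move=> /(_ v0); lra.
Qed.

Lemma whp_new_reference t j q : admissible k (current f t) -> ~ is_constant (current f t) ->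
  (j <= m.+1)%N -> `|Phi (current f t) (grid j) - (2^-1 + alpha)| <= alpha / 2 ->
  whp f (2 * expR (- L)) (fun r q' => [/\ r.1 = (t, j), ref_ok (current f t) j r.2 &
    q' = (q + ref_size j)%N]) q (new_reference t j).
Proof.
move=> ag nc jm hj; have [mg cg] := ag; set g := current f t in ag nc mg cg hj *.
have [u0 u1 ku] := inv_k_bounds R k_gt0.
have uv := ref_var ag nc jm hj; have v4 := bern_var_le (grid j).
have v0 : 0 < bern_var (grid j) by lra.
have d0 : 0 < 4096 * bern_var (grid j) by lra.
have e0 : 0 < ref_error j by rewrite /ref_error divr_gt0 ?exprn_gt0.
have e1 : ref_error j <= 2.
  rewrite /ref_error ler_pdivrMr //.
  have := inv_k_cube.
  by lra.
have hN : 8 * L <= (ref_size j)%:R * ref_error j ^+ 2.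
  apply: le_trans (ler_wpM2r (sqr_ge0 _) (sample_size_ge _)).
  have -> : 2 ^+ 27 * bern_var (grid j) * k%:R ^+ 6 * L * ref_error j ^+ 2 =
      8 * L * (bern_var (grid j))^-1.
    by rewrite /ref_error; field; rewrite pnatr_eq0 -lt0n k_gt0 gt_eqF.
  rewrite ler_peMr ?mulr_ge0 ?(ltW L_gt0) // invf_ge1 //; lra.
have tl := threshold_tails g (Phi g (grid j) - ref_error j) (Phi g (grid j) + ref_error j)
  jm (isT : (0 < ref_size j)%N) e0 e1 hN.
pose bad (w : sample (ref_size j)) := (Phi g (grid j) + ref_error j <= threshold_mean R g w j) ||
  (threshold_mean R g w j <= Phi g (grid j) - ref_error j).
have badP : freq R bad <= 2 * expR (- L).
  have B1 := tl.1 (lexx _); have B2 := tl.2 (lexx _).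
  have := freq_or R (fun w : sample (ref_size j) => Phi g (grid j) + ref_error j <= threshold_mean R g w j)
    (fun w => threshold_mean R g w j <= Phi g (grid j) - ref_error j).
  by rewrite /bad; lra.
rewrite -[2 * _]addr0; apply: whp_bind => //.
  exact: (whp_mono badP (fun _ _ h => h) (whp_draw R f bad q)).
move=> w q1 [/norP[nb1 nb2] ->]; rewrite -!ltNge in nb1 nb2.
apply: (whp_seq (lexx _) (whp_empirical f _ _ _ _)) => a q2 [-> ->].
apply: whp_ret; split=> //; split=> //=.
by rewrite ler_norml; lra.
Qed.

Lemma whp_reference old t j q : admissible k (current f t) -> ~ is_constant (current f t) ->
  (j <= m.+1)%N -> `|Phi (current f t) (grid j) - (2^-1 + alpha)| <= alpha / 2 ->
  (forall r, old = Some r -> ref_ok (current f r.1.1) r.1.2 r.2) ->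
  whp f (2 * expR (- L)) (fun r q' => [/\ ref_ok (current f r.1.1) r.1.2 r.2,
      `|grid j - grid r.1.2| <= ref_radius r.1.2 &
      (old = Some r /\ q' = q) \/
      [/\ r.1 = (t, j),
        forall r', old = Some r' -> ref_radius r'.1.2 < `|grid j - grid r'.1.2| &
        q' = (q + ref_size j)%N]]) q (reference old t j).
Proof.
move=> ag nc jm hj hold.
have u0 : 0 < u by rewrite invr_gt0 ltr0n.
have v0 : 0 <= ref_radius j.
  have := ref_var ag nc jm hj => h.
  by rewrite divr_ge0 // mulr_ge0 ?ltW //; lra.
have new : (forall r', old = Some r' -> ref_radius r'.1.2 < `|grid j - grid r'.1.2|) ->
    whp f (2 * expR (- L)) (fun r q' => [/\ ref_ok (current f r.1.1) r.1.2 r.2,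
      `|grid j - grid r.1.2| <= ref_radius r.1.2 &
      (old = Some r /\ q' = q) \/
      [/\ r.1 = (t, j),
        forall r', old = Some r' -> ref_radius r'.1.2 < `|grid j - grid r'.1.2| &
        q' = (q + ref_size j)%N]]) q (new_reference t j).
  move=> ho; apply: whp_mono (whp_new_reference q ag nc jm hj) => //.
  move=> [[t1 j1] a] q' /= [[-> ->] ok ->]; split=> //.
    by rewrite subrr normr0.
  by right.
have d0 : 0 <= 2 * expR (- L) by rewrite mulr_ge0 // expR_ge0.
case: old hold new => [[[t0 j0] a]|] hold new /=; last exact: new.
case: ifPn => h.
  apply: whp_mono d0 (fun _ _ h => h) _; apply: whp_ret.
  by split=> //; [exact: (hold _ erefl)|left].
by apply: new => r' [<-]; rewrite ltNge.
Qed.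

(** The radius v u / 8 and the offset v u / 32 of the grid point add up to less than v u / 5, even
    after v = p (1-p) is moved from the reference to c. *)
Lemma reference_near g j jr : admissible k g -> ~ is_constant g ->
  (j <= m.+1)%N -> (jr <= m.+1)%N ->
  `|Phi g (grid j) - (2^-1 + alpha)| <= alpha / 2 ->
  `|grid j - grid jr| <= ref_radius jr ->
  5 * `|grid jr - c g| <= bern_var (c g) * u /\
  4 * bern_var (c g) <= 5 * bern_var (grid jr).
Proof.
move=> ag nc jm jrm hj hr.
have [cq hd _ _] := coarse_upper k_gt0 ag nc (@grid_bounds R m j jm) hj.
have [_ _ _ uv] := slope_crit R k_gt0 ag nc.
have [u0 u1 ku] := inv_k_bounds R k_gt0.
have [/andP[c0 c1] _] := crit_probP R ag.1 nc.
have cc : 0 <= c g <= 1 by lra.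
have B1 := bern_var_dist cc (@grid_bounds R m jr jrm).
have B2 := bern_var_dist (@grid_bounds R m jr jrm) cc.
rewrite distrC in B1; set d := `|grid jr - c g| in B1 B2 *.
have d0 : 0 <= d by exact: normr_ge0.
have tri : d <= `|grid j - grid jr| + (grid j - c g).
  rewrite -[grid j - c g]ger0_norm ?subr_ge0 //.
  by rewrite [`|grid j - grid jr|]distrC; apply: ler_distD.
have h1 : bern_var (grid jr) * u <= bern_var (c g) * u + d * u.
  by rewrite -mulrDl ler_pM2r.
have h2 : d * u <= d by rewrite ler_piMr.
have v0 : 0 <= bern_var (c g) by lra.
have h3 : bern_var (c g) * u <= bern_var (c g) by rewrite ler_piMr.
rewrite /ref_radius in hr.
have key : 5 * d <= bern_var (c g) * u by lra.
by split=> //; lra.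
Qed.

(** Phi of [g] at [j] and at [jr], and Phi of [g0] at [jr], all deviate from 1/2 by O(s u), so both
    parts in [threshold_diff_moment] are of that size. *)
Lemma fine_variance (v : bool) g g0 a j jr jp : admissible k g -> ~ is_constant g ->
  comparable_as v g g0 -> ref_ok g0 jr a -> (jp <= m.+1)%N ->
  `|Phi g (grid jp) - (2^-1 + alpha)| <= alpha / 2 ->
  `|grid jp - grid jr| <= ref_radius jr ->
  (j <= m.+1)%N -> `|grid j - c g| <= tol ->
  average (fun U => threshold_diff g g0 j jr U ^+ 2) <= slope g (c g) * u.
Proof.
move=> ag nc cmp [_ _ jrm hjr _] jpm hjp hr jm hj; have [mg cg] := ag.
apply: le_trans (threshold_diff_moment mg cmp jm jrm) _.
have [near _] := reference_near ag nc jpm jrm hjp hr.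
have [v1 sk s1 uv] := slope_crit R k_gt0 ag nc.
have [u0 u1 ku] := inv_k_bounds R k_gt0.
set s := slope g (c g) in v1 sk s1 *; set d := `|grid jr - c g| in near *.
have v4 := bern_var_le (c g).
have d0 : 0 <= d by exact: normr_ge0.
have win x y : 5 * x <= bern_var (c g) * u -> `|y - c g| <= x ->
    `|Phi g y - 2^-1| <= 2 * s * x.
  move=> hx hy; apply: (@le_trans _ _ (2 * s * `|y - c g|)); last first.
    by rewrite ler_wpM2l //; lra.
  apply: (window_norm k_gt0 ag nc).
  apply: (@le_trans _ _ (x * (2 * k%:R))); first by rewrite ler_wpM2r // mulr_ge0.
  have := ler_wpM2r (ler0n R k) hx.
  have -> : bern_var (c g) * u * k%:R = bern_var (c g) by rewrite -mulrA [u * _]mulrC ku mulr1.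
  by lra.
have u2 : u ^+ 2 <= u by rewrite expr2 ler_piMr // ltW.
have tolE : 64 * tol = u * u ^+ 2 by rewrite /crit_tol exprS; field; rewrite pnatr_eq0 -lt0n.
have t5 : 5 * tol <= bern_var (c g) * u.
  have : u * u ^+ 2 <= u * u by rewrite ler_pM2l.
  have : u * u <= 4 * bern_var (c g) * u by rewrite ler_pM2r.
  by lra.
have P1 := win tol (grid j) t5 hj.
have P2 := win d (grid jr) near (lexx _).
have su : u <= s * u by rewrite ler_peMl // ltW.
have sv : s * (bern_var (c g) * u) <= s * (4^-1 * u).
  by rewrite ler_wpM2l ?ler_wpM2r //; [lra|exact: ltW].
have sd : s * (5 * d) <= s * (bern_var (c g) * u) by rewrite ler_wpM2l //; lra.
have st : s * (5 * tol) <= s * (bern_var (c g) * u) by rewrite ler_wpM2l //; lra.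
have al : alpha <= u / 1024 by rewrite /level_step; lra.
have stt : s * (64 * tol) <= s * u.
  rewrite tolE ler_wpM2l //; first by lra.
  by rewrite -exprS inv_k_cube.
move: P1 P2 hjr; rewrite !ler_norml => /andP[a1 a2] /andP[b1 b2] /andP[e1 e2].
have N1 : `|Phi g (grid j) - Phi g (grid jr)| <= 2 * s * tol + 2 * s * d.
  by rewrite ler_norml; lra.
have N2 : `|Phi g (grid jr) - Phi g0 (grid jr)| <= 2 * s * d + 3 / 2 * alpha.
  by rewrite ler_norml; lra.
by lra.
Qed.

(** Bernstein with second moment s u and deviation s tol / 8 needs O(k^5 L / s) samples, and w >=
    alpha / (2 s) shows that [fine_size] provides them. *)
Lemma whp_refine (v : bool) t (ref : ref_type) jp jm q :
  admissible k (current f t) -> ~ is_constant (current f t) ->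
  comparable_as v (current f t) (current f ref.1.1) ->
  ref_ok (current f ref.1.1) ref.1.2 ref.2 ->
  coarse_ok (current f t) jp jm -> `|grid jp - grid ref.1.2| <= ref_radius ref.1.2 ->
  whp f (2 * expR (- L)) (fun j q' => [/\ (j <= m.+1)%N,
      `|grid j - c (current f t)| <= tol &
      q' = (q + fine_size (grid jp - grid jm) + b * fine_size (grid jp - grid jm))%N]) q
    (refine ref t (grid jp - grid jm)).
Proof.
case: ref => [[t0 jr] a]; cbn [fst snd] => ag nc cmp rok [jpm jmm hjp hjm] hr; rewrite /refine.
have [mg cg] := ag; set g := current f t in ag nc cmp hjp hjm mg cg *.
set g0 := current f t0 in cmp rok *; have [_ _ jrm hjr ha] := rok.
have [v1 sk s1 uv] := slope_crit R k_gt0 ag nc.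
have [u0 u1 ku] := inv_k_bounds R k_gt0.
have [near vv] := reference_near ag nc jpm jrm hjp hr.
have [cq _ wp _] := coarse_upper k_gt0 ag nc (grid_bounds R jpm) hjp.
have [qc _ wm _] := coarse_lower k_gt0 ag nc (grid_bounds R jmm) hjm.
set s := slope g (c g) in v1 sk s1 wp wm *.
set w := grid jp - grid jm.
have sw : alpha <= 2 * (s * w) by rewrite /w; lra.
have w0 : 0 <= w by rewrite /w; lra.
have s0 : 0 < s by lra.
pose tt := s * tol / 8.
have tol0 := crit_tol_gt0 R k_gt0.
have tt0 : 0 < tt by rewrite divr_gt0 // mulr_gt0.
have tt1 : tt <= 2 * (s * u).
  have : s * tol <= s * u.
    rewrite ler_pM2l // /crit_tol.
    have := inv_k_cube.
    by lra.
  have : 0 < s * u by rewrite mulr_gt0.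
  by rewrite /tt; lra.
have hN : 8 * (s * u) * L <= (fine_size w)%:R * tt ^+ 2.
  apply: le_trans (ler_wpM2r (sqr_ge0 _) (sample_size_ge _)).
  have -> : 2 ^+ 32 * k%:R ^+ 7 * w * L * tt ^+ 2 = 2 ^+ 14 * k%:R * (s * w) * (s * L).
    by rewrite /tt /crit_tol; field; rewrite pnatr_eq0 -lt0n.
  have -> : 8 * (s * u) * L = 2 ^+ 13 * k%:R * alpha * (s * L).
    by rewrite /level_step; field; rewrite pnatr_eq0 -lt0n.
  have sL : 0 <= s * L by rewrite mulr_ge0 // ltW.
  rewrite ler_wpM2r //.
  have := ler_wpM2l (mulr_ge0 (exprn_ge0 13 (ler0n R 2)) (ler0n R k)) sw.
  by rewrite (exprS _ 13); lra.
(* This amounts to 8 v s >= 1 with v = p (1-p) at the reference: Poincare at c, moved by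
   [reference_near]. *)
have e0 : ref_error jr <= tt.
  have vr0 : 0 < bern_var (grid jr) by lra.
  have d0 : 0 < 4096 * bern_var (grid jr) by lra.
  rewrite /ref_error /tt ler_pdivrMr //.
  have -> : s * tol / 8 * (4096 * bern_var (grid jr)) = u ^+ 3 * (8 * bern_var (grid jr) * s).
    by rewrite /crit_tol; field; rewrite pnatr_eq0 -lt0n.
  rewrite ler_peMr ?exprn_ge0 ?ltW //.
  have : 4 * bern_var (c g) * s <= 5 * bern_var (grid jr) * s by rewrite ler_pM2r.
  have : 0 < bern_var (grid jr) * s by rewrite mulr_gt0.
  by lra.
have [j1 [j2 [j1m /andP[j20 j2m] [near1 near2] [lo hi] hj]]] := fine_bracket k_gt0 ag nc (fine_grid' fine_grid).
rewrite -/s in lo hi.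
have X1 j U := threshold_diff_bounds g g0 j jr U.
have V1 := fine_variance ag nc cmp rok jpm hjp hr (ltnW j1m) near1.
have V2 := fine_variance ag nc cmp rok jpm hjp hr j2m near2.
have T1 := @upper_tail R _ (fine_size w) (threshold_diff g g0 j1 jr) _ tt L
  (sample_space_gt0 n m) isT (fun U => (andP (X1 j1 U)).2) V1 tt0 tt1 hN.
have T2 := @lower_tail R _ (fine_size w) (threshold_diff g g0 j2 jr) _ tt L
  (sample_space_gt0 n m) isT (fun U => (andP (X1 j2 U)).1) V2 tt0 tt1 hN.
pose bad1 (x : sample (fine_size w)) :=
  average (threshold_diff g g0 j1 jr) + tt <= sample_mean (threshold_diff g g0 j1 jr) x.
pose bad2 (x : sample (fine_size w)) :=
  sample_mean (threshold_diff g g0 j2 jr) x <= average (threshold_diff g g0 j2 jr) - tt.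
have badP : freq R (fun x => bad1 x || bad2 x) <= 2 * expR (- L).
  apply: le_trans (freq_or R bad1 bad2) _.
  by rewrite mulr_natl mulr2n lerD.
rewrite -[2 * _]addr0; apply: whp_bind => //.
  exact: (whp_mono badP (fun _ _ h => h) (whp_draw R f _ q)).
move=> x q1 [/norP[nb1 nb2] ->]; rewrite /bad1 /bad2 -!ltNge in nb1 nb2.
rewrite !threshold_mean_diff !average_threshold_diff ?(ltnW j1m) // in nb1 nb2.
apply: (whp_seq (lexx _) (whp_empirical f _ _ _ _)) => a0 q2 [-> ->].
move: ha; rewrite ler_norml => /andP[ha1 ha2].
have j1b : (j1 < 2 ^ b)%N by rewrite -grid_size.
have W : threshold_mean R g x j1 < 2^-1 - a + threshold_mean R g0 x jr <= threshold_mean R g x j2.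
  by rewrite /tt in nb1 nb2 e0; lra.
apply: whp_mono (whp_search _ mg j1b j20 W) => // j q' [hjj /andP[_ jb] ->].
by split=> //; [rewrite grid_size|exact: hj].
Qed.


End Estimates.

(** * Influence estimates and the query cost of a round *)

Section RoundSpecs.
Variables (R : realType) (n k b : nat) (L : R).
Local Notation m := (2 ^ b).-1.
Local Notation u := (k%:R^-1 : R).
Local Notation alpha := (level_step R k).
Local Notation grid := (grid R m).
Local Notation tol := (crit_tol R k).
Local Notation c g := (crit_prob R g).
Local Notation ref_type := (ref_type R n).
Local Notation ref_radius := (ref_radius R k b).
Local Notation coarse_size := (coarse_size k L).
Local Notation ref_size := (ref_size k b L).
Local Notation fine_size := (fine_size k L).
Local Notation coarse_ok := (@coarse_ok R n k b).
Local Notation ref_ok := (@ref_ok R n k b).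
Notation sample N := {ffun 'I_N -> {ffun 'I_n -> 'I_m.+1}}.
Implicit Types (t : seq (round R n)) (g : cube n -> bool).
Variable f : cube n -> bool.
Hypotheses (k_gt0 : (0 < k)%N) (L_ge1 : 1 <= L) (b_gt0 : (0 < b)%N)
  (fine_grid : 4096 * k%:R ^+ 3 <= (2 ^ b)%:R :> R).

Let L_gt0 : 0 < L. Proof. by apply: lt_le_trans L_ge1. Qed.

Lemma influence_tails g i j : monotone g -> (j <= m.+1)%N ->
  freq R (fun w : sample coarse_size =>
    u ^+ 2 / 32 <= `|sample_mean (fun U => (g (threshold_point j U))%:R *
      ((threshold_point j U i)%:R - grid j)) w - rerand_inf g (grid j) i / 4|) <=
  2 * expR (- L).
Proof.
move=> mg jm; pose X (U : {ffun 'I_n -> 'I_m.+1}) : R :=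
  (g (threshold_point j U))%:R * ((threshold_point j U i)%:R - grid j).
have avX : average X = rerand_inf g (grid j) i / 4.
  rewrite rerand_inf_corr // (average_threshold (fun x => (g x)%:R * ((x i)%:R - grid j))) //.
  by field.
have /andP[p0 p1] := @grid_bounds R m j jm.
have X1 U : -1 <= X U <= 1.
  by rewrite /X; case: (g _); case: (threshold_point j U i) => /=; lra.
have X2 : average (fun U => X U ^+ 2) <= 1.
  rewrite -(average_cst (sample_space_gt0 n m) 1); apply: le_average => U.
  have /andP[x0 x1] := X1 U.
  by have : 0 <= (1 - X U) * (1 + X U) by [apply: mulr_ge0; lra]; rewrite expr2; lra.
have [u0 u1 ku] := inv_k_bounds R k_gt0.
have u2 : u ^+ 2 <= 1 by rewrite expr_le1 // ltW.
have t0 : 0 < u ^+ 2 / 32 by rewrite divr_gt0 ?exprn_gt0.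
have t2 : u ^+ 2 / 32 <= 2 * 1 by lra.
have hN : 8 * 1 * L <= coarse_size%:R * (u ^+ 2 / 32) ^+ 2.
  rewrite mulr1; apply: le_trans (coarse_size_ge L k_gt0) _.
  rewrite ler_wpM2l // lerXn2r ?nnegrE //; [|exact: ltW|].
    by rewrite /level_step; lra.
  by rewrite /level_step; lra.
have T1 := @upper_tail R _ coarse_size X _ _ L (sample_space_gt0 n m) isT
  (fun U => (andP (X1 U)).2) X2 t0 t2 hN.
have T2 := @lower_tail R _ coarse_size X _ _ L (sample_space_gt0 n m) isT
  (fun U => (andP (X1 U)).1) X2 t0 t2 hN.
rewrite avX in T1 T2.
apply: (@le_trans _ _ (freq R (fun w : sample coarse_size =>
  (rerand_inf g (grid j) i / 4 + u ^+ 2 / 32 <= sample_mean X w) ||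
  (sample_mean X w <= rerand_inf g (grid j) i / 4 - u ^+ 2 / 32)))); last first.
  apply: le_trans (freq_or R _ _) _.
  by rewrite mulr_natl mulr2n lerD.
apply: le_freq => w; rewrite -/X.
have [d|d] := ger0P (sample_mean X w - rerand_inf g (grid j) i / 4) => h.
  by apply/orP; left; lra.
by apply/orP; right; lra.
Qed.

Lemma whp_influences t (mem : option ref_type * nat) p q : monotone (current f t) ->
  (mem.2 <= m.+1)%N ->
  whp f (2 * n%:R * expR (- L)) (fun em q' => [/\ em.2 = mem,
    forall i, `|em.1 i - rerand_inf (current f t) (grid mem.2) i| <= u ^+ 2 / 8 &
    q' = (q + coarse_size)%N]) q (influences k b L mem t p).
Proof.
move=> mg jm; set g := current f t in mg *; set j := mem.2 in jm *.
pose X i (U : {ffun 'I_n -> 'I_m.+1}) : R :=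
  (g (threshold_point j U))%:R * ((threshold_point j U i)%:R - grid j).
pose bad (i : 'I_n) (w : sample coarse_size) :=
  u ^+ 2 / 32 <= `|sample_mean (X i) w - rerand_inf g (grid j) i / 4|.
have badP : freq R (fun w => [exists i, bad i w]) <= 2 * n%:R * expR (- L).
  apply: le_trans (freq_exists R bad) _.
  apply: (@le_trans _ _ (\sum_(i < n) 2 * expR (- L))).
    by apply: ler_sum => i _; exact: influence_tails.
  by rewrite sumr_const card_ord -[X in X <= _]mulr_natr; lra.
rewrite -[_ * expR _]addr0; apply: whp_bind => //.
  exact: (whp_mono badP (fun _ _ h => h) (whp_draw R f _ q)).
move=> w q1 [/existsPn nb ->].
apply: (whp_seq (lexx _) (whp_query_all R f _ _)) => bs q2 [-> ->].
apply: whp_ret; split=> //=; last by rewrite size_map size_enum_ord.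
move=> i; have := nb i; rewrite /bad -ltNge.
set e := (X in 4 * X).
have -> : e = sample_mean (X i) w.
  rewrite /e /sample_mean; congr (_ / _); apply: eq_bigr => l _.
  rewrite -map_comp (nth_map l) ?size_enum_ord // nth_ord_enum.
  by [].
by rewrite !ltr_norml ler_norml => /andP[a a']; lra.
Qed.

Lemma whp_nonconstancy_test t (mem : option ref_type * nat) q :
  whp f (0 : R) (fun bm q' => [/\ bm.1 = (current f t (cube0 n) != current f t (cube1 n)),
    bm.2 = mem & q' = (q + 2)%N]) q (nonconstancy_test mem t).
Proof.
apply: (whp_seq (lexx _) (whp_query_all R f _ _)) => bs q2 [-> ->].
exact: whp_ret.
Qed.

Definition ref_crit (r : ref_type) : R := c (current f r.1.1).

(* So the movement of the critical probability pays for new references. *)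
Lemma new_reference_move g j (r : ref_type) : admissible k g -> ~ is_constant g ->
  (j <= m.+1)%N -> `|Phi g (grid j) - (2^-1 + alpha)| <= alpha / 2 ->
  ref_ok (current f r.1.1) r.1.2 r.2 ->
  ref_radius r.1.2 < `|grid j - grid r.1.2| ->
  ref_radius r.1.2 <= 8 / 3 * `|c g - ref_crit r|.
Proof.
move=> ag nc jm hj [ar ncr jrm hjr _] hr.
have [u0 u1 ku] := inv_k_bounds R k_gt0.
have [c1 hd _ _] := coarse_upper k_gt0 ag nc (grid_bounds R jm) hj.
have [c2 hd' _ _] := coarse_upper k_gt0 ar ncr (grid_bounds R jrm) hjr.
have [/andP[c10 c11] _] := crit_probP R ag.1 nc.
have [/andP[c20 c21] _] := crit_probP R ar.1 ncr.
rewrite /ref_crit; move: hr hd hd' c1 c2 c10 c11 c20 c21; rewrite /ref_radius.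
have := @grid_bounds R m r.1.2 jrm; have := @grid_bounds R m j jm.
move: (grid r.1.2) (grid j) (c g) (c (current f r.1.1)) => p0 p c c0.
move=> hp hp0 hr hd hd' c1 c2 c10 c11 c20 c21.
have B1 := @bern_var_dist R c c0 ltac:(lra) ltac:(lra).
have B2 := @bern_var_dist R c0 p0 ltac:(lra) ltac:(lra).
rewrite distrC ger0_norm ?subr_ge0 // in B2.
(* The offsets of the two grid points from their critical points make up about half of the radius;
   the move of c must supply the rest. *)
have tri : `|p - p0| <= (p - c) + `|c - c0| + (p0 - c0).
  have [h|h] := ger0P (p - p0); have [h'|h'] := ger0P (c - c0); lra.
set d := `|c - c0| in B1 tri *; have d0 : 0 <= d by exact: normr_ge0.
have du : d * u <= d by rewrite ler_piMr.
have B1' := ler_wpM2r (ltW u0) B1; have B2' := ler_wpM2r (ltW u0) B2.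
have v0 : 0 <= bern_var c0 by rewrite mulr_ge0; lra.
have h3 : (p0 - c0) * u <= p0 - c0 by rewrite ler_piMr // subr_ge0.
rewrite mulrDl in B1'; rewrite mulrDl in B2'.
by lra.
Qed.

(** The cost, up to constants, of a unit of distance travelled by the critical probability. *)
Definition budget : R := b%:R * k%:R ^+ 7 * L.

Lemma budget_ge1 : 1 <= budget.
Proof.
have k1 : 1 <= k%:R ^+ 7 :> R by rewrite exprn_ege1 // ler1n.
have b1 : 1 <= b%:R :> R by rewrite ler1n.
by apply: mulr_ege1 => //; exact: mulr_ege1.
Qed.

(** Each sample size becomes a length times [budget]: coarse samples cost tol, fine ones the window
    width, a reference its radius. *)
Lemma round_cost_le jp (w : R) (x : nat) : 0 <= w -> (jp <= m.+1)%N ->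
  (x <= ref_size jp)%N ->
  (2 + 2 * (b * coarse_size) + x + fine_size w + b * fine_size w + coarse_size)%:R <=
  budget * (2 ^+ 37 * tol + 2 ^+ 33 * w + 2 ^+ 30 * ref_radius jp) /\
  (2 + 2 * (b * coarse_size) + fine_size w + b * fine_size w + coarse_size)%:R <=
  budget * (2 ^+ 37 * tol + 2 ^+ 33 * w).
Proof.
move=> w0 jm xr; have [u0 u1 ku] := inv_k_bounds R k_gt0.
have b1 : 1 <= b%:R :> R by rewrite ler1n.
have k1 : 1 <= k%:R :> R by rewrite ler1n.
have k4 : 1 <= k%:R ^+ 4 :> R by rewrite exprn_ege1.
have kL : 1 <= k%:R ^+ 4 * L by apply: mulr_ege1.
have bkL : b%:R <= b%:R * (k%:R ^+ 4 * L) by rewrite ler_peMr //; lra.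
have e4 : budget * tol = b%:R * (k%:R ^+ 4 * L) / 64.
  by rewrite /budget /crit_tol; field; rewrite pnatr_eq0 -lt0n.
set y := k%:R ^+ 4 * L in kL bkL e4.
have Cs : coarse_size%:R <= 2 ^+ 28 * y.
  have h : 0 <= 2 ^+ 27 * k%:R ^+ 4 * L by rewrite -mulrA -/y mulr_ge0 ?exprn_ge0 //; lra.
  apply: le_trans (sample_size_le h) _.
  by rewrite -mulrA -/y [2 ^+ 28]exprS; have : 1 <= 2 ^+ 27 * y by [apply: mulr_ege1 => //; apply: exprn_ege1; rewrite ler1n]; lra.
have bCs : b%:R * coarse_size%:R <= 2 ^+ 28 * (b%:R * y).
  by rewrite mulrCA ler_wpM2l.
have ybig : y <= b%:R * y by rewrite ler_peMl //; lra.
set z := b%:R * y in bkL e4 bCs ybig.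
pose W := k%:R ^+ 7 * L * w.
have L0 := ltW L_gt0.
have W0 : 0 <= W by rewrite /W !mulr_ge0 ?exprn_ge0.
have Fs : (fine_size w)%:R <= 2 ^+ 32 * W + 1.
  have -> : 2 ^+ 32 * W = 2 ^+ 32 * k%:R ^+ 7 * w * L by rewrite /W; ring.
  by apply: sample_size_le; rewrite !mulr_ge0 ?exprn_ge0.
have bw : budget * w = b%:R * W by rewrite /budget /W; ring.
have bFs : b%:R * (fine_size w)%:R <= 2 ^+ 32 * (b%:R * W) + b%:R.
  by apply: le_trans (ler_wpM2l _ Fs) _; [lra|rewrite mulrDr mulr1 mulrCA].
have WW : W <= b%:R * W by rewrite ler_peMl.
have /andP[p0 p1] := @grid_bounds R m jp jm.
have pv : 0 <= bern_var (grid jp) by rewrite mulr_ge0; lra.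
have Rr0 : 0 <= ref_radius jp by apply: divr_ge0 => //; apply: mulr_ge0 => //; exact: ltW.
have Rs : (ref_size jp)%:R <= 2 ^+ 30 * (budget * ref_radius jp) + 1.
  have h : 0 <= 2 ^+ 27 * bern_var (grid jp) * k%:R ^+ 6 * L.
    by move: (bern_var _) pv => p pp; rewrite !mulr_ge0 ?exprn_ge0.
  apply: le_trans (sample_size_le h) _; rewrite lerD2r.
  have -> : 2 ^+ 30 * (budget * ref_radius jp) =
      b%:R * (2 ^+ 27 * bern_var (grid jp) * k%:R ^+ 6 * L).
    by rewrite /budget /ref_radius; field; rewrite pnatr_eq0 -lt0n.
  by rewrite ler_peMl.
have xs : x%:R <= (ref_size jp)%:R :> R by rewrite ler_nat.
(* The spare 1 absorbs the rounding in [ref_size]. *)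
have core : (2 + 2 * (b * coarse_size) + fine_size w + b * fine_size w + coarse_size)%:R + 1 <=
    budget * (2 ^+ 37 * tol + 2 ^+ 33 * w).
  rewrite mulrDr mulrCA [budget * (2 ^+ 33 * w)]mulrCA e4 bw.
  rewrite !natrD !natrM.
  have e37 : 2 ^+ 37 * (z / 64) = 8 * (2 ^+ 28 * z) :> R by field.
  have e33 : 2 ^+ 33 * (b%:R * W) = 2 * (2 ^+ 32 * (b%:R * W)) by rewrite (exprS 2 32) -mulrA.
  rewrite e37 e33.
  have z28 : 2 ^+ 28 * y <= 2 ^+ 28 * z by rewrite ler_wpM2l // exprn_ge0.
  have W32 : 2 ^+ 32 * W <= 2 ^+ 32 * (b%:R * W) by rewrite ler_wpM2l // exprn_ge0.
  have z1 : 16 * z <= 2 ^+ 28 * z.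
    have z0 : 0 <= z by lra.
    have p24 : 1 <= 2 ^+ 24 :> R by rewrite exprn_ege1 // ler1n.
    have -> : 2 ^+ 28 = 16 * 2 ^+ 24 :> R by rewrite (exprD 2 4 24) !exprS expr0; ring.
    by have := ler_peMl z0 p24; rewrite -mulrA; lra.
  move: Fs Cs z1 z28 W32 bFs bCs.
  move: (2 ^+ 28 * z) (2 ^+ 32 * (b%:R * W)) (2 ^+ 32 * W) (2 ^+ 28 * y) => Z WWW W' Y.
  by lra.
split; last by lra.
rewrite mulrDr [budget * (2 ^+ 30 * _)]mulrCA.
move: core; rewrite !natrD; lra.
Qed.

End RoundSpecs.

(** * Amortized analysis *)

Section RunInvariants.
Variables (R : realType) (n : nat).
Implicit Types (t : seq (round R n)) (g : cube n -> bool) (x : cube n).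

Lemma fix_coordsE t x :
  fix_coords t x = [ffun i => if i \in returned_set t then chosen_bits t i else x i].
Proof.
apply/ffunP => i; rewrite !ffunE !inE.
elim: t => //= r t IH; rewrite inE ffunE eq_sym.
by case: eqP => // _; rewrite IH.
Qed.

Lemma current_restrict_set g t :
  restrict_set g (returned_set t) (chosen_bits t) = current g t.
Proof. by apply/funext => x; rewrite /current fix_coordsE. Qed.

Lemma current_rcons g t (r : round R n) :
  current g (rcons t r) = restrict (current g t) (r_coord r) (r_bit r).
Proof. by apply/funext => x; rewrite /current /fix_coords foldr_rcons. Qed.

Lemma admissible_current k g t : admissible k g -> admissible k (current g t).
Proof.
elim/last_ind: t => [|t r IH] ag; first exact: ag.
by rewrite current_rcons; apply: admissible_restrict; exact: IH.
Qed.

(** Selected coordinates have positive influence, so every selection is fresh and there are at most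
    [n] rounds. *)
Lemma chosen_no_influence g t i (p : R) : i \in map (@r_coord R n) t ->
  rerand_inf (current g t) p i = 0.
Proof.
move=> it; rewrite rerand_infEx.
have e b : Ex p (fun x => (current g t x != current g t (set_coord x i b))%:R) = 0.
  rewrite -[RHS](Ex_cst n p 0); apply: eq_Ex => x.
  suff -> : current g t (set_coord x i b) = current g t x by rewrite eqxx.
  rewrite /current !fix_coordsE; congr g; apply/ffunP => j; rewrite !ffunE.
  case: ifP => // jt; case: eqP => // ji.
  by rewrite ji inE it in jt.
by rewrite !e !mulr0 addr0 mulr0.
Qed.

Lemma all_chosen_constant g t : uniq (map (@r_coord R n) t) -> (n <= size t)%N ->
  is_constant (current g t).
Proof.
move=> ut st x y; rewrite /current !fix_coordsE; congr g; apply/ffunP => i.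
rewrite !ffunE; suff -> : i \in returned_set t by [].
have h : #|returned_set t| = n.
  rewrite /returned_set cardsE (card_uniqP ut) size_map; apply/eqP.
  rewrite eqn_leq st andbT -(size_map (@r_coord R n)) -(card_uniqP ut).
  by apply: leq_trans (max_card _) _; rewrite card_ord.
have : returned_set t == [set: 'I_n]%SET.
  by rewrite eqEcard finset.subsetT cardsT card_ord h /=.
by move=> /eqP ->; rewrite inE.
Qed.

Fixpoint accurate_prefix (eps del : R) g t : Prop :=
  if t is r :: t' then
    [/\ ~ is_constant g,
        0 <= r_p r <= 1 /\ `|r_p r - crit_prob R g| <= eps,
        forall i, `|r_est r i - rerand_inf g (r_p r) i| <= del
      & accurate_prefix eps del (restrict g (r_coord r) (r_bit r)) t']
  else True.

Lemma accurate_prefix_run eps del g t : accurate_prefix eps del g t ->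
  is_constant (current g t) -> accurate_run eps del g t.
Proof.
elim: t g => [|r t IH] g //= [a b d e] cst; split=> //; exact: IH.
Qed.

Lemma accurate_prefix_rcons eps del g t (r : round R n) : accurate_prefix eps del g t ->
  ~ is_constant (current g t) ->
  0 <= r_p r <= 1 /\ `|r_p r - crit_prob R (current g t)| <= eps ->
  (forall i, `|r_est r i - rerand_inf (current g t) (r_p r) i| <= del) ->
  accurate_prefix eps del g (rcons t r).
Proof.
by elim: t g => [|r' t IH] g /= ; [move=> _ a b d|case=> a b d e h1 h2 h3; split=> //; exact: IH].
Qed.

Lemma largestP (e : 'I_n -> R) : (0 < n)%N ->
  exists2 i, largest e = Some i & forall j, e j <= e i.
Proof.
move=> n0; rewrite /largest; case: pickP => [i /forallP h|h]; first by exists i.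
have [i _ hi] := @arg_maxP _ _ _ (Ordinal n0) xpredT e isT.
by have /forallP := h i; case=> j; apply: hi.
Qed.

End RunInvariants.

Section GreedyRun.
Variables (R : realType) (n k b : nat) (L : R).
Local Notation m := (2 ^ b).-1.
Local Notation u := (k%:R^-1 : R).
Local Notation alpha := (level_step R k).
Local Notation grid := (grid R m).
Local Notation tol := (crit_tol R k).
Local Notation c g := (crit_prob R g).
Local Notation ref_type := (ref_type R n).
Local Notation ref_radius := (ref_radius R k b).
Local Notation coarse_size := (coarse_size k L).
Local Notation ref_size := (ref_size k b L).
Local Notation fine_size := (fine_size k L).
Local Notation coarse_ok := (@coarse_ok R n k b).
Local Notation ref_ok := (@ref_ok R n k b).
Local Notation budget := (budget k b L).
Implicit Types (t : seq (round R n)) (g : cube n -> bool).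
Variable f : cube n -> bool.
Hypotheses (k_gt0 : (0 < k)%N) (L_ge1 : 1 <= L) (b_gt0 : (0 < b)%N)
  (fine_grid : 4096 * k%:R ^+ 3 <= (2 ^ b)%:R :> R).
Hypothesis af : admissible k f.

Let L_gt0 : 0 < L. Proof. by apply: lt_le_trans L_ge1. Qed.

Local Notation ref_crit := (ref_crit f).

(** Before a reference is replaced, c moves by at least 3/8 of its radius and [crit_dist] gains 2/3
    of that, a quarter of the radius. Hence 4 [crit_dist] covers all earlier references, and the
    radius is the debt for the present one. *)
Definition ref_charge (r : ref_type) : R :=
  2 ^+ 30 * (ref_radius r.1.2 + 4 * crit_dist (ref_crit r)).

(* State before a round: every past query is paid for by the distance travelled
   by the critical probability, whose next leg will also pay for the coming
   round; the current reference remains to be paid. *)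
Definition ready t (old : option ref_type) (q : nat) :=
  let g := current f t in
  [/\ (size t)%:R * (4 * tol) <= crit_dist (c g),
    forall jp jm, coarse_ok g jp jm ->
      q%:R + budget * (2 ^+ 37 * tol + 2 ^+ 33 * (grid jp - grid jm)) <=
      budget * (2 ^+ 38 + 2 ^+ 39 * crit_dist (c g) + oapp ref_charge 0 old) &
    forall r, old = Some r -> [/\ ref_ok (current f r.1.1) r.1.2 r.2,
      crit_dist (ref_crit r) + 2 / 3 * `|c g - ref_crit r| <= crit_dist (c g) &
      forall p, `|p - c g| <= tol -> comparable_as (p < 2^-1) g (current f r.1.1)]].

(** The cost clause already includes the samples for the influence estimates that follow. *)
Definition located t (r : ref_type) j (q : nat) :=
  let g := current f t in
  [/\ (j <= m.+1)%N /\ `|grid j - c g| <= tol, ref_ok (current f r.1.1) r.1.2 r.2,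
    crit_dist (ref_crit r) + 2 / 3 * `|c g - ref_crit r| <= crit_dist (c g),
    comparable_as (grid j < 2^-1) g (current f r.1.1) &
    q%:R + coarse_size%:R <= budget * (2 ^+ 38 + 2 ^+ 39 * crit_dist (c g) + ref_charge r)].

Lemma comparable_refl v g : comparable_as v g g.
Proof. by move=> x; case: v; rewrite implybb. Qed.

Lemma whp_locate t mem q : ~ is_constant (current f t) -> ready t mem.1 q ->
  whp f (8 * expR (- L)) (fun pm q' => exists r j,
    pm = (grid j, (Some r, j)) /\ located t r j q') (q + 2) (locate k b L mem t).
Proof.
move=> nc [_ pay refs]; have ag := admissible_current t af.
set g := current f t in nc ag pay refs *.
have E0 := tail_prob_ge0 L.
have -> : 8 * expR (- L) = 4 * expR (- L) + (2 * expR (- L) + (2 * expR (- L) + 0)) by ring.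
apply: whp_bind (whp_coarse_window L k_gt0 fine_grid _ ag nc) _ => //; first by lra.
move=> [jp jm] q1 [ok ->]; have [jpm jmm hjp hjm] := ok.
have hold r : mem.1 = Some r -> ref_ok (current f r.1.1) r.1.2 r.2.
  by move=> /refs[].
apply: whp_bind (whp_reference k_gt0 L_gt0 _ ag nc jpm hjp hold) _; first by lra.
move=> r q2 [rok near origin].
have t0 := ltW (crit_tol_gt0 R k_gt0).
have cmp (p : R) : `|p - c g| <= tol -> comparable_as (p < 2^-1) g (current f r.1.1).
  move=> hp; case: origin => [[/refs[_ _ h] _]|[e _ _]]; first exact: h.
  by rewrite e; exact: comparable_refl.
have cmp0 : comparable_as (c g < 2^-1) g (current f r.1.1).
  by apply: cmp; rewrite subrr normr0.
apply: whp_bind (whp_refine k_gt0 L_gt0 fine_grid _ ag nc cmp0 rok ok near) _ => //.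
move=> j q3 [jm' hj ->]; apply: whp_ret; exists r, j; split=> //.
have [cq _ _ _] := coarse_upper k_gt0 ag nc (grid_bounds R jpm) hjp.
have [qc _ _ _] := coarse_lower k_gt0 ag nc (grid_bounds R jmm) hjm.
set w := grid jp - grid jm; have w0 : 0 <= w by rewrite /w; lra.
have [cost1 cost2] := round_cost_le k_gt0 L_ge1 b_gt0 w0 jpm (leqnn _).
have payw := pay _ _ ok; rewrite -/w in payw.
have V0 : 0 <= budget by apply: le_trans (budget_ge1 k_gt0 L_ge1 b_gt0).
rewrite !natrD in cost1 cost2.
case: origin => [[old ->]|[e far ->]].
  have [_ h3 _] := refs _ old.
  split=> //; first exact: cmp.
  by rewrite old /= in payw; rewrite !natrD; lra.
have rc : ref_crit r = c g by rewrite /ref_crit e.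
split=> //; [by rewrite rc subrr normr0 mulr0 addr0|exact: cmp|].
have ch : oapp ref_charge 0 mem.1 + 2 ^+ 30 * ref_radius jp <= ref_charge r.
  rewrite /ref_charge rc e /= [X in _ <= X]mulrDr addrC lerD2l.
  case old: mem.1 => [r'|] /=; last first.
    by apply: mulr_ge0; [exact: exprn_ge0|apply: mulr_ge0 => //; exact: normr_ge0].
  have [rok' h3 _] := refs _ old.
  have := new_reference_move k_gt0 ag nc jpm hjp rok' (far _ old).
  by move=> hm; apply: ler_wpM2l; [exact: exprn_ge0|lra].
have ch' := ler_wpM2l V0 ch.
by rewrite !natrD; lra.
Qed.

End GreedyRun.

(** * The loop invariant and the success probability *)

Section GreedyLoop.
Variables (R : realType) (n k b : nat) (L : R).
Local Notation m := (2 ^ b).-1.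
Local Notation u := (k%:R^-1 : R).
Local Notation alpha := (level_step R k).
Local Notation grid := (grid R m).
Local Notation tol := (crit_tol R k).
Local Notation c g := (crit_prob R g).
Local Notation ref_type := (ref_type R n).
Local Notation coarse_size := (coarse_size k L).
Local Notation coarse_ok := (@coarse_ok R n k b).
Local Notation budget := (budget k b L).
Implicit Types (t : seq (round R n)) (g : cube n -> bool).
Variable f : cube n -> bool.
Hypotheses (k_gt0 : (0 < k)%N) (L_ge1 : 1 <= L) (b_gt0 : (0 < b)%N)
  (fine_grid : 4096 * k%:R ^+ 3 <= (2 ^ b)%:R :> R).
Hypothesis af : admissible k f.

Local Notation ref_crit := (ref_crit f).
Local Notation ready := (@ready R n k b L f).
Local Notation located := (@located R n k b L f).
Local Notation eps := (64^-1 / k%:R ^+ 3 : R).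
Local Notation del := (8^-1 / k%:R ^+ 2 : R).

Lemma epsE : eps = tol.
Proof. by rewrite /crit_tol; field; rewrite pnatr_eq0 -lt0n. Qed.

Lemma delE : del = u ^+ 2 / 8.
Proof. by field; rewrite pnatr_eq0 -lt0n. Qed.

(* The level sets searched in the new window lie beyond the point from which Phi
   was pushed away, so the window is no wider than the move of the critical
   probability. *)
Lemma window_charge g jp jm v p c0 : admissible k g -> ~ is_constant g ->
  coarse_ok g jp jm -> 0 <= p <= 1 -> pushed k v g p -> `|p - c0| <= tol ->
  6 * tol <= `|c g - c0| -> grid jp - grid jm <= 16 * `|c g - c0|.
Proof.
move=> ag nc [jpm jmm hjp hjm] hp push near far; have [mg cg] := ag.
have [cq _ wp wp'] := coarse_upper k_gt0 ag nc (grid_bounds R jpm) hjp.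
have [qc _ wm wm'] := coarse_lower k_gt0 ag nc (grid_bounds R jmm) hjm.
have [_ _ s1 _] := slope_crit R k_gt0 ag nc.
set s := slope g (c g) in wp wp' wm wm' s1.
have s0 : 0 < s by lra.
(* Both half-widths lie between alpha/(4 s) and 3 alpha/s. The window is thus at most 13 times the
   half facing p, which is at most 7/6 of the move, and 13 * 7/6 < 16. *)
have r1 : grid jp - c g <= 12 * (c g - grid jm).
  by rewrite -(ler_pM2l s0); lra.
have r2 : c g - grid jm <= 12 * (grid jp - c g).
  by rewrite -(ler_pM2l s0); lra.
have /andP[p0 p1] := hp.
have /andP[a0 _] := level_step_bounds R k_gt0.
have aE : 1024 * alpha = u ^+ 2 by rewrite /level_step; field; rewrite pnatr_eq0 -lt0n.
move: hjp hjm near; rewrite !ler_norml => /andP[x1 x2] /andP[y1 y2] /andP[z1 z2].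
move: push; rewrite /pushed; case: v => push.
  have pq : grid jp <= p.
    rewrite leNgt; apply/negP => lt.
    have /andP[_ jp1] := grid_bounds R jpm.
    by have := Phi_le mg p0 (ltW lt) jp1; lra.
  have := ler_norm (c0 - c g); rewrite distrC; lra.
have pq : p <= grid jm.
  rewrite leNgt; apply/negP => lt.
  have /andP[jm0 _] := grid_bounds R jmm.
  by have := Phi_le mg jm0 (ltW lt) p1; lra.
by have := ler_norm (c g - c0); lra.
Qed.

Lemma pow2_values : [/\ 2 ^+ 33 = 8 * 2 ^+ 30 :> R, 2 ^+ 37 = 128 * 2 ^+ 30 :> R,
  2 ^+ 38 = 256 * 2 ^+ 30 :> R, 2 ^+ 39 = 512 * 2 ^+ 30 :> R &
  2 ^+ 40 = 1024 * 2 ^+ 30 :> R].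
Proof.
by split; [rewrite (exprD 2 3 30)|rewrite (exprD 2 7 30)|rewrite (exprD 2 8 30)|
  rewrite (exprD 2 9 30)|rewrite (exprD 2 10 30)]; congr (_ * _); rewrite !exprS expr0; ring.
Qed.

Lemma tol_small : tol <= 64^-1.
Proof.
have [u0 u1 _] := inv_k_bounds R k_gt0.
have : u ^+ 3 <= 1 by rewrite expr_le1 // ltW.
by rewrite /crit_tol; lra.
Qed.

Lemma set_coord_le g i v x : monotone g ->
  if v then g x ==> g (set_coord x i v) else g (set_coord x i v) ==> g x.
Proof.
by move=> mg; case: v; apply: mg => j; rewrite ffunE; case: eqP => //;
  rewrite ?implybT ?implybb.
Qed.

Lemma comparable_restrict v g g0 i : monotone g -> comparable_as v g g0 ->
  comparable_as v (restrict g i v) g0.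
Proof.
move=> mg h x; have := h x; have := set_coord_le i v x mg; rewrite /restrict.
by case: v {h}; case: (g x); case: (g _); case: (g0 x).
Qed.

Lemma next_ready t r j q i p (e : 'I_n -> R) : p = grid j ->
  ~ is_constant (current f t) ->
  (size t)%:R * (4 * tol) <= crit_dist (c (current f t)) ->
  located t r j q -> u ^+ 2 / 2 <= rerand_inf (current f t) p i ->
  let rd := Round p e i (p < 2^-1) in
  ~ is_constant (current f (rcons t rd)) -> ready (rcons t rd) (Some r) (q + coarse_size).
Proof.
move=> pE nc size_t [[jm near] rok dist cmp cost] inf rd nc'.
have ag := admissible_current t af; have ag' := admissible_current (rcons t rd) af.
have [u0 u1 ku] := inv_k_bounds R k_gt0.
have t0 := crit_tol_gt0 R k_gt0.
rewrite -pE in near cmp.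
have p01 : 0 <= p <= 1 by rewrite pE; exact: grid_bounds.
have push : pushed k (p < 2^-1) (current f (rcons t rd)) p.
  by rewrite current_rcons; apply: step_pushed.
have [far prog side] := crit_progress k_gt0 near (crit_pushed k_gt0 ag' nc' p01 push).
split.
- by rewrite size_rcons -natr1; lra.
- move=> jp jm' ok.
  have wide := window_charge ag' nc' ok p01 push near far.
  have V1 := budget_ge1 k_gt0 L_ge1 b_gt0.
  have P0 : 0 < 2 ^+ 30 :> R by rewrite exprn_gt0.
  have [P33 P37 P38 P39 _] := pow2_values.
  set w := grid jp - grid jm' in wide *.
  set c1 := c (current f (rcons t rd)) in far prog wide *.
  set c0 := c (current f t) in far prog wide cost *.
  (* In units of 2^30, for a move d >= 6 tol: 128 tol + 8 * 16 d is below 512 * 2/3 d. *)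
  have h : 2 ^+ 37 * tol + 2 ^+ 33 * w + 2 ^+ 39 * crit_dist c0 <= 2 ^+ 39 * crit_dist c1.
    rewrite P37 P33 P39.
    have := ler_wpM2l (ltW P0) (_ : 128 * tol + 8 * w + 512 * crit_dist c0 <= 512 * crit_dist c1).
    by move=> /(_ ltac:(lra)); lra.
  have V0 : 0 <= budget by lra.
  by have := ler_wpM2l V0 h; rewrite natrD /=; lra.
move=> _ [<-]; split=> //.
  have := ler_distD (c (current f t)) (c (current f (rcons t rd))) (ref_crit r).
  by lra.
move=> p' hp'.
(* The new critical probability is at least 7 tol away from 1/2, so an error of tol cannot change
   the direction. *)
have -> : (p' < 2^-1) = (p < 2^-1).
  move: hp' side; rewrite ler_norml => /andP[a a'].
  by case: ifP => _ side; [apply/idP|apply/negbTE; rewrite -leNgt]; lra.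
by rewrite current_rcons; apply: comparable_restrict => //; exact: ag.1.
Qed.

(** At most [n] rounds select a coordinate; one more pass finds the function constant. *)
Definition greedy : implementation R n :=
  @Implementation R n (option ref_type * nat) (None, 0%N) n.+1
    (@nonconstancy_test R n) (locate k b L) (influences k b L).

(** [ready] speaks of a critical probability, so it is required only of nonconstant restrictions.
    The extra 4 tol in the size bound is for the last round, after which there is no critical
    probability left to measure progress. *)
Definition loop_inv t (old : option ref_type) q :=
  [/\ accurate_prefix eps del f t, uniq (map (@r_coord R n) t),
    (size t)%:R * (4 * tol) <= 4 * tol + 2^-1, q%:R <= budget * 2 ^+ 40 &
    ~ is_constant (current f t) -> ready t old q].

Definition success t (q : nat) :=
  [/\ accurate_run eps del f t, q%:R <= budget * 2 ^+ 41,
    #|returned_set t|%:R <= 9 * k%:R ^+ 3 :> R &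
    is_constant (restrict_set f (returned_set t) (chosen_bits t))].

Lemma loop_inv_start : loop_inv [::] None 0.
Proof.
have t0 := crit_tol_gt0 R k_gt0; have t1 := tol_small.
have V1 := budget_ge1 k_gt0 L_ge1 b_gt0.
have P0 : 0 < 2 ^+ 30 :> R by rewrite exprn_gt0.
split=> //=; [by lra|by rewrite mulr_ge0 ?exprn_ge0 //; lra|].
move=> nc; split=> //; first by rewrite mul0r; exact: normr_ge0.
move=> jp jm [jpm jmm _ _] /=.
have /andP[a a'] := grid_bounds R jpm; have /andP[d d'] := grid_bounds R jmm.
rewrite add0r addr0; have [P33 P37 P38 P39 _] := pow2_values.
set w := grid jp - grid jm.
set x := crit_dist _; have x0 : 0 <= x by exact: normr_ge0.
apply: ler_wpM2l; first by lra.
rewrite P37 P33 P38 P39.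
have := ler_wpM2l (ltW P0) (_ : 128 * tol + 8 * w <= 256 + 512 * x).
by move=> /(_ ltac:(rewrite /w; lra)); lra.
Qed.

Lemma crit_dist_le g : monotone g -> ~ is_constant g -> crit_dist (c g) <= 2^-1.
Proof.
move=> mg nc; have [/andP[c0 c1] _] := crit_probP R mg nc.
by rewrite /crit_dist ler_norml; lra.
Qed.

Lemma located_total t r j q : ~ is_constant (current f t) -> located t r j q ->
  (q + coarse_size)%:R <= budget * 2 ^+ 40.
Proof.
move=> nc [_ [ar ncr jrm _ _] _ _ cost]; rewrite natrD.
have V1 := budget_ge1 k_gt0 L_ge1 b_gt0.
have P0 : 0 < 2 ^+ 30 :> R by rewrite exprn_gt0.
have [P33 P37 P38 P39 P40] := pow2_values.
have d1 := crit_dist_le (admissible_current t af).1 nc.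
have d2 : crit_dist (ref_crit r) <= 2^-1 := crit_dist_le ar.1 ncr.
have [u0 u1 _] := inv_k_bounds R k_gt0.
have rr : ref_radius R k b r.1.2 <= 1.
  have v4 := bern_var_le (grid r.1.2).
  rewrite /ref_radius; have := ler_wpM2r (ltW u0) v4; lra.
apply: le_trans cost _; apply: ler_wpM2l; first by lra.
rewrite /ref_charge P38 P39 P40.
have := ler_wpM2l (ltW P0) (_ : 256 + 512 * crit_dist (c (current f t)) +
  (ref_radius R k b r.1.2 + 4 * crit_dist (ref_crit r)) <= 1024).
by move=> /(_ ltac:(lra)); lra.
Qed.

Lemma success_of_inv t old q : loop_inv t old q -> is_constant (current f t) ->
  success t (q + 2).
Proof.
move=> [pre ut st tot _] cst.
have V1 := budget_ge1 k_gt0 L_ge1 b_gt0.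
have k1 : 1 <= k%:R ^+ 3 :> R by rewrite exprn_ege1 // ler1n.
have P0 : 1 <= 2 ^+ 40 :> R by rewrite exprn_ege1 // ler1n.
split.
- exact: accurate_prefix_run.
- rewrite natrD (exprS 2 40).
  have : 1 <= budget * 2 ^+ 40 by apply: mulr_ege1.
  have : 2 <= budget * 2 ^+ 40.
    have P1 : 2 <= 2 ^+ 40 :> R.
      by rewrite (exprS 2 39); have : 1 <= 2 ^+ 39 :> R by [rewrite exprn_ege1 // ler1n]; lra.
    by have := ler_peMl (le_trans ler01 P0) V1; lra.
  by lra.
- have h : #|returned_set t|%:R <= (size t)%:R :> R.
    rewrite ler_nat /returned_set cardsE; apply: leq_trans (card_size _) _.
    by rewrite size_map.
  apply: le_trans h _.
  have := ler_wpM2r (_ : 0 <= 16 * k%:R ^+ 3) st.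
  have -> : (size t)%:R * (4 * tol) * (16 * k%:R ^+ 3) = (size t)%:R.
    by rewrite /crit_tol; field; rewrite pnatr_eq0 -lt0n.
  have -> : (4 * tol + 2^-1) * (16 * k%:R ^+ 3) = 1 + 8 * k%:R ^+ 3.
    by rewrite /crit_tol; field; rewrite pnatr_eq0 -lt0n.
  by move=> /(_ ltac:(lra)); lra.
by rewrite current_restrict_set.
Qed.

Lemma greedy_loopS fuel (mem : option ref_type * nat) t :
  @main_loop R n greedy fuel.+1 mem t =
  bind (nonconstancy_test mem t) (fun '(nonconst, s1) =>
    if nonconst then
      bind (locate k b L s1 t) (fun '(p, s2) =>
      bind (influences k b L s2 t p) (fun '(e, s3) =>
      if largest e is Some i then
        @main_loop R n greedy fuel s3 (rcons t (Round p e i (p < 2^-1)))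
      else Ret t))
    else Ret t).
Proof. by []. Qed.

Lemma whp_greedy_loop fuel t mem q : (fuel + size t)%N = n.+1 -> loop_inv t mem.1 q ->
  whp f (fuel%:R * ((8 + 2 * n%:R) * expR (- L))) success q (@main_loop R n greedy fuel mem t).
Proof.
elim: fuel t mem q => [|fuel IH] t mem q.
  (* Running out of fuel would mean n + 1 distinct coordinates. *)
  move=> st [_ ut _ _ _]; exfalso; rewrite add0n in st.
  have sub : {subset map (@r_coord R n) t <= enum 'I_n} by move=> i _; rewrite mem_enum.
  by have := uniq_leq_size ut sub; rewrite size_map size_enum_ord st ltnn.
move=> st inv; have E0 := tail_prob_ge0 L.
have n0 : 0 <= n%:R :> R by [].
have d0 : 0 <= fuel%:R * ((8 + 2 * n%:R) * expR (- L)).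
  by apply: mulr_ge0 => //; apply: mulr_ge0 => //; lra.
have d1 : 0 <= 2 * n%:R * expR (- L) by apply: mulr_ge0 => //; lra.
have d2 : 0 <= 8 * expR (- L) by lra.
set g := current f t; have ag : admissible k g := admissible_current t af.
have -> : fuel.+1%:R * ((8 + 2 * n%:R) * expR (- L)) =
    8 * expR (- L) + (2 * n%:R * expR (- L) + fuel%:R * ((8 + 2 * n%:R) * expR (- L))).
  by rewrite -natr1; ring.
rewrite greedy_loopS.
apply: whp_seq (whp_nonconstancy_test f t mem q) _; first by lra.
move=> [nb s1] q1 []; cbn [fst snd] => -> -> ->; cbv beta iota.
case: ifPn => [/eqP ne|]; last first.
  rewrite negbK => /eqP eq01; have ok := success_of_inv inv (constant_monotone ag.1 eq01).
  by apply: (@whp_mono R n f _ 0 _ success success) => //; [lra|exact: whp_ret].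
have nc : ~ is_constant g by move=> cst; apply: ne; exact: cst.
have [pre ut size_t tot rdy] := inv; have {}rdy := rdy nc.
apply: whp_bind (whp_locate k_gt0 L_ge1 b_gt0 fine_grid af nc rdy) _; first by lra.
move=> [p s2] q2 [r [j [[pE ->] loc]]]; cbv beta iota.
have [[jm near] _ _ _ _] := loc.
apply: whp_bind (@whp_influences R n k b L f k_gt0 t (Some r, j) p q2 ag.1 jm) _ => //.
move=> [e s3] q3 []; cbn [fst snd] => -> he ->; cbv beta iota.
have szn : (size t < n)%N.
  by rewrite ltnNge; apply/negP => h; apply: nc; exact: all_chosen_constant.
have [i -> hi] := largestP e (leq_ltn_trans (leq0n _) szn).
have p01 : 0 <= grid j <= 1 by exact: grid_bounds.
have inf := selected_influence k_gt0 ag nc p01 near he hi.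
rewrite pE; set rd := Round _ _ _ _.
apply: IH; first by rewrite size_rcons -addSnnS.
cbn [fst snd].
have [size_t' _ _] := rdy.
have t0 := crit_tol_gt0 R k_gt0.
split.
- apply: accurate_prefix_rcons => //=; rewrite ?epsE ?delE //.
- rewrite map_rcons rcons_uniq ut andbT; apply/negP => it.
  have := chosen_no_influence f (grid j) it; move: inf; rewrite /g => inf e0.
  have [u0 _ _] := inv_k_bounds R k_gt0.
  have : 0 < u ^+ 2 by rewrite exprn_gt0.
  by rewrite e0 in inf; lra.
- by rewrite size_rcons -natr1; have := crit_dist_le ag.1 nc; lra.
- exact: located_total nc loc.
- by apply: (@next_ready t r j q2 i (grid j) e).
Qed.

End GreedyLoop.

(** * Choice of constants *)

Section Constants.
Variable R : realType.

Lemma ln_nat_ge0 n : 0 <= ln (n%:R : R).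
Proof.
case: n => [|n]; first by rewrite ln0.
by rewrite ln_ge0 // ler1n.
Qed.

(** exp(1/2) <= 1 + 1/2 + 2/4 = 2. *)
Lemma ln2_ge : 2^-1 <= ln (2 : R).
Proof.
have h := @expR_le_quad R 2^-1 (lexx _).
rewrite -[2^-1]expRK ler_ln ?posrE ?expR_gt0 //.
by apply: le_trans h _; rewrite expr2; lra.
Qed.

Definition grid_bits k := up_log 2 (2 ^ 12 * k ^ 3)%N.

Lemma grid_bits_fine k : 4096 * k%:R ^+ 3 <= (2 ^ grid_bits k)%:R :> R.
Proof.
have -> : 4096 * k%:R ^+ 3 = (2 ^ 12 * k ^ 3)%:R :> R.
  by rewrite natrM !natrX; congr (_ * _); rewrite !exprS expr0; ring.
by rewrite ler_nat up_logP.
Qed.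

(** Minimality gives (b - 1) ln 2 <= 12 ln 2 + 3 ln k, hence b ln 2 <= 13 ln 2 + 3 ln k <= 16 ln
    (k+1). The shift to k+1 keeps the right side positive at k = 1. *)
Lemma grid_bits_bounds k : (0 < k)%N ->
  (0 < grid_bits k)%N /\ (grid_bits k)%:R * ln 2 <= 16 * ln k.+1%:R :> R.
Proof.
move=> k0; have big : (1 < 2 ^ 12 * k ^ 3)%N.
  by apply: (@leq_trans (2 ^ 12 * 1)%N); rewrite ?leq_mul2l ?expn_gt0 ?k0.
have b0 : (0 < grid_bits k)%N by rewrite up_log_gt0.
split=> //; have /andP[lt _] := up_log_bounds (isT : (1 < 2)%N) big.
rewrite -/(grid_bits k) in lt.
have k0' : 0 < k%:R :> R by rewrite ltr0n.
have h : ln ((2 ^ (grid_bits k).-1)%:R : R) <= ln (2 ^ 12 * k ^ 3)%:R.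
  by rewrite ler_ln ?posrE ?ltr0n ?muln_gt0 ?expn_gt0 ?k0 // ler_nat ltnW.
rewrite natrM !natrX lnM ?posrE ?exprn_gt0 // !lnXn // in h.
have l1 : ln (2 : R) <= ln k.+1%:R by rewrite ler_ln ?posrE ?ltr0n // ler_nat.
have l2 : ln (k%:R : R) <= ln k.+1%:R by rewrite ler_ln ?posrE ?ltr0n // ler_nat.
rewrite -!(mulr_natl (ln _)) in h.
rewrite -(prednK b0) -natr1 mulrDl mul1r.
by lra.
Qed.

(** There are 8 + 2 n tails per round and n + 1 rounds; (n+1) (8+2n) <= n^2 n^4 for n >= 2 explains
    the exponent c + 6. *)
Lemma failure_bound (n c : nat) : (1 < n)%N ->
  n.+1%:R * ((8 + 2 * n%:R) * expR (- ((c + 6)%:R * ln n%:R))) <= (n%:R ^+ c)^-1 :> R.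
Proof.
move=> n1; have n0 : 0 < n%:R :> R by rewrite ltr0n ltnW.
rewrite expRN expRM_natl lnK ?posrE // exprD invfM.
have c0 : 0 < n%:R ^+ c :> R by rewrite exprn_gt0.
have n6 : 0 < n%:R ^+ 6 :> R by rewrite exprn_gt0.
rewrite !mulrA mulrAC -[X in _ <= X]mul1r ler_pM2r ?invr_gt0 //.
rewrite ler_pdivrMr // mul1r.
have -> : 8 + 2 * n%:R = (8 + 2 * n)%:R :> R by rewrite natrD natrM.
rewrite -natrM -natrX ler_nat (expnD n 2 4).
apply: leq_mul.
  apply: (@leq_trans (2 * n)%N); first by rewrite mul2n -addnn -addn1 leq_add2l ltnW.
  by rewrite expnS expn1 leq_mul2r n1 orbT.
apply: (@leq_trans (4 * n + 2 * n)%N).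
  by rewrite leq_add2r (leq_mul2l 4 2) n1.
apply: (@leq_trans (2 * 2 * 2 * n)%N); first by rewrite -mulnDl leq_mul2r orbT.
by rewrite !expnS expn0 muln1 !mulnA !leq_mul.
Qed.

End Constants.

(** Declares the function constant without a query; meant for n <= 1 or k = 0, where the query bound
    is 0. *)
Definition idle (R : realType) n : implementation R n :=
  @Implementation R n unit tt 1 (fun _ _ => Ret (false, tt)) (fun _ _ => Ret (0, tt))
    (fun _ _ _ => Ret (fun=> 0, tt)).

Theorem theorem3 (R : realType) :
  exists Ceps Cinf Csize : R, forall c : nat,
  exists (Cquery : R) (I : forall n k : nat, implementation R n),
  forall (n k : nat) (f : cube n -> bool),
    monotone f -> (cert_complexity f <= k)%N ->
    1 - (n%:R ^+ c)^-1 <=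
    run_prob R f
      (fun (t : seq (round R n)) (q : nat) =>
        [/\ accurate_run (Ceps / k%:R ^+ 3) (Cinf / k%:R ^+ 2) f t,
            q%:R <= Cquery * k%:R ^+ 7 * ln k.+1%:R * ln n%:R,
            #|returned_set t|%:R <= Csize * k%:R ^+ 3
          & is_constant (restrict_set f (returned_set t) (chosen_bits t))])
      0 (algorithm (I n k)).
Proof.
exists 64^-1, 8^-1, 9 => c.
exists (2 ^+ 41 * (c + 6)%:R * 16 / ln 2), (fun n k =>
  if (1 < n)%N && (0 < k)%N then greedy n k (grid_bits k) ((c + 6)%:R * ln n%:R : R)
  else idle R n).
move=> n k f mf ck; have cf := certs_complexity ck.
have ln2 : 2^-1 <= ln (2 : R) by exact: ln2_ge.
have lnk := ln_nat_ge0 R k.+1; have lnn := ln_nat_ge0 R n.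
case: (boolP ((1 < n)%N && (0 < k)%N)) => [/andP[n1 k0]|small]; last first.
  (* For n = 1 the required probability is 0; for n = 0 or k = 0 the function is constant. *)
  have [n1|n1] := eqVneq n 1%N.
    suff h : 1 - (n%:R ^+ c)^-1 <= 0 :> R by apply: (le_trans h); exact: run_prob_ge0.
    by rewrite n1 expr1n invr1 subrr.
  have cst : is_constant f.
    move: small; rewrite negb_and -!leqNgt => /orP[n0|k0] x y.
      have {}n0 : n = 0%N by case: n n1 n0 {f mf ck cf x y lnn} => [|[|]].
      by congr f; apply/ffunP => i; have := ltn_ord i; rewrite {2}n0.
    have [S /certP hS] := cf x; move: k0; rewrite leqn0 => /eqP ->.
    rewrite leqn0 cards_eq0 => /eqP S0; apply/esym/hS => i.
    by rewrite S0 inE.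
  rewrite /= asboolT ?gerBl ?invr_ge0 ?exprn_ge0 //; split=> //.
  - by rewrite !mulr_ge0 ?exprn_ge0 // invr_ge0; lra.
  - rewrite (_ : returned_set [::] = finset.set0) ?cards0; last first.
      by apply/setP => i; rewrite !inE.
    by rewrite mulr_ge0 ?exprn_ge0.
  by move=> x y; apply: cst.
have [b0 bk] := grid_bits_bounds R k0.
have ln2n : ln (2 : R) <= ln n%:R by rewrite ler_ln ?posrE ?ltr0n ?ler_nat // ltnW.
have L1 : 1 <= (c + 6)%:R * ln n%:R :> R.
  have h : 6 * ln n%:R <= (c + 6)%:R * ln n%:R :> R by rewrite ler_wpM2r // ler_nat leq_addl.
  by lra.
have af : admissible k f by [].
have inv := @loop_inv_start R n k (grid_bits k) _ f k0 L1 b0.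
have run := @whp_greedy_loop R n k (grid_bits k) _ f k0 L1 b0 (grid_bits_fine R k) af
  n.+1 [::] (None, 0%N) 0 (addn0 n.+1) inv.
apply: whp_mono run; first exact: failure_bound.
move=> t q [acc cost size cst]; split=> //.
apply: le_trans cost _; rewrite /budget.
have -> : (grid_bits k)%:R * k%:R ^+ 7 * ((c + 6)%:R * ln n%:R) * 2 ^+ 41 =
    ((grid_bits k)%:R * ln 2) * (2 ^+ 41 * (c + 6)%:R / ln 2 * k%:R ^+ 7 * ln n%:R) :> R.
  by field; lra.
have -> : 2 ^+ 41 * (c + 6)%:R * 16 / ln 2 * k%:R ^+ 7 * ln k.+1%:R * ln n%:R =
    (16 * ln k.+1%:R) * (2 ^+ 41 * (c + 6)%:R / ln 2 * k%:R ^+ 7 * ln n%:R) :> R.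
  by field; lra.
apply: ler_wpM2r => //.
by rewrite !mulr_ge0 ?exprn_ge0 // invr_ge0; lra.
Qed.
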